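(* Let $0<q<1$ and let $\alpha=(a,b,c,d)$ be generic complex parameters with $\mathrm{Re}(a)>0$. Then for all $(\gamma,x)\in\mathbb{C}^\times\times\mathbb{C}^\times$ the analytic part $\phi_\gamma^{an}(x)=\phi_\gamma^{an}(x;\alpha;q)$ of the Askey-Wilson function satisfies $$\phi_\gamma^{an}(x)=G^{\tau\sigma\tau}(s_0^\tau)^{-1}\sum_{s\in \mathcal{S}^\tau}h^{\tau\sigma}(s)\,G^{\tau\sigma\tau}(s)\,E^{\sigma\tau}_s(\gamma)\,E^\tau_s(x)$$ $$=\sum_{m=0}^\infty {}_{4}\phi_3\left(\begin{matrix} q^{-m}, q^mabc/d, ax, a/x\\ ab,ac,qa/d\end{matrix}\,; q,q\right)\,{}_{4}\phi_3\left(\begin{matrix} q^{-m}, q^mabc/d, \tilde{a}\gamma, \tilde{a}/\gamma\\ ab,ac,bc \end{matrix}\,; q,q\right)\,\frac{(1-abcq^{2m}/d)\,(abc/d,ab,ac;q)_m}{(1-abc/d)\,(q,qb/d,qc/d;q)_m}\left(\frac{-1}{ad}\right)^mq^{m(m+1)/2}.$$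
   Context: Notation. $0<q<1$; $\mathbb{Z}_+=\{0,1,2,\dots\}$; $\mathbb{C}^\times=\mathbb{C}\setminus\{0\}$; $(x;q)_k=\prod_{i=0}^{k-1}(1-xq^i)$ for $k\in\mathbb{Z}_+\cup\{\infty\}$, $(x_1,\dots,x_r;q)_k=\prod_i(x_i;q)_k$. The series ${}_4\phi_3\left(\begin{matrix}a_1,\dots,a_4\\ b_1,b_2,b_3\end{matrix};q,z\right)=\sum_{k\ge0}\frac{(a_1,\dots,a_4;q)_k}{(q,b_1,b_2,b_3;q)_k}z^k$. The very-well-poised series is ${}_8W_7(A;b,c,d,e,f;q,z)=\sum_{k\ge 0}\frac{1-Aq^{2k}}{1-A}\frac{(A,b,c,d,e,f;q)_kz^k}{(q,qA/b,qA/c,qA/d,qA/e,qA/f;q)_k}$. The square root is the branch positive on $\mathbb{R}_{>0}$ with cut along $(-\infty,0)$. ''Generic'' means that the parameters avoid the exceptional proper subvarieties on which some expression involved is ill-defined (vanishing denominators, coinciding poles that are supposed to be simple, etc.). Involutions on parameters $\alpha=(a,b,c,d)$: $\alpha_\sigma=(a_\sigma,b_\sigma,c_\sigma,d_\sigma)=(\tilde a,\tilde b,\tilde c,\tilde d)$ with $\tilde a=\sqrt{q^{-1}abcd}$, $\tilde b=ab/\tilde a$, $\tilde c=ac/\tilde a$, $\tilde d=ad/\tilde a$; and $\alpha_\tau=(a,b,c,q/d)$. Compositions are read left to right: $\alpha_{\sigma\tau}$ means first apply $\sigma$ to $\alpha$, then apply $\tau$ to $\alpha_\sigma$, so $\alpha_{\sigma\tau}=(\tilde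 a,\tilde b,\tilde c,q/\tilde d)$. For an object $H=H(\alpha)$, $H^{\sigma\tau}$ etc. denotes $H(\alpha_{\sigma\tau})$. Askey-Wilson polynomials: $\mathcal{S}=\mathcal{S}(\alpha;q)=\{s_m=s_m(\alpha;q)=\tilde aq^m : m\in\mathbb{Z}_+\}$ and $E_{s_n}(x)=E_{s_n}(x;\alpha;q)={}_4\phi_3\left(\begin{matrix}q^{-n},q^{n-1}abcd,ax,a/x\\ ab,ac,ad\end{matrix};q,q\right)$. One has $\mathcal{S}^\tau=\mathcal{S}^{\sigma\tau}$ with $s_m^\tau=s_m^{\sigma\tau}=q^m\sqrt{abc/d}$. The weights $h^{\sigma}(s)=\widetilde h(s)$ ($s\in\mathcal{S}$) are $\widetilde h(s_m)=\frac{(1-q^{2m-1}abcd)(q^{-1}abcd,ab,ac,ad;q)_m}{(1-q^{-1}abcd)(q,bc,bd,cd;q)_m}a^{-2m}$; hence $h^{\tau\sigma}(s_m^\tau)=\frac{(1-abcq^{2m}/d)(abc/d,ab,ac,qa/d;q)_m}{(1-abc/d)(q,bc,qb/d,qc/d;q)_m}a^{-2m}$. Gaussian: $G(x)=G(x;\alpha;q)=(dx,d/x;q)_\infty^{-1}$. Askey-Wilson function: $\phi_\gamma(x)=\phi_\gamma(x;\alpha;q)$ is defined for $|q/\tilde d\gamma|<1$ by $$\phi_\gamma(x)=\frac{(qax\gamma/\tilde d,qa\gamma/\tilde dx,qabc/d;q)_\infty}{(\tilde a\tilde b\tilde c\gamma,q\gamma/\tilde d,qx/d,q/dx,bc,qb/d,qc/d;q)_\infty}\,{}_8W_7(\tilde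 a\tilde b\tilde c\gamma/q;ax,a/x,\tilde a\gamma,\tilde b\gamma,\tilde c\gamma;q,q/\tilde d\gamma),$$ and extended meromorphically to $(\gamma,x)\in\mathbb{C}^\times\times\mathbb{C}^\times$ by the (equal) expression $$\phi_\gamma(x)=\frac{(qabc/d;q)_\infty}{(bc,qa/d,qb/d,qc/d,q/ad;q)_\infty}\,{}_4\phi_3\left(\begin{matrix}ax,a/x,\tilde a\gamma,\tilde a/\gamma\\ ab,ac,ad\end{matrix};q,q\right)+\frac{(ax,a/x,\tilde a\gamma,\tilde a/\gamma,qabc/d;q)_\infty}{(qx/d,q/dx,q\gamma/\tilde d,q/\tilde d\gamma,ab,ac,bc,qa/d,ad/q;q)_\infty}\,{}_4\phi_3\left(\begin{matrix}qx/d,q/dx,q\gamma/\tilde d,q/\tilde d\gamma\\ qb/d,qc/d,q^2/ad\end{matrix};q,q\right).$$ Its analytic part is $\phi_\gamma^{an}(x)=G^\tau(x)^{-1}G^{\sigma\tau}(\gamma)^{-1}\phi_\gamma(x)=(qx/d,q/dx,q\gamma/\tilde d,q/\tilde d\gamma;q)_\infty\,\phi_\gamma(x)$, which is analytic on $\mathbb{C}^\times\times\mathbb{C}^\times$. *)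

(* Defs.v *)
From Stdlib Require Import Reals List ClassicalEpsilon.
From Coquelicot Require Import Coquelicot.
Import ListNotations.

Open Scope C_scope.

(** [iota] returns the unique element satisfying a predicate, and is only
    meaningful when the limit (resp. the sum) exists. *)
Definition Clim_seq (u : nat -> C) : C :=
  @iota C_CompleteNormedModule
    (fun l : C => filterlim u eventually (locally l)).

Definition CSeries (u : nat -> C) : C :=
  @iota C_CompleteNormedModule (fun l : C => is_series u l).

(** Principal square root: positive on the positive reals, cut along the
    negative reals; on the cut itself, the limit from the upper half plane. *)
Definition Csqrt (z : C) : C :=
  (sqrt ((Cmod z + Re z) / 2),
   if Rlt_dec (Im z) 0 then Ropp (sqrt ((Cmod z - Re z) / 2))
   else sqrt ((Cmod z - Re z) / 2))%R.

Fixpoint qpoch (q : R) (x : C) (k : nat) : C :=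
  match k with
  | O => 1
  | S k' => qpoch q x k' * (1 - x * q ^ k')
  end.

Definition qpoch_inf (q : R) (x : C) : C := Clim_seq (qpoch q x).

Definition qpochs (q : R) (xs : list C) (k : nat) : C :=
  fold_right (fun x r => qpoch q x k * r) 1 xs.

Definition qpochs_inf (q : R) (xs : list C) : C :=
  fold_right (fun x r => qpoch_inf q x * r) 1 xs.

Definition phi43 (q : R) (a1 a2 a3 a4 b1 b2 b3 z : C) : C :=
  CSeries (fun k =>
    qpochs q [a1; a2; a3; a4] k / qpochs q [RtoC q; b1; b2; b3] k * z ^ k).

Record params := Params { pa : C; pb : C; pc : C; pd : C }.

Definition inv_sigma (q : R) (al : params) : params :=
  let ta := Csqrt (/ q * (pa al * pb al * pc al * pd al)) in
  Params ta (pa al * pb al / ta) (pa al * pc al / ta) (pa al * pd al / ta).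

Definition inv_tau (q : R) (al : params) : params :=
  Params (pa al) (pb al) (pc al) (q / pd al).

(** Compositions of involutions are read from left to right. *)
Definition sigma_tau (q : R) (al : params) : params := inv_tau q (inv_sigma q al).

Definition tau_sigma_tau (q : R) (al : params) : params :=
  inv_tau q (inv_sigma q (inv_tau q al)).

Definition spec (q : R) (al : params) (m : nat) : C := pa (inv_sigma q al) * q ^ m.

(** The index $m$ of a point $s = s_m$; $m \mapsto s_m$ is
    injective when $0 < q < 1$ and the parameters are nonzero. *)
Definition spec_index (q : R) (al : params) (s : C) : nat :=
  epsilon (inhabits O) (fun m => s = spec q al m).

(** $\sum_{s \in \mathcal S(\alpha;q)} F(s)$, as a series in the enumeration
    $s_0, s_1, \dots$ of the spectrum. *)
Definition spec_summable (q : R) (al : params) (F : C -> C) : Prop :=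
  ex_series (fun m => F (spec q al m)).

Definition spec_sum (q : R) (al : params) (F : C -> C) : C :=
  CSeries (fun m => F (spec q al m)).

(** Meaningful for $s$ in the spectrum of [al] only. *)
Definition AWpoly (q : R) (al : params) (s x : C) : C :=
  let (a, b, c, d) := al in
  let n := spec_index q al s in
  phi43 q (/ q ^ n) (q ^ n / q * (a * b * c * d)) (a * x) (a / x)
    (a * b) (a * c) (a * d) q.

(** The weight $h^\sigma = \widetilde h$ on the spectrum of [al]; thus
    $h^{\tau\sigma}$ is [weight_sigma q (inv_tau q al)]. *)
Definition weight_sigma (q : R) (al : params) (s : C) : C :=
  let (a, b, c, d) := al in
  let m := spec_index q al s in
  let A := / q * (a * b * c * d) in
  ((1 - q ^ (2 * m) * A) * qpochs q [A; a * b; a * c; a * d] m)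
  / ((1 - A) * qpochs q [RtoC q; b * c; b * d; c * d] m)
  * / a ^ (2 * m).

Definition gauss_den (q : R) (al : params) (x : C) : C :=
  qpochs_inf q [pd al * x; pd al / x].

Definition gauss (q : R) (al : params) (x : C) : C := / gauss_den q al x.

(** The expression of $\phi_\gamma(x)$ as a meromorphic function on the whole of
    $\mathbb C^\times\times\mathbb C^\times$; the very-well-poised ${}_8W_7$
    series, which converges only for $|q/\tilde d\gamma|<1$, is equal to it
    there.  At the poles the value is an artefact of division by zero. *)
Definition AWfun (q : R) (al : params) (g x : C) : C :=
  let (a, b, c, d) := al in
  let (ta, tb, tc, td) := inv_sigma q al in
  qpochs_inf q [q * a * b * c / d]
  / qpochs_inf q [b * c; q * a / d; q * b / d; q * c / d; q / (a * d)]
  * phi43 q (a * x) (a / x) (ta * g) (ta / g) (a * b) (a * c) (a * d) q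
  +
  qpochs_inf q [a * x; a / x; ta * g; ta / g; q * a * b * c / d]
  / qpochs_inf q [q * x / d; q / (d * x); q * g / td; q / (td * g);
                  a * b; a * c; b * c; q * a / d; a * d / q]
  * phi43 q (q * x / d) (q / (d * x)) (q * g / td) (q / (td * g))
      (q * b / d) (q * c / d) (q ^ 2 / (a * d)) q.

(** The denominators of [AWfun] depending on $(\gamma,x)$ do not vanish. *)
Definition AW_regular (q : R) (al : params) (p : C * C) : Prop :=
  fst p <> 0 /\ snd p <> 0 /\
  gauss_den q (inv_tau q al) (snd p) <> 0 /\
  gauss_den q (sigma_tau q al) (fst p) <> 0.

(** The analytic part
    $\phi_\gamma^{an}(x)=G^\tau(x)^{-1}G^{\sigma\tau}(\gamma)^{-1}\phi_\gamma(x)$;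
    the singularities on the polar divisor of $\phi_\gamma(x)$ are removable, and
    the value there is the limit along regular points. *)
Definition AWfun_an (q : R) (al : params) (g x : C) : C :=
  let f (p : C * C) : C :=
    / gauss q (inv_tau q al) (snd p) * / gauss q (sigma_tau q al) (fst p)
    * AWfun q al (fst p) (snd p) in
  if excluded_middle_informative (AW_regular q al (g, x)) then f (g, x)
  else
    @iota C_CompleteNormedModule (fun l : C =>
      filterlim f (within (AW_regular q al) (locally (g, x))) (locally l)).

(** $(u;q)_k \neq 0$ for all $k$, including $k=\infty$, that is,
    $u \notin q^{-\mathbb Z_+}$. *)
Definition qpoch_nonvanishing (q : R) (u : C) : Prop :=
  forall k : nat, u * q ^ k <> 1.

(** The exceptional subvarieties: those on which a denominator depending on the
    parameters only vanishes, in $\phi_\gamma(x)$, in $h^{\tau\sigma}$, in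
    $E^\tau$, $E^{\sigma\tau}$ or in the Gaussians $G^{\tau\sigma\tau}(s)$.
    In $G^{\tau\sigma\tau}(s_m^\tau)^{-1}=(bcq^m,dq^{-m}/a;q)_\infty$ every
    integral power of $q$ is excluded for $d/a$, and in $\phi_\gamma(x)$ every
    integral power of $q$ is excluded for $ad$. *)
Definition generic (q : R) (al : params) : Prop :=
  let (a, b, c, d) := al in
  (a <> 0 /\ b <> 0 /\ c <> 0 /\ d <> 0) /\
  a * b * c / d <> 1 /\
  List.Forall (qpoch_nonvanishing q)
    [a * b; a * c; b * c; q * b / d; q * c / d;
     a * d; / (a * d); a / d; d / a].

(* Main.v *)
(** Put $\rho = q/(ad)$ and $A = abc/d$. The terminating 4phi3 polynomials $E_m(z)$ of the bilinear
    sum expand in two families of functions of $z$, namely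
    $(az,a/z;q)_k (\rho az,\rho a/z;q)_\infty$ and its image under $a \leftrightarrow \rho a$: this
    comes from a limit of the nonterminating q-Saalschütz sum and the terminating q-Saalschütz sum.
    The coefficients $D_k(m)$ are polynomials in $q^{-m} + Aq^m$. Those of one family are orthogonal
    with respect to the weights of the sum over $m$, by a limit of the very-well-poised 6phi5 sum,
    and the mixed moments of the two families vanish. Summing over $m$ therefore collapses the
    product of the expansions of $E_m(x)$ and $E_m(\gamma)$ to two single series, which are the two
    4phi3 series defining the Askey-Wilson function. The interchange is justified by bounds
    $|E_m| \le MK^m$ (read off after a Sears transformation) and $|D_k(m)| \le MK^mq^{-m^2/4}$,
    the weights being of order $q^{m^2/2}$ up to geometric factors. Points of the polar divisor are
    reached by continuity of the bilinear sum. *)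

Require Import Defs.
From Stdlib Require Import Reals List Lra Lia Arith ClassicalEpsilon.
Import ListNotations.
From Coquelicot Require Import Coquelicot.
Open Scope C_scope.

(** The weights decay like $q^{m^2/2}$, while the bound on $D_k(m)$ uniform in $k$ costs
    $q^{-m^2/4}$: expanding both polynomials at once would consume all the decay. The expansions are
    therefore made one at a time. $E_m(x)$ is paired with a single $D_k$, which for fixed $k$ grows
    only geometrically; then $E_m(\gamma)$ is expanded against the unexpanded $E_m(x)$. The
    geometric bound on the latter is not visible in its defining sum, whose terms reach the size
    $q^{-m^2/2}$ and cancel. The exchange $(p_1,p_2,\rho,a)\to(\rho p_1,\rho p_2,1/\rho,\rho a)$
    governs the rest: $E_m$ changes by a factor $\kappa_m$, the weight $w_m$ becomes
    $w_m\kappa_m^2$, and the second term of the Askey-Wilson function is the image of the first. The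
    mixed weight $w_m\kappa_m$ has the same shape with $\rho$ replaced by $1$, and there the closed
    form of the sum contains $(1;q)_\infty=0$; this is why the mixed moments vanish. The summation
    formulas behind this rest on first-order recurrences, each verified by an explicit telescoping
    certificate. *)

Fixpoint csum (f : nat -> C) (n : nat) : C :=
  match n with O => 0 | S n' => csum f n' + f n' end.

Fixpoint rsum (f : nat -> R) (n : nat) : R :=
  match n with O => 0 | S n' => rsum f n' + f n' end.

(** Convergence is measured by the real sequence of moduli, so that the squeeze lemmas for
    [is_lim_seq] do the analysis; [cvg_filterlim] returns to the filters used in the statement. *)
Definition cvg (u : nat -> C) (l : C) : Prop :=
  is_lim_seq (fun n => Cmod (u n - l)) 0.

Definition ser (f : nat -> C) (l : C) : Prop := cvg (csum f) l.

Definition summable (X : nat -> R) : Prop :=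
  (forall n, (0 <= X n)%R) /\ exists S : R, is_lim_seq (rsum X) S.

(** * Limits of complex sequences *)

Lemma Cmod_minus_sym (x y : C) : Cmod (x - y) = Cmod (y - x).
Proof. replace (y - x) with (- (x - y)) by ring. now rewrite Cmod_opp. Qed.

Lemma Cmod_triangle_minus (x y : C) : (Cmod (x - y) <= Cmod x + Cmod y)%R.
Proof. unfold Cminus. rewrite <- (Cmod_opp y). apply Cmod_triangle. Qed.

Lemma Cmod_triangle_inv (x y : C) : (Cmod x - Cmod y <= Cmod (x - y))%R.
Proof.
  pose proof (Cmod_triangle (x - y) y) as H.
  replace (x - y + y) with x in H by ring. lra.
Qed.

Lemma Cminus_eq_0 (x y : C) : x - y = 0 -> x = y.
Proof. intros H. replace x with (x - y + y) by ring. rewrite H. ring. Qed.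

Lemma cvg_squeeze (u : nat -> C) (l : C) (r : nat -> R) :
  (forall n, (Cmod (u n - l) <= r n)%R) -> is_lim_seq r 0 -> cvg u l.
Proof.
  intros H Hr. unfold cvg.
  apply (is_lim_seq_le_le (fun _ => 0%R) _ r); auto.
  - intros n; split; auto using Cmod_ge_0.
  - apply is_lim_seq_const.
Qed.

Lemma cvg_filterlim (u : nat -> C) (l : C) :
  cvg u l <-> filterlim u eventually (locally l).
Proof.
  split.
  - intros H. apply (filterlim_locally_ball_norm (K := C_AbsRing) (U := C_NormedModule)).
    intros eps.
    apply is_lim_seq_spec in H. destruct (H eps) as [N HN]. exists N.
    intros n Hn. specialize (HN n Hn). rewrite Rminus_0_r in HN.
    rewrite Rabs_pos_eq in HN by apply Cmod_ge_0. exact HN.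
  - intros H. apply is_lim_seq_spec. intros eps.
    apply (filterlim_locally_ball_norm (K := C_AbsRing) (U := C_NormedModule)) with (eps := eps) in H.
    destruct H as [N HN]. exists N. intros n Hn. specialize (HN n Hn).
    rewrite Rminus_0_r, Rabs_pos_eq by apply Cmod_ge_0. exact HN.
Qed.

Lemma cvg_unique (u : nat -> C) (l l' : C) : cvg u l -> cvg u l' -> l = l'.
Proof.
  intros H H'. apply Cminus_eq_0, Cmod_eq_0.
  assert (K : is_lim_seq (fun _ : nat => Cmod (l - l')) 0).
  { apply (is_lim_seq_le_le (fun _ => 0%R) _ (fun n => (Cmod (u n - l) + Cmod (u n - l'))%R)).
    - intros n; split; [apply Cmod_ge_0 |].
      replace (l - l') with ((u n - l') - (u n - l)) by ring.
      eapply Rle_trans; [apply Cmod_triangle_minus | lra].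
    - apply is_lim_seq_const.
    - replace (Finite 0) with (Finite (0 + 0)) by (f_equal; ring).
      now apply is_lim_seq_plus'. }
  pose proof (is_lim_seq_unique _ _ K) as E. rewrite Lim_seq_const in E.
  now injection E.
Qed.

Lemma cvg_const (c : C) : cvg (fun _ => c) c.
Proof.
  apply cvg_squeeze with (fun _ => 0%R).
  - intros n. replace (c - c) with (RtoC 0) by ring. rewrite Cmod_0. lra.
  - apply is_lim_seq_const.
Qed.

Lemma cvg_ext (u v : nat -> C) (l : C) : (forall n, u n = v n) -> cvg u l -> cvg v l.
Proof.
  intros E. apply is_lim_seq_ext. intros n. now rewrite E.
Qed.

Lemma cvg_plus (u v : nat -> C) (l l' : C) :
  cvg u l -> cvg v l' -> cvg (fun n => u n + v n) (l + l').
Proof.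
  intros H H'. apply cvg_squeeze with (fun n => (Cmod (u n - l) + Cmod (v n - l'))%R).
  - intros n. replace (u n + v n - (l + l')) with ((u n - l) + (v n - l')) by ring.
    apply Cmod_triangle.
  - replace (Finite 0) with (Finite (0 + 0)) by (f_equal; ring).
    now apply is_lim_seq_plus'.
Qed.

Lemma cvg_bounded (u : nat -> C) (l : C) :
  cvg u l -> exists M, (0 < M)%R /\ forall n, (Cmod (u n) <= M)%R.
Proof.
  intros H. apply is_lim_seq_spec in H. destruct (H (mkposreal 1 Rlt_0_1)) as [N HN].
  assert (F : forall n, exists M, forall k, (k < n)%nat -> (Cmod (u k) <= M)%R).
  { induction n as [|n [M HM]].
    - exists 0%R. intros; lia.
    - exists (Rmax M (Cmod (u n))). intros k Hk.
      destruct (Nat.eq_dec k n) as [->|]; [apply Rmax_r |].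
      eapply Rle_trans; [apply HM; lia | apply Rmax_l]. }
  destruct (F N) as [M HM].
  exists (Rmax M (Cmod l + 1))%R. split.
  - eapply Rlt_le_trans; [| apply Rmax_r]. pose proof (Cmod_ge_0 l). lra.
  - intros n. destruct (le_lt_dec N n) as [Hn | Hn].
    + eapply Rle_trans; [| apply Rmax_r]. specialize (HN n Hn). simpl in HN.
      rewrite Rminus_0_r, Rabs_pos_eq in HN by apply Cmod_ge_0.
      pose proof (Cmod_triangle_inv (u n) l). lra.
    + eapply Rle_trans; [apply HM; lia | apply Rmax_l].
Qed.

Lemma cvg_mult (u v : nat -> C) (l l' : C) :
  cvg u l -> cvg v l' -> cvg (fun n => u n * v n) (l * l').
Proof.
  intros H H'. destruct (cvg_bounded _ _ H) as [M [_ HM]].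
  apply cvg_squeeze with (fun n => (M * Cmod (v n - l') + Cmod l' * Cmod (u n - l))%R).
  - intros n. replace (u n * v n - l * l') with (u n * (v n - l') + l' * (u n - l)) by ring.
    eapply Rle_trans; [apply Cmod_triangle |]. rewrite !Cmod_mult.
    apply Rplus_le_compat_r, Rmult_le_compat_r; auto using Cmod_ge_0.
  - replace (Finite 0) with (Finite (M * 0 + Cmod l' * 0)) by (f_equal; ring).
    apply is_lim_seq_plus'; now apply (is_lim_seq_scal_l _ _ (Finite 0)).
Qed.

Lemma cvg_scal (c : C) (u : nat -> C) (l : C) : cvg u l -> cvg (fun n => c * u n) (c * l).
Proof. intros H. apply cvg_mult; auto using cvg_const. Qed.

Lemma cvg_inv (u : nat -> C) (l : C) :
  (exists c, (0 < c)%R /\ forall n, (c <= Cmod (u n))%R) -> l <> 0 ->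
  cvg u l -> cvg (fun n => / u n) (/ l).
Proof.
  intros [c [Hc Hu]] Hl H.
  assert (Hn : forall n, u n <> 0).
  { intros n E. specialize (Hu n). rewrite E, Cmod_0 in Hu. lra. }
  pose proof (proj1 (Cmod_gt_0 l) Hl) as Hl'.
  apply cvg_squeeze with (fun n => (/ (c * Cmod l) * Cmod (u n - l))%R).
  - intros n. replace (/ u n - / l) with (/ (u n * l) * (l - u n)) by (field; auto).
    assert (u n * l <> 0) by (apply Cmult_neq_0; auto).
    rewrite Cmod_mult, Cmod_inv, Cmod_mult, (Cmod_minus_sym l) by auto.
    apply Rmult_le_compat_r; [apply Cmod_ge_0 |].
    apply Rinv_le_contravar; [now apply Rmult_lt_0_compat |].
    apply Rmult_le_compat_r; auto using Cmod_ge_0.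
  - replace (Finite 0) with (Finite (/ (c * Cmod l) * 0)) by (f_equal; ring).
    now apply (is_lim_seq_scal_l _ _ (Finite 0)).
Qed.

Lemma cvg_shift (u : nat -> C) (k : nat) (l : C) :
  cvg u l <-> cvg (fun n => u (n + k)%nat) l.
Proof. apply (is_lim_seq_incr_n (fun n => Cmod (u n - l))). Qed.

Lemma cvg_le (u : nat -> C) (l : C) (M : R) :
  cvg u l -> (exists N, forall n, (N <= n)%nat -> (Cmod (u n) <= M)%R) -> (Cmod l <= M)%R.
Proof.
  intros H [N HM]. apply Rnot_lt_le. intros Hlt.
  apply is_lim_seq_spec in H.
  assert (Hp : (0 < Cmod l - M)%R) by lra.
  destruct (H (mkposreal _ Hp)) as [N' HN]. specialize (HN (N + N')%nat ltac:(lia)).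
  simpl in HN. rewrite Rminus_0_r, Rabs_pos_eq in HN by apply Cmod_ge_0.
  specialize (HM (N + N')%nat ltac:(lia)).
  rewrite Cmod_minus_sym in HN.
  pose proof (Cmod_triangle_inv l (u (N + N')%nat)). lra.
Qed.

Lemma cvg_ge (u : nat -> C) (l : C) (M : R) :
  cvg u l -> (forall n, (M <= Cmod (u n))%R) -> (M <= Cmod l)%R.
Proof.
  intros H HM. apply Rnot_lt_le. intros Hlt.
  apply is_lim_seq_spec in H.
  assert (Hp : (0 < M - Cmod l)%R) by lra.
  destruct (H (mkposreal _ Hp)) as [N' HN]. specialize (HN N' ltac:(lia)).
  simpl in HN. rewrite Rminus_0_r, Rabs_pos_eq in HN by apply Cmod_ge_0.
  specialize (HM N'). pose proof (Cmod_triangle_inv (u N') l). lra.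
Qed.

(** ** Finite sums *)

Lemma csum_ext (f g : nat -> C) (n : nat) :
  (forall k, (k < n)%nat -> f k = g k) -> csum f n = csum g n.
Proof.
  induction n as [|n IH]; intros H; simpl; auto.
  rewrite IH by (intros; apply H; lia). now rewrite H by lia.
Qed.

Lemma csum_S (f : nat -> C) (n : nat) : csum f (S n) = csum f n + f n.
Proof. reflexivity. Qed.

Lemma csum_plus (f g : nat -> C) (n : nat) :
  csum (fun k => f k + g k) n = csum f n + csum g n.
Proof. induction n as [|n IH]; simpl; [ring | rewrite IH; ring]. Qed.

Lemma csum_scal (c : C) (f : nat -> C) (n : nat) :
  csum (fun k => c * f k) n = c * csum f n.
Proof. induction n as [|n IH]; simpl; [ring | rewrite IH; ring]. Qed.

Lemma csum_0 (f : nat -> C) (n : nat) :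
  (forall k, (k < n)%nat -> f k = 0) -> csum f n = 0.
Proof.
  induction n as [|n IH]; intros H; simpl; auto.
  rewrite IH, H by (auto with arith). ring.
Qed.

Lemma csum_add (f : nat -> C) (m n : nat) :
  csum f (m + n) = csum f m + csum (fun k => f (m + k)%nat) n.
Proof.
  induction n as [|n IH]; simpl; [rewrite Nat.add_0_r; ring |].
  rewrite Nat.add_succ_r. simpl. rewrite IH. ring.
Qed.

Lemma csum_S_l (f : nat -> C) (n : nat) :
  csum f (S n) = f O + csum (fun k => f (S k)) n.
Proof. change (S n) with (1 + n)%nat. rewrite csum_add. simpl. ring. Qed.

Lemma csum_swap (f : nat -> nat -> C) (m n : nat) :
  csum (fun i => csum (fun j => f i j) n) m = csum (fun j => csum (fun i => f i j) m) n.
Proof.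
  induction m as [|m IH]; simpl.
  - symmetry. now apply csum_0.
  - rewrite IH, <- csum_plus. now apply csum_ext.
Qed.

Lemma csum_telescope (t : nat -> C) (n : nat) :
  csum (fun k => t (S k) - t k) n = t n - t O.
Proof. induction n as [|n IH]; simpl; [ring | rewrite IH; ring]. Qed.

Lemma csum_Cmod (f : nat -> C) (X : nat -> R) (n : nat) :
  (forall k, (k < n)%nat -> (Cmod (f k) <= X k)%R) -> (Cmod (csum f n) <= rsum X n)%R.
Proof.
  induction n as [|n IH]; intros H; simpl.
  - rewrite Cmod_0. lra.
  - eapply Rle_trans; [apply Cmod_triangle |]. apply Rplus_le_compat; auto.
Qed.

Lemma rsum_scal (c : R) (X : nat -> R) (n : nat) :
  rsum (fun k => c * X k)%R n = (c * rsum X n)%R.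
Proof. induction n as [|n IH]; simpl; [ring | rewrite IH; ring]. Qed.

Lemma rsum_le (X Y : nat -> R) (n : nat) :
  (forall k, (k < n)%nat -> (X k <= Y k)%R) -> (rsum X n <= rsum Y n)%R.
Proof.
  induction n as [|n IH]; intros H; simpl; [lra |].
  apply Rplus_le_compat; auto.
Qed.

Lemma rsum_mono (X : nat -> R) (m n : nat) :
  (forall k, (0 <= X k)%R) -> (m <= n)%nat -> (rsum X m <= rsum X n)%R.
Proof.
  intros H Hmn. induction Hmn as [|n Hmn IH]; simpl; [lra |]. specialize (H n). lra.
Qed.

Lemma csum_Cmod_diff (f : nat -> C) (X : nat -> R) (m n : nat) :
  (forall k, (Cmod (f k) <= X k)%R) -> (m <= n)%nat ->
  (Cmod (csum f n - csum f m) <= rsum X n - rsum X m)%R.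
Proof.
  intros H Hmn. induction Hmn as [|n Hmn IH]; simpl.
  - replace (csum f m - csum f m) with (RtoC 0) by ring. rewrite Cmod_0. lra.
  - replace (csum f n + f n - csum f m) with ((csum f n - csum f m) + f n) by ring.
    eapply Rle_trans; [apply Cmod_triangle |]. specialize (H n). lra.
Qed.

(** ** Summable majorants *)

Lemma rsum_le_lim (X : nat -> R) (S : R) (n : nat) :
  (forall k, (0 <= X k)%R) -> is_lim_seq (rsum X) S -> (rsum X n <= S)%R.
Proof.
  intros HX HS. apply is_lim_seq_incr_compare; auto.
  intros k. simpl. specialize (HX k). lra.
Qed.

Lemma summable_bounded (X : nat -> R) (B : R) :
  (forall n, (0 <= X n)%R) -> (forall n, (rsum X n <= B)%R) -> summable X.
Proof.
  intros HX HB. split; auto.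
  destruct (ex_finite_lim_seq_incr (rsum X) B) as [S HS]; eauto.
  intros k. simpl. specialize (HX k). lra.
Qed.

Lemma summable_le (X Y : nat -> R) :
  (forall n, (0 <= X n <= Y n)%R) -> summable Y -> summable X.
Proof.
  intros H [HY [S HS]]. apply summable_bounded with S; [intros; apply H |].
  intros n. eapply Rle_trans; [apply rsum_le | now apply rsum_le_lim].
  intros k _. apply H.
Qed.

Lemma summable_scal (c : R) (X : nat -> R) :
  (0 <= c)%R -> summable X -> summable (fun n => c * X n)%R.
Proof.
  intros Hc [HX [S HS]]. apply summable_bounded with (c * S)%R.
  - intros n. apply Rmult_le_pos; auto.
  - intros n. rewrite rsum_scal. apply Rmult_le_compat_l; auto. now apply rsum_le_lim.
Qed.

Lemma summable_tail (X : nat -> R) (N : nat) :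
  (forall n, (0 <= X n)%R) -> summable (fun n => X (N + n)%nat) -> summable X.
Proof.
  intros HX [_ [S HS]]. apply summable_bounded with (rsum X N + S)%R; auto.
  assert (E : forall n, rsum X (N + n) = (rsum X N + rsum (fun k => X (N + k)%nat) n)%R).
  { induction n as [|n IH]; simpl; [rewrite Nat.add_0_r; ring |].
    rewrite Nat.add_succ_r. simpl. rewrite IH. ring. }
  intros n. apply Rle_trans with (rsum X (N + n)).
  - apply rsum_mono; auto; lia.
  - rewrite E. apply Rplus_le_compat_l. now apply rsum_le_lim.
Qed.

Lemma summable_geom (r : R) : (0 <= r < 1)%R -> summable (fun n => r ^ n)%R.
Proof.
  intros Hr. apply summable_bounded with (/ (1 - r))%R.
  - intros n. now apply pow_le.
  - assert (E : forall n, rsum (fun n => r ^ n)%R n = ((1 - r ^ n) / (1 - r))%R).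
    { induction n as [|n IH]; simpl; [field; lra |]. rewrite IH. field. lra. }
    intros n. rewrite E. unfold Rdiv. rewrite <- (Rmult_1_l (/ (1 - r))) at 2.
    apply Rmult_le_compat_r; [left; apply Rinv_0_lt_compat; lra |].
    pose proof (pow_le r n (proj1 Hr)). lra.
Qed.

Lemma summable_ratio (X : nat -> R) (N : nat) (r : R) :
  (0 <= r < 1)%R -> (forall n, (0 <= X n)%R) ->
  (forall n, (N <= n)%nat -> (X (S n) <= r * X n)%R) -> summable X.
Proof.
  intros Hr HX H. apply summable_tail with N; auto.
  apply summable_le with (fun n => X N * r ^ n)%R.
  - intros n. split; auto. induction n as [|n IH].
    + rewrite Nat.add_0_r. simpl. lra.
    + rewrite Nat.add_succ_r. eapply Rle_trans; [apply H; lia |].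
      simpl. replace (X N * (r * r ^ n))%R with (r * (X N * r ^ n))%R by ring.
      apply Rmult_le_compat_l; lra.
  - apply summable_scal; auto. now apply summable_geom.
Qed.

(** ** Series *)

Lemma ser_unique (f : nat -> C) (l l' : C) : ser f l -> ser f l' -> l = l'.
Proof. apply cvg_unique. Qed.

Lemma ser_ext (f g : nat -> C) (l : C) : (forall n, f n = g n) -> ser f l -> ser g l.
Proof. intros E. apply cvg_ext. intros n. now apply csum_ext. Qed.

Lemma ser_eq (f : nat -> C) (l l' : C) : ser f l -> l = l' -> ser f l'.
Proof. now intros H <-. Qed.

Lemma ser_plus (f g : nat -> C) (l l' : C) :
  ser f l -> ser g l' -> ser (fun n => f n + g n) (l + l').
Proof.
  intros H H'. eapply cvg_ext; [| apply (cvg_plus _ _ _ _ H H')].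
  intros n. now rewrite csum_plus.
Qed.

Lemma ser_scal (c : C) (f : nat -> C) (l : C) : ser f l -> ser (fun n => c * f n) (c * l).
Proof.
  intros H. eapply cvg_ext; [| apply (cvg_scal c _ _ H)].
  intros n. now rewrite csum_scal.
Qed.

Lemma ser_minus (f g : nat -> C) (l l' : C) :
  ser f l -> ser g l' -> ser (fun n => f n - g n) (l - l').
Proof.
  intros H H'. apply ser_ext with (fun n => f n + (- (1)) * g n); [intros; ring |].
  replace (l - l') with (l + (- (1)) * l') by ring.
  apply ser_plus; auto. now apply ser_scal.
Qed.

Lemma ser_csum (f : nat -> nat -> C) (l : nat -> C) (N : nat) :
  (forall s, (s < N)%nat -> ser (f s) (l s)) ->
  ser (fun n => csum (fun s => f s n) N) (csum l N).
Proof.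
  induction N as [|N IH]; intros H; simpl.
  - eapply cvg_ext; [| apply cvg_const]. intros n. symmetry. now apply csum_0.
  - apply ser_plus; auto.
Qed.

Lemma ser_finite (f : nat -> C) (N : nat) :
  (forall n, (N <= n)%nat -> f n = 0) -> ser f (csum f N).
Proof.
  intros H. apply (cvg_shift _ N). apply cvg_ext with (fun _ => csum f N); [| apply cvg_const].
  intros n. rewrite Nat.add_comm, csum_add, (csum_0 (fun k => f (N + k)%nat)); [ring |].
  intros; apply H; lia.
Qed.

Lemma ser_shift (f : nat -> C) (N : nat) (l : C) :
  (forall n, (n < N)%nat -> f n = 0) -> ser (fun n => f (N + n)%nat) l -> ser f l.
Proof.
  intros H Hs. apply (cvg_shift _ N).
  apply cvg_ext with (csum (fun n => f (N + n)%nat)); auto.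
  intros n. rewrite (Nat.add_comm n), csum_add, (csum_0 f) by auto. ring.
Qed.

Lemma ser_telescope (f t : nat -> C) (L : C) :
  (forall n, f n = t (S n) - t n) -> cvg t L -> ser f (L - t O).
Proof.
  intros E H. apply cvg_ext with (fun n => t n + - t O).
  - intros n. rewrite (csum_ext _ (fun k => t (S k) - t k)) by auto.
    rewrite csum_telescope. ring.
  - apply cvg_plus; auto using cvg_const.
Qed.

Lemma ser_is_series (f : nat -> C) (l : C) :
  ser f l <-> @is_series C_AbsRing C_NormedModule f l.
Proof.
  assert (E : forall n, csum f (S n) = @sum_n C_AbelianMonoid f n).
  { induction n as [|n IH].
    - rewrite sum_O. simpl. ring.
    - rewrite sum_Sn, <- IH. reflexivity. }
  unfold ser, is_series. rewrite (cvg_shift _ 1), cvg_filterlim.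
  split; apply filterlim_ext; intros n; rewrite Nat.add_1_r; auto.
Qed.

Lemma ser_exists (f : nat -> C) (X : nat -> R) :
  (forall n, (Cmod (f n) <= X n)%R) -> summable X -> exists l, ser f l.
Proof.
  intros H [HX [S HS]].
  assert (E : ex_series X).
  { exists S. unfold is_series.
    apply (is_lim_seq_incr_1 (rsum X)) in HS. revert HS. apply filterlim_ext.
    induction x as [|n IH].
    - rewrite sum_O. simpl. ring.
    - rewrite sum_Sn, <- IH. reflexivity. }
  destruct (@ex_series_le C_AbsRing C_CompleteNormedModule f X H E) as [l Hl].
  exists l. now apply ser_is_series.
Qed.

Lemma ser_tail_le (f : nat -> C) (X : nat -> R) (l : C) (S : R) (M : nat) :
  (forall n, (Cmod (f n) <= X n)%R) -> is_lim_seq (rsum X) S -> ser f l ->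
  (Cmod (l - csum f M) <= S - rsum X M)%R.
Proof.
  intros H HS Hl.
  assert (HX : forall k, (0 <= X k)%R) by (intros k; eapply Rle_trans; [apply Cmod_ge_0 | apply H]).
  apply cvg_le with (fun n => csum f n + - csum f M).
  - apply cvg_plus; auto using cvg_const.
  - exists M. intros n Hn.
    eapply Rle_trans; [apply (csum_Cmod_diff f X); auto |].
    pose proof (rsum_le_lim X S n HX HS). lra.
Qed.

Lemma ser_le (f : nat -> C) (X : nat -> R) (l : C) (S : R) :
  (forall n, (Cmod (f n) <= X n)%R) -> is_lim_seq (rsum X) S -> ser f l -> (Cmod l <= S)%R.
Proof.
  intros H HS Hl. pose proof (ser_tail_le f X l S 0 H HS Hl) as K. simpl in K.
  replace (l - 0) with l in K by ring. lra.
Qed.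

(** For a majorant of product form, the remainder after $M$ rows is a series over the columns, and
    each column tail is at most $(S_X-\sum_{m<M}X_m)\,Y_k$. Summing over $k$ leaves $S_Y$ times the
    tail of $X$, which tends to zero. *)
Lemma ser_fubini (u : nat -> nat -> C) (X Y : nat -> R) (r s : nat -> C) (L : C) :
  summable X -> summable Y -> (forall m k, (Cmod (u m k) <= X m * Y k)%R) ->
  (forall m, ser (u m) (r m)) -> (forall k, ser (fun m => u m k) (s k)) ->
  ser s L -> ser r L.
Proof.
  intros [HX [SX HSX]] [HY [SY HSY]] H Hr Hs HL.
  apply cvg_squeeze with (fun M => SY * (SX - rsum X M))%R.
  - intros M. rewrite Cmod_minus_sym.
    assert (K : ser (fun k => s k - csum (fun m => u m k) M) (L - csum r M)).
    { apply ser_minus; auto. apply (ser_csum u r M). auto. }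
    rewrite Rmult_comm.
    apply (ser_le _ (fun k => (SX - rsum X M) * Y k)%R _ _) with (3 := K).
    + intros k.
      assert (Hk : is_lim_seq (rsum (fun m => Y k * X m)%R) (Y k * SX)%R).
      { apply is_lim_seq_ext with (fun n => Y k * rsum X n)%R.
        - intros n. now rewrite rsum_scal.
        - now apply (is_lim_seq_scal_l _ _ (Finite SX)). }
      pose proof (ser_tail_le (fun m => u m k) (fun m => Y k * X m)%R (s k) (Y k * SX)%R M) as T.
      rewrite rsum_scal in T.
      replace ((SX - rsum X M) * Y k)%R with (Y k * SX - Y k * rsum X M)%R by ring.
      apply T; auto. intros m. rewrite Rmult_comm. apply H.
    + apply is_lim_seq_ext with (fun n => (SX - rsum X M) * rsum Y n)%R.
      * intros n. now rewrite rsum_scal.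
      * now apply (is_lim_seq_scal_l _ _ (Finite SY)).
  - replace (Finite 0) with (Finite (SY * (SX - SX))) by (f_equal; ring).
    apply (is_lim_seq_scal_l _ _ (Finite (SX - SX))).
    apply is_lim_seq_minus'; auto using is_lim_seq_const.
Qed.

Lemma CSeries_ser (f : nat -> C) (l : C) : ser f l -> CSeries f = l.
Proof.
  intros H. apply (iota_unique (V := C_CompleteNormedModule)).
  - intros y Hy. apply ser_is_series in Hy. eapply ser_unique; eauto.
  - now apply ser_is_series.
Qed.

Lemma Clim_seq_cvg (u : nat -> C) (l : C) : cvg u l -> Clim_seq u = l.
Proof.
  intros H. apply (iota_unique (V := C_CompleteNormedModule)).
  - intros y Hy. apply cvg_filterlim in Hy. eapply cvg_unique; eauto.
  - now apply cvg_filterlim.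
Qed.

(** * Finite and infinite q-shifted factorials *)

Section Poch.
Context (q : R) (hq : (0 < q < 1)%R).

Notation qp := (qpoch q).
Notation pinf := (qpoch_inf q).
Notation qnv := (qpoch_nonvanishing q).

Lemma q_neq_0 : RtoC q <> 0.
Proof. intros E. apply RtoC_inj in E. lra. Qed.

Lemma qpow_neq_0 (n : nat) : RtoC q ^ n <> 0.
Proof. apply Cpow_nz, q_neq_0. Qed.

Lemma Cmod_qpow (n : nat) : Cmod (RtoC q ^ n) = (q ^ n)%R.
Proof. rewrite Cmod_pow, Cmod_R, Rabs_pos_eq by lra. reflexivity. Qed.

Lemma qpow_pos (n : nat) : (0 < q ^ n)%R.
Proof. apply pow_lt; lra. Qed.

Lemma qpow_le_1 (n : nat) : (q ^ n <= 1)%R.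
Proof. rewrite <- (pow1 n). apply pow_incr; lra. Qed.

Lemma qpow_lim : is_lim_seq (fun n => q ^ n)%R 0.
Proof. apply is_lim_seq_geom. rewrite Rabs_pos_eq; lra. Qed.

Lemma qp_S (x : C) (n : nat) : qp x (S n) = qp x n * (1 - x * q ^ n).
Proof. reflexivity. Qed.

Lemma qp_add (x : C) (m n : nat) : qp x (m + n) = qp x m * qp (x * q ^ m) n.
Proof.
  induction n as [|n IH].
  - rewrite Nat.add_0_r. simpl. ring.
  - rewrite Nat.add_succ_r, !qp_S, IH, Cpow_add_r. ring.
Qed.

Lemma qp_S_l (x : C) (n : nat) : qp x (S n) = (1 - x) * qp (x * q) n.
Proof.
  change (S n) with (1 + n)%nat. rewrite qp_add. simpl.
  replace (x * (q * 1)) with (x * q) by ring. ring.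
Qed.

(** From $|1-xq^i|\le 1+rq^i\le e^{rq^i}$ and $\sum_i q^i=1/(1-q)$: a majorant of $|(x;q)_n|$ for
    $|x|\le r$, uniform in $n$. *)
Definition qbd (r : R) : R := exp (r / (1 - q)).

Lemma qbd_pos (r : R) : (0 < qbd r)%R.
Proof. apply exp_pos. Qed.

Lemma Cmod_1_minus_le (x : C) (r : R) : (Cmod x <= r)%R -> (Cmod (1 - x) <= exp r)%R.
Proof.
  intros H. eapply Rle_trans; [apply Cmod_triangle_minus |]. rewrite Cmod_1.
  eapply Rle_trans; [| apply exp_ineq1_le]. lra.
Qed.

Lemma qp_le (x : C) (r : R) (n : nat) : (Cmod x <= r)%R -> (Cmod (qp x n) <= qbd r)%R.
Proof.
  intros Hx. assert (Hr : (0 <= r)%R) by (eapply Rle_trans; [apply Cmod_ge_0 | eauto]).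
  apply Rle_trans with (exp (r * (1 - q ^ n) / (1 - q))).
  - induction n as [|n IH].
    + simpl. rewrite Cmod_1. unfold Rdiv. replace (r * (1 - 1) * / (1 - q))%R with 0%R by ring.
      rewrite exp_0. lra.
    + rewrite qp_S, Cmod_mult.
      replace (r * (1 - q ^ S n) / (1 - q))%R with (r * (1 - q ^ n) / (1 - q) + r * q ^ n)%R
        by (simpl; field; lra).
      rewrite exp_plus. apply Rmult_le_compat; auto using Cmod_ge_0.
      apply Cmod_1_minus_le. rewrite Cmod_mult, Cmod_qpow.
      apply Rmult_le_compat_r; auto. left; apply qpow_pos.
  - unfold qbd.
    pose proof (qpow_pos n).
    assert (K : (r * (1 - q ^ n) / (1 - q) <= r / (1 - q))%R).
    { unfold Rdiv. apply Rmult_le_compat_r; [left; apply Rinv_0_lt_compat; lra |].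
      rewrite <- (Rmult_1_r r) at 2. apply Rmult_le_compat_l; lra. }
    destruct K as [K | ->]; [left; now apply exp_increasing | lra].
Qed.

Lemma summable_qpow : summable (fun n => q ^ n)%R.
Proof. apply summable_geom; lra. Qed.

(** The increments $(x;q)_{k+1}-(x;q)_k$ are $O(q^k)$, so the product written as a telescoped series
    converges by a geometric majorant, without logarithms. The same series also measures the
    distance of $(x;q)_n$ from $1$. *)
Lemma qp_eq_csum (x : C) (n : nat) : qp x n = 1 + csum (fun k => - (x * q ^ k) * qp x k) n.
Proof. induction n as [|n IH]; simpl; [ring |]. rewrite Cplus_assoc, <- IH. ring. Qed.

Lemma qp_diff_le (x : C) (r : R) (k : nat) :
  (Cmod x <= r)%R -> (Cmod (- (x * q ^ k) * qp x k) <= r * qbd r * q ^ k)%R.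
Proof.
  intros Hx. rewrite Cmod_mult, Cmod_opp, Cmod_mult, Cmod_qpow.
  replace (r * qbd r * q ^ k)%R with (r * q ^ k * qbd r)%R by ring.
  pose proof (qpow_pos k).
  apply Rmult_le_compat; auto using Cmod_ge_0, qp_le.
  - apply Rmult_le_pos; [apply Cmod_ge_0 | lra].
  - apply Rmult_le_compat_r; lra.
Qed.

Lemma pinf_cvg (x : C) : cvg (qp x) (pinf x).
Proof.
  destruct (ser_exists (fun k => - (x * q ^ k) * qp x k)
              (fun k => Cmod x * qbd (Cmod x) * q ^ k)%R) as [l Hl].
  - intros n. apply qp_diff_le. lra.
  - apply summable_scal; [| apply summable_qpow].
    apply Rmult_le_pos; [apply Cmod_ge_0 | left; apply qbd_pos].
  - assert (H : cvg (qp x) (1 + l)).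
    { eapply cvg_ext; [| apply cvg_plus; [apply (cvg_const 1) | apply Hl]].
      intros n. symmetry. apply qp_eq_csum. }
    unfold qpoch_inf. now rewrite (Clim_seq_cvg _ _ H).
Qed.

Lemma pinf_split (x : C) (n : nat) : pinf x = qp x n * pinf (x * q ^ n).
Proof.
  apply cvg_unique with (fun k => qp x (k + n)).
  - apply (cvg_shift (qp x) n), pinf_cvg.
  - apply cvg_ext with (fun k => qp x n * qp (x * q ^ n) k).
    + intros k. now rewrite Nat.add_comm, qp_add.
    + apply cvg_scal, pinf_cvg.
Qed.

Lemma pinf_S (x : C) : pinf x = (1 - x) * pinf (x * q).
Proof. rewrite (pinf_split x 1). simpl. f_equal; [ring | f_equal; ring]. Qed.

Lemma qp_minus_1_le (x : C) (r : R) (n : nat) :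
  (Cmod x <= r)%R -> (Cmod (qp x n - 1) <= r * qbd r / (1 - q))%R.
Proof.
  intros Hx. assert (Hr : (0 <= r)%R) by (eapply Rle_trans; [apply Cmod_ge_0 | eauto]).
  rewrite qp_eq_csum. replace (1 + csum (fun k => - (x * q ^ k) * qp x k) n - 1)
    with (csum (fun k => - (x * q ^ k) * qp x k) n) by ring.
  eapply Rle_trans; [apply csum_Cmod; intros k _; apply qp_diff_le, Hx |].
  rewrite rsum_scal. unfold Rdiv. apply Rmult_le_compat_l.
  - apply Rmult_le_pos; auto. left; apply qbd_pos.
  - clear Hx. replace (/ (1 - q))%R with ((1 - q ^ n + q ^ n) / (1 - q))%R by (field; lra).
    assert (E : rsum (fun k => q ^ k)%R n = ((1 - q ^ n) / (1 - q))%R).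
    { induction n as [|n IH]; simpl; [field; lra |]. rewrite IH. field. lra. }
    change (rsum (pow q) n) with (rsum (fun k => q ^ k)%R n). rewrite E. unfold Rdiv.
    apply Rmult_le_compat_r; [left; apply Rinv_0_lt_compat; lra |].
    pose proof (qpow_pos n). lra.
Qed.

Lemma pinf_minus_1_le (x : C) (r : R) :
  (Cmod x <= r)%R -> (Cmod (pinf x - 1) <= r * qbd r / (1 - q))%R.
Proof.
  intros H. apply cvg_le with (fun n => qp x n + - (1)).
  - apply cvg_plus; [apply pinf_cvg | apply cvg_const].
  - exists O. intros n _. now apply qp_minus_1_le.
Qed.

Lemma Cmod_mult_qpow_le (x : C) (n : nat) : (Cmod (x * q ^ n) <= Cmod x)%R.
Proof.
  rewrite Cmod_mult, Cmod_qpow, <- (Rmult_1_r (Cmod x)) at 1.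
  rewrite Rmult_1_r. rewrite <- (Rmult_1_r (Cmod x)) at 2.
  apply Rmult_le_compat_l; [apply Cmod_ge_0 | apply qpow_le_1].
Qed.

Lemma qbd_mono (r s : R) : (r <= s)%R -> (qbd r <= qbd s)%R.
Proof.
  intros [H | ->]; [| lra]. left. apply exp_increasing.
  apply Rmult_lt_compat_r; auto. apply Rinv_0_lt_compat; lra.
Qed.

Lemma pinf_qpow_cvg (x : C) : cvg (fun n => pinf (x * q ^ n)) 1.
Proof.
  apply cvg_squeeze with (fun n => Cmod x * qbd (Cmod x) / (1 - q) * q ^ n)%R.
  - intros n. eapply Rle_trans; [apply pinf_minus_1_le, Rle_refl |].
    replace (Cmod x * qbd (Cmod x) / (1 - q) * q ^ n)%R
      with (Cmod x * q ^ n * qbd (Cmod x) / (1 - q))%R by (field; lra).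
    rewrite Cmod_mult, Cmod_qpow. unfold Rdiv.
    apply Rmult_le_compat_r; [left; apply Rinv_0_lt_compat; lra |].
    apply Rmult_le_compat_l.
    + apply Rmult_le_pos; [apply Cmod_ge_0 | left; apply qpow_pos].
    + apply qbd_mono. rewrite <- Cmod_qpow, <- Cmod_mult. apply Cmod_mult_qpow_le.
  - replace (Finite 0) with (Finite (Cmod x * qbd (Cmod x) / (1 - q) * 0)) by (f_equal; ring).
    apply (is_lim_seq_scal_l _ _ (Finite 0)), qpow_lim.
Qed.

Lemma qnv_qpow (x : C) (n : nat) : qnv x -> qnv (x * q ^ n).
Proof. intros H k E. apply (H (n + k)%nat). rewrite Cpow_add_r, <- E. ring. Qed.

Lemma qnv_q (x : C) : qnv x -> qnv (x * q).
Proof. intros H. generalize (qnv_qpow x 1 H). simpl. now rewrite Cmult_1_r. Qed.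

Lemma qp_neq_0 (x : C) (n : nat) : qnv x -> qp x n <> 0.
Proof.
  intros H. induction n as [|n IH]; simpl.
  - apply C1_nz.
  - apply Cmult_neq_0; auto. intros E. apply (H n). symmetry. now apply Cminus_eq_0.
Qed.

(** After a shift by $N$ the argument $xq^N$ is so small that $|(xq^N;q)_n-1|\le 1/2$ for all $n$;
    the finitely many shorter products are nonzero and contribute a minimum. *)
Lemma qp_ge (x : C) : qnv x -> exists c, (0 < c)%R /\ forall n, (c <= Cmod (qp x n))%R.
Proof.
  intros H.
  assert (HN : exists N, (Cmod (x * q ^ N) * qbd (Cmod x) / (1 - q) <= 1 / 2)%R).
  { assert (L : is_lim_seq (fun N => Cmod x * qbd (Cmod x) / (1 - q) * q ^ N)%R 0).
    { replace (Finite 0) with (Finite (Cmod x * qbd (Cmod x) / (1 - q) * 0)) by (f_equal; ring).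
      apply (is_lim_seq_scal_l _ _ (Finite 0)), qpow_lim. }
    apply is_lim_seq_spec in L. assert (Hp : (0 < 1 / 2)%R) by lra.
    destruct (L (mkposreal _ Hp)) as [N HN]. exists N. specialize (HN N (le_n N)). simpl in HN.
    rewrite Rminus_0_r in HN. apply Rabs_def2 in HN.
    rewrite Cmod_mult, Cmod_qpow.
    replace (Cmod x * q ^ N * qbd (Cmod x) / (1 - q))%R
      with (Cmod x * qbd (Cmod x) / (1 - q) * q ^ N)%R by (field; lra). lra. }
  destruct HN as [N HN].
  assert (Hlow : forall n, (1 / 2 <= Cmod (qp (x * q ^ N) n))%R).
  { intros n. pose proof (qp_minus_1_le (x * q ^ N) _ n (Rle_refl _)) as K.
    assert (K2 : (Cmod (qp (x * q ^ N) n - 1) <= 1 / 2)%R).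
    { eapply Rle_trans; [apply K |]. eapply Rle_trans; [| apply HN]. unfold Rdiv.
      apply Rmult_le_compat_r; [left; apply Rinv_0_lt_compat; lra |].
      apply Rmult_le_compat_l; [apply Cmod_ge_0 |]. apply qbd_mono, Cmod_mult_qpow_le. }
    rewrite Cmod_minus_sym in K2. pose proof (Cmod_triangle_inv 1 (1 - qp (x * q ^ N) n)) as T.
    replace (1 - (1 - qp (x * q ^ N) n)) with (qp (x * q ^ N) n) in T by ring.
    rewrite Cmod_1 in T. lra. }
  assert (F : forall M, exists c, (0 < c)%R /\ forall n, (n < M)%nat -> (c <= Cmod (qp x n))%R).
  { induction M as [|M [c [Hc HM]]].
    - exists 1%R. split; [lra | intros; lia].
    - exists (Rmin c (Cmod (qp x M))). split.
      + apply Rmin_pos; auto. apply Cmod_gt_0. now apply qp_neq_0.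
      + intros n Hn. destruct (Nat.eq_dec n M) as [->|]; [apply Rmin_r |].
        eapply Rle_trans; [apply Rmin_l | apply HM; lia]. }
  destruct (F N) as [c [Hc HM]].
  pose proof (proj1 (Cmod_gt_0 _) (qp_neq_0 x N H)) as HxN.
  exists (Rmin c (Cmod (qp x N) * (1 / 2))). split.
  - apply Rmin_pos; auto. apply Rmult_lt_0_compat; lra.
  - intros n. destruct (le_lt_dec N n) as [Hn | Hn].
    + replace n with (N + (n - N))%nat by lia. rewrite qp_add, Cmod_mult.
      eapply Rle_trans; [apply Rmin_r |]. apply Rmult_le_compat_l; auto; lra.
    + eapply Rle_trans; [apply Rmin_l | auto].
Qed.

(** In $(x;q)_{n+k}=(x;q)_n(xq^n;q)_k$ the left side is bounded below and $(x;q)_n$ is bounded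
    above, which bounds the last factor below uniformly in $n$ and $k$. *)
Lemma pinf_ge (x : C) : qnv x -> exists c, (0 < c)%R /\ forall n, (c <= Cmod (pinf (x * q ^ n)))%R.
Proof.
  intros H. destruct (qp_ge x H) as [c [Hc HM]].
  pose proof (qbd_pos (Cmod x)) as Hb.
  exists (c / qbd (Cmod x))%R. split; [now apply Rdiv_lt_0_compat |].
  intros n. apply cvg_ge with (qp (x * q ^ n)); [apply pinf_cvg |].
  intros k. specialize (HM (n + k)%nat). rewrite qp_add, Cmod_mult in HM.
  apply Rmult_le_reg_l with (qbd (Cmod x)); auto.
  replace (qbd (Cmod x) * (c / qbd (Cmod x)))%R with c by (field; lra).
  eapply Rle_trans; [apply HM |]. apply Rmult_le_compat_r; [apply Cmod_ge_0 |].
  apply qp_le, Rle_refl.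
Qed.

Lemma pinf_neq_0 (x : C) : qnv x -> pinf x <> 0.
Proof.
  intros H E. destruct (pinf_ge x H) as [c [Hc Hn]]. specialize (Hn O). simpl in Hn.
  rewrite Cmult_1_r, E, Cmod_0 in Hn. lra.
Qed.

Lemma qp_inv_le (x : C) : qnv x ->
  exists K, (0 < K)%R /\ forall n k, (Cmod (/ qp (x * q ^ n) k) <= K)%R.
Proof.
  intros H. destruct (qp_ge x H) as [c [Hc HM]].
  pose proof (qbd_pos (Cmod x)) as Hb.
  exists (qbd (Cmod x) / c)%R. split; [now apply Rdiv_lt_0_compat |].
  intros n k. assert (Hx : qp (x * q ^ n) k <> 0) by (apply qp_neq_0, qnv_qpow, H).
  rewrite Cmod_inv by auto. pose proof (proj1 (Cmod_gt_0 _) Hx).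
  replace (/ Cmod (qp (x * q ^ n) k))%R with (1 / Cmod (qp (x * q ^ n) k))%R by (field; lra).
  apply Rmult_le_reg_r with (Cmod (qp (x * q ^ n) k)); auto.
  replace (1 / Cmod (qp (x * q ^ n) k) * Cmod (qp (x * q ^ n) k))%R with 1%R by (field; lra).
  apply Rmult_le_reg_l with c; auto.
  replace (c * (qbd (Cmod x) / c * Cmod (qp (x * q ^ n) k)))%R
    with (qbd (Cmod x) * Cmod (qp (x * q ^ n) k))%R by (field; lra).
  rewrite Rmult_1_r. specialize (HM (n + k)%nat). rewrite qp_add, Cmod_mult in HM.
  eapply Rle_trans; [apply HM |]. apply Rmult_le_compat_r; [apply Cmod_ge_0 |].
  apply qp_le, Rle_refl.
Qed.

Lemma qp_inv_le_0 (x : C) : qnv x -> exists K, (0 < K)%R /\ forall k, (Cmod (/ qp x k) <= K)%R.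
Proof.
  intros H. destruct (qp_inv_le x H) as [K [HK HM]]. exists K. split; auto.
  intros k. generalize (HM O k). simpl. now rewrite Cmult_1_r.
Qed.

Lemma qnv_q_self : qnv q.
Proof.
  intros k E. change (RtoC q * RtoC q ^ k) with (RtoC q ^ S k) in E.
  assert (K : Cmod (RtoC q ^ S k) = 1%R) by (rewrite E; apply Cmod_1).
  rewrite Cmod_qpow in K. simpl in K. pose proof (qpow_le_1 k). pose proof (qpow_pos k). nra.
Qed.

Lemma qpq_neq_0 (n : nat) : qp q n <> 0.
Proof. apply qp_neq_0, qnv_q_self. Qed.

Lemma qp_zero (m s : nat) : (m < s)%nat -> qp (/ q ^ m) s = 0.
Proof.
  intros H. replace s with (m + (1 + (s - m - 1)))%nat by lia.
  rewrite qp_add, qp_add. simpl. rewrite Cinv_l by apply qpow_neq_0. ring.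
Qed.

(** $n(n-1)/2$, defined without division; the exponent $n(n+1)/2$ thus appears as [tri n + n]. *)
Fixpoint tri (n : nat) : nat := match n with O => O | S n' => (tri n' + n')%nat end.

(** Each factor satisfies $1-xq^{-j}=-xq^{-j}(1-q^j/x)$ for $1\le j\le n$. The powers $q^{-j}$ are
    cleared to the left side, so that only natural exponents occur. This reversal is the source of
    all Gaussian factors $q^{m^2/2}$ below. *)
Lemma qp_rev (x : C) (n : nat) : x <> 0 ->
  qp (x / q ^ n) n * q ^ (tri n + n) = (- x) ^ n * qp (q / x) n.
Proof.
  intros Hx. induction n as [|n IH]; [simpl; ring |].
  rewrite qp_S_l. replace (x / q ^ S n * q) with (x / q ^ n)
    by (simpl; field; split; [apply qpow_neq_0 | apply q_neq_0]).
  rewrite qp_S. replace ((- x) ^ S n * (qp (q / x) n * (1 - q / x * q ^ n)))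
    with ((- x) ^ n * qp (q / x) n * (- x * (1 - q / x * q ^ n))) by (simpl; ring).
  rewrite <- IH.
  replace (tri (S n) + S n)%nat with ((tri n + n) + S n)%nat by (simpl; lia).
  rewrite (Cpow_add_r _ _ (S n)). simpl (_ ^ S n).
  field. repeat split; auto using qpow_neq_0, q_neq_0.
Qed.

(** ** A two-term expansion of a constant *)

Definition pp (a z : C) (k : nat) : C := qp (a * z) k * qp (a / z) k.
Definition ppinf (a z : C) : C := pinf (a * z) * pinf (a / z).

Lemma pp_add (a z : C) (m n : nat) : pp a z (m + n) = pp a z m * pp (a * q ^ m) z n.
Proof.
  unfold pp. rewrite !qp_add.
  replace (a * q ^ m * z) with (a * z * q ^ m) by ring.
  replace (a * q ^ m / z) with (a / z * q ^ m) by (unfold Cdiv; ring). ring.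
Qed.

Lemma pp_S (a z : C) (k : nat) :
  pp a z (S k) = pp a z k * ((1 - a * q ^ k * z) * (1 - a * q ^ k / z)).
Proof. unfold pp. rewrite !qp_S. unfold Cdiv. ring. Qed.

Lemma pp_S_l (a z : C) (k : nat) :
  pp a z (S k) = (1 - a * z) * (1 - a / z) * pp (a * q) z k.
Proof.
  change (S k) with (1 + k)%nat. rewrite pp_add. unfold pp at 1. simpl.
  replace (a * (q * 1)) with (a * q) by ring. unfold Cdiv. ring.
Qed.

Lemma pp_cvg (a z : C) : cvg (pp a z) (ppinf a z).
Proof. apply cvg_mult; apply pinf_cvg. Qed.

Lemma ppinf_split (a z : C) (n : nat) : ppinf a z = pp a z n * ppinf (a * q ^ n) z.
Proof.
  unfold ppinf, pp. rewrite (pinf_split (a * z) n), (pinf_split (a / z) n).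
  replace (a * q ^ n * z) with (a * z * q ^ n) by ring.
  replace (a * q ^ n / z) with (a / z * q ^ n) by (unfold Cdiv; ring). ring.
Qed.

Definition ppbd (a z : C) : R := (qbd (Cmod (a * z)) * qbd (Cmod (a / z)))%R.

Lemma ppbd_pos (a z : C) : (0 < ppbd a z)%R.
Proof. apply Rmult_lt_0_compat; apply qbd_pos. Qed.

Lemma pp_le (a z : C) (n k : nat) : (Cmod (pp (a * q ^ n) z k) <= ppbd a z)%R.
Proof.
  unfold pp, ppbd. rewrite Cmod_mult. apply Rmult_le_compat; auto using Cmod_ge_0.
  - apply qp_le. replace (a * q ^ n * z) with (a * z * q ^ n) by ring. apply Cmod_mult_qpow_le.
  - apply qp_le. replace (a * q ^ n / z) with (a / z * q ^ n) by (unfold Cdiv; ring).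
    apply Cmod_mult_qpow_le.
Qed.

Lemma pp_le_0 (a z : C) (k : nat) : (Cmod (pp a z k) <= ppbd a z)%R.
Proof. generalize (pp_le a z 0 k). simpl. now rewrite Cmult_1_r. Qed.

(** $r\notin q^{\mathbb Z}\cup\{0\}$: the two nonvanishing conditions exclude the nonpositive and
    the nonnegative powers. The condition is stable under inversion and under shifts by $q$ in both
    directions, as the recurrences in $a$ require. *)
Definition nonintegral (r : C) : Prop := r <> 0 /\ qnv r /\ qnv (/ r).

Lemma nonintegral_inv (r : C) : nonintegral r -> nonintegral (/ r).
Proof.
  intros [H0 [H H']]. split; [| split; [exact H' |]].
  - intros E. apply H0. replace r with (r * r * / r) by (field; auto). rewrite E. ring.
  - replace (/ / r) with r by (field; auto). exact H.
Qed.

Lemma nonintegral_mult (r : C) (n : nat) : nonintegral r -> nonintegral (r * q ^ n).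
Proof.
  intros [H0 [H H']]. pose proof (qpow_neq_0 n) as Hn.
  split; [| split].
  - now apply Cmult_neq_0.
  - now apply qnv_qpow.
  - intros k E. destruct (le_lt_dec n k) as [L | L].
    + apply (H' (k - n)%nat). rewrite <- E. replace k with (n + (k - n))%nat at 2 by lia.
      rewrite Cpow_add_r. field. auto.
    + apply (H (n - k)%nat). pose proof (qpow_neq_0 k). pose proof (qpow_neq_0 (n - k)).
      replace (r * q ^ (n - k)) with (/ (/ (r * q ^ n) * q ^ k)).
      * rewrite E. field.
      * replace n with (k + (n - k))%nat at 1 by lia. rewrite Cpow_add_r. field. auto.
Qed.

Lemma nonintegral_div (r : C) (n : nat) : nonintegral r -> nonintegral (r / q ^ n).
Proof.
  intros H. pose proof (qpow_neq_0 n) as Hn. pose proof H as [H0 _].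
  replace (r / q ^ n) with (/ (/ r * q ^ n)) by (field; auto).
  apply nonintegral_inv, nonintegral_mult, nonintegral_inv, H.
Qed.

Lemma one_minus_neq_0 (x : C) : qnv x -> 1 - x <> 0.
Proof.
  intros H E. apply (H O). simpl. rewrite Cmult_1_r. symmetry. now apply Cminus_eq_0.
Qed.

Lemma nonintegral_q_inv (r : C) : nonintegral r -> qnv (q / r).
Proof.
  intros [H0 [H H']]. unfold Cdiv. rewrite Cmult_comm. now apply qnv_q.
Qed.

(** The summand of ${}_2\phi_1(az,a/z;qa/e;q,q)$. *)
Definition SAterm (a e z : C) (k : nat) : C := pp a z k * q ^ k / (qp q k * qp (q * a / e) k).
Definition SA (a e z : C) : C := CSeries (SAterm a e z).

Lemma inv_qpq_le : exists K, (0 < K)%R /\ forall k, (Cmod (/ qp q k) <= K)%R.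
Proof. apply qp_inv_le_0, qnv_q_self. Qed.

Lemma SAterm_le (a e : C) : a <> 0 -> nonintegral (e / a) -> e <> 0 ->
  exists K, (0 < K)%R /\ forall z n k, (Cmod (SAterm (a * q ^ n) e z k) <= K * ppbd a z * q ^ k)%R.
Proof.
  intros Ha H He. destruct inv_qpq_le as [K1 [HK1 H1]].
  assert (Hr : qnv (q * a / e)).
  { replace (q * a / e) with (q / (e / a)) by (field; auto). now apply nonintegral_q_inv. }
  destruct (qp_inv_le _ Hr) as [K2 [HK2 H2]].
  exists (K1 * K2)%R. split; [now apply Rmult_lt_0_compat |]. intros z n k. unfold SAterm.
  replace (q * (a * q ^ n) / e) with (q * a / e * q ^ n) by (field; auto).
  assert (qp (q * a / e * q ^ n) k <> 0) by (apply qp_neq_0, qnv_qpow, Hr).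
  pose proof (qpq_neq_0 k).
  replace (pp (a * q ^ n) z k * q ^ k / (qp q k * qp (q * a / e * q ^ n) k))
    with (/ qp q k * / qp (q * a / e * q ^ n) k * pp (a * q ^ n) z k * q ^ k) by (field; auto).
  rewrite !Cmod_mult, Cmod_qpow. pose proof (qpow_pos k).
  apply Rmult_le_compat_r; [lra |].
  apply Rmult_le_compat; auto using Cmod_ge_0, pp_le.
  - apply Rmult_le_pos; apply Cmod_ge_0.
  - apply Rmult_le_compat; auto using Cmod_ge_0.
Qed.

Lemma CSeries_exists (f : nat -> C) (X : nat -> R) :
  (forall n, (Cmod (f n) <= X n)%R) -> summable X -> ser f (CSeries f).
Proof.
  intros H HX. destruct (ser_exists f X H HX) as [l Hl]. now rewrite (CSeries_ser _ _ Hl).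
Qed.

Lemma SA_ser (a e z : C) : a <> 0 -> e <> 0 -> nonintegral (e / a) -> ser (SAterm a e z) (SA a e z).
Proof.
  intros Ha He H. destruct (SAterm_le a e Ha H He) as [K [HK HT]].
  apply CSeries_exists with (fun k => K * ppbd a z * q ^ k)%R.
  - intros k. generalize (HT z O k). simpl. now rewrite Cmult_1_r.
  - apply summable_scal; [| apply summable_qpow].
    pose proof (ppbd_pos a z). apply Rmult_le_pos; lra.
Qed.

Lemma cvg_qpow : cvg (fun n => q ^ n) 0.
Proof.
  apply cvg_squeeze with (fun n => q ^ n)%R; [| apply qpow_lim].
  intros n. replace (q ^ n - 0) with (RtoC q ^ n) by ring. rewrite Cmod_qpow. lra.
Qed.

Lemma cvg_inv_qp (x : C) : qnv x -> cvg (fun n => / qp x n) (/ pinf x).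
Proof.
  intros H. apply cvg_inv; [now apply qp_ge | now apply pinf_neq_0 | apply pinf_cvg].
Qed.

(** The summands for $aq$ and $a$ differ by an exact difference, so the two series are contiguous up
    to a boundary value at infinity. Neither series alone obeys a homogeneous recurrence; the
    infinite product left here is cancelled in [twoterm_step] by the one in [SA_step_r]. *)
Lemma SA_step_l (a e z : C) : a <> 0 -> e <> 0 -> z <> 0 -> nonintegral (e / a) ->
  (1 - a * e) * (- (q * a / e)) * (SA (a * q) e z / (1 - q * a / e)) - SA a e z
  = - ppinf (a * q) z / (pinf q * pinf (q * a / e)).
Proof.
  intros Ha He Hz H.
  assert (Hr : qnv (q * a / e)).
  { replace (q * a / e) with (q / (e / a)) by (field; auto). now apply nonintegral_q_inv. }
  assert (H' : nonintegral (e / (a * q))).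
  { replace (e / (a * q)) with (e / a / q ^ 1) by (simpl; field; auto using q_neq_0).
    now apply nonintegral_div. }
  assert (Haq : a * q <> 0) by (apply Cmult_neq_0; auto using q_neq_0).
  pose proof (one_minus_neq_0 _ Hr) as H1.
  (* The telescoping certificate. Its generic expression contains $1/(q;q)_{k-1}$, which is to be
     read as zero at $k=0$; hence the case distinction. *)
  set (T := fun n => match n with O => RtoC 0 | S k =>
    - (1 - a * a * q ^ S k) * pp (a * q) z k * (/ qp q k * / qp (q * a / e) (S k)) end).
  apply ser_unique with (fun k => T (S k) - T k).
  - apply ser_ext with (fun k => (1 - a * e) * (- (q * a / e)) * / (1 - q * a / e) * SAterm (a * q) e z k
                                 - SAterm a e z k).
    + intros k. unfold SAterm.
      replace (q * (a * q) / e) with (q * a / e * q) by (field; auto).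
      assert (E : qp (q * a / e * q) k = qp (q * a / e) (S k) / (1 - q * a / e)).
      { rewrite qp_S_l. field. split; auto. intros E. apply H1.
        replace (1 - q * a / e) with ((e - q * a) / e) by (field; auto). rewrite E. unfold Cdiv. ring. }
      rewrite E.
      pose proof (qpq_neq_0 k) as N1. pose proof (qp_neq_0 _ k Hr) as N2.
      pose proof (qp_neq_0 _ (S k) Hr) as N3. rewrite qp_S in N3.
      assert (N4 : 1 - q * a / e * q ^ k <> 0) by (intros N; apply N3; rewrite N; ring).
      assert (H1' : e - q * a <> 0).
      { intros N. apply H1. replace (1 - q * a / e) with ((e - q * a) / e) by (field; auto).
        rewrite N. unfold Cdiv. ring. }
      assert (N4' : e - q * a * q ^ k <> 0).
      { intros N. apply N4. replace (1 - q * a / e * q ^ k) with ((e - q * a * q ^ k) / e) by (field; auto).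
        rewrite N. unfold Cdiv. ring. }
      destruct k as [|j].
      * unfold T, pp. simpl. field. repeat split; auto; try (intros N; apply H1'; rewrite <- N; ring).
      * unfold T. rewrite (pp_S_l a z j), (pp_S (a * q) z j).
        pose proof (qpq_neq_0 j) as M1. pose proof (qp_neq_0 _ (S j) Hr) as M2.
        rewrite (qp_S q j) in *. rewrite (qp_S (q * a / e) (S j)) in *.
        assert (M3 : 1 - q * q ^ j <> 0) by (intros N; apply N1; rewrite N; ring).
        generalize dependent (pp (a * q) z j). generalize dependent (qp q j).
        generalize dependent (qp (q * a / e) (S j)).
        simpl (RtoC q ^ S _) in *. generalize dependent (RtoC q ^ j). intros.
        field. repeat split; auto; try (intros N; apply N4'; rewrite <- N; ring).
    + replace ((1 - a * e) * (- (q * a / e)) * (SA (a * q) e z / (1 - q * a / e)))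
        with ((1 - a * e) * (- (q * a / e)) * / (1 - q * a / e) * SA (a * q) e z) by (unfold Cdiv; ring).
      apply ser_minus; [apply ser_scal |]; now apply SA_ser.
  - replace (- ppinf (a * q) z / (pinf q * pinf (q * a / e)))
      with (- (1 - a * a * 0) * ppinf (a * q) z * (/ pinf q * / pinf (q * a / e)) - T O).
    2:{ simpl. field. split; apply pinf_neq_0; auto using qnv_q_self. }
    apply ser_telescope; auto.
    apply (cvg_shift T 1).
    apply cvg_ext with (fun k => - (1 - a * a * q ^ S k) * pp (a * q) z k
                                 * (/ qp q k * / qp (q * a / e) (S k))).
    { intros n. rewrite Nat.add_1_r. reflexivity. }
    apply cvg_mult; [apply cvg_mult |].
    + apply cvg_ext with (fun n => (-(1)) * (1 + (- (a * a)) * q ^ S n)); [intros; ring |].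
      replace (- (1 - a * a * 0)) with (- (1) * (1 + - (a * a) * 0)) by ring.
      apply cvg_scal, cvg_plus; [apply cvg_const |]. apply cvg_scal.
      apply cvg_ext with (fun n => q ^ (n + 1)); [intros; now rewrite Nat.add_1_r |].
      apply (cvg_shift (fun n => q ^ n)), cvg_qpow.
    + apply pp_cvg.
    + apply cvg_mult; [apply cvg_inv_qp, qnv_q_self |].
      apply cvg_ext with (fun n => / qp (q * a / e) (n + 1)); [intros; now rewrite Nat.add_1_r |].
      apply (cvg_shift (fun n => / qp (q * a / e) n)), cvg_inv_qp, Hr.
Qed.

Lemma SA_step_r (a e z : C) : a <> 0 -> e <> 0 -> z <> 0 -> nonintegral (e / a) ->
  (1 - a * e) * (1 - a / e) * SA e (a * q) z
    - (1 - a * z) * (1 - a / z) * SA e a z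
  = (1 - a / e) * ppinf e z / (pinf q * pinf (e / a)).
Proof.
  intros Ha He Hz H.
  assert (Hr : qnv (e / a)) by apply H.
  assert (Hi : nonintegral (a / e)).
  { replace (a / e) with (/ (e / a)) by (field; auto). now apply nonintegral_inv. }
  assert (H' : nonintegral (a * q / e)).
  { replace (a * q / e) with (a / e * q ^ 1) by (simpl; field; auto).
    now apply nonintegral_mult. }
  assert (Haq : a * q <> 0) by (apply Cmult_neq_0; auto using q_neq_0).
  pose proof (one_minus_neq_0 _ Hr) as H1.
  assert (H1' : a - e <> 0).
  { intros N. apply H1. replace (1 - e / a) with ((a - e) / a) by (field; auto).
    rewrite N. unfold Cdiv. ring. }
  set (T := fun n => (1 - a / e) * (1 - q ^ n) * pp e z n * (/ qp q n * / qp (e / a) n)).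
  apply ser_unique with (fun k => T (S k) - T k).
  - apply ser_ext with (fun k => (1 - a * e) * (1 - a / e) * SAterm e (a * q) z k
                                 - (1 - a * z) * (1 - a / z) * SAterm e a z k).
    + intros k. unfold SAterm, T.
      replace (q * e / (a * q)) with (e / a) by (field; auto using q_neq_0).
      replace (q * e / a) with (e / a * q) by (field; auto).
      assert (E : qp (e / a * q) k = qp (e / a) (S k) / (1 - e / a)).
      { rewrite qp_S_l. field. split; auto. }
      rewrite E. rewrite pp_S, !qp_S.
      pose proof (qpq_neq_0 (S k)) as N1. pose proof (qp_neq_0 _ (S k) Hr) as N2.
      rewrite qp_S in N1, N2.
      assert (N3 : qp q k <> 0) by (intros N; apply N1; rewrite N; ring).
      assert (N4 : qp (e / a) k <> 0) by (intros N; apply N2; rewrite N; ring).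
      assert (N5 : 1 - q * q ^ k <> 0) by (intros N; apply N1; rewrite N; ring).
      assert (N6 : a - e * q ^ k <> 0).
      { intros N. apply N2. replace (1 - e / a * q ^ k) with ((a - e * q ^ k) / a) by (field; auto).
        rewrite N. unfold Cdiv. ring. }
      generalize dependent (pp e z k). generalize dependent (qp q k).
      generalize dependent (qp (e / a) k).
      simpl (RtoC q ^ S _) in *. generalize dependent (RtoC q ^ k). intros.
      field. repeat split; auto.
    + apply ser_minus; apply ser_scal; apply SA_ser; auto.
  - replace ((1 - a / e) * ppinf e z / (pinf q * pinf (e / a)))
      with ((1 - a / e) * (1 + - (1) * 0) * ppinf e z * (/ pinf q * / pinf (e / a)) - T O).
    2:{ unfold T, pp. simpl. field. repeat split; auto; apply pinf_neq_0; auto using qnv_q_self. }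
    apply ser_telescope; auto. unfold T.
    apply cvg_mult; [apply cvg_mult |].
    + apply cvg_ext with (fun n => (1 - a / e) * (1 + (- (1)) * q ^ n)); [intros; ring |].
      apply cvg_scal, cvg_plus; [apply cvg_const |]. apply cvg_scal, cvg_qpow.
    + apply pp_cvg.
    + apply cvg_mult; apply cvg_inv_qp; auto using qnv_q_self.
Qed.

Definition twoterm (a e z : C) : C :=
  ppinf e z / pinf (e / a) * SA a e z + ppinf a z / pinf (a / e) * SA e a z.

Lemma nonintegral_swap (a e : C) : a <> 0 -> e <> 0 -> nonintegral (e / a) -> nonintegral (a / e).
Proof.
  intros Ha He H. replace (a / e) with (/ (e / a)) by (field; auto). now apply nonintegral_inv.
Qed.

(** The infinite products produced by [SA_step_l] and [SA_step_r] become opposite once multiplied by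
    the prefactors of [twoterm]. What remains is the first-order recurrence in $a$ that
    $(ae;q)_\infty$ satisfies as well. *)
Lemma twoterm_step (a e z : C) : a <> 0 -> e <> 0 -> z <> 0 -> nonintegral (e / a) ->
  twoterm a e z = (1 - a * e) * twoterm (a * q) e z.
Proof.
  intros Ha He Hz H. pose proof (nonintegral_swap a e Ha He H) as H'.
  assert (Hr : qnv (q * a / e)).
  { replace (q * a / e) with (q / (e / a)) by (field; auto). now apply nonintegral_q_inv. }
  pose proof (SA_step_l a e z Ha He Hz H) as L. pose proof (SA_step_r a e z Ha He Hz H) as M.
  unfold twoterm.
  pose proof q_neq_0 as Hq.
  assert (E1 : pinf (e / (a * q)) = (1 - e / (a * q)) * pinf (e / a)).
  { rewrite pinf_S. do 2 f_equal. field. auto. }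
  assert (E2 : pinf (a / e) = (1 - a / e) * pinf (a * q / e)).
  { rewrite pinf_S. do 2 f_equal. field. auto. }
  assert (E3 : pinf (q * a / e) = pinf (a * q / e)) by (f_equal; field; auto).
  assert (E4 : ppinf a z = (1 - a * z) * (1 - a / z) * ppinf (a * q) z).
  { rewrite (ppinf_split a z 1). unfold pp. simpl. unfold Cdiv. rewrite !Cmult_1_r. ring. }
  rewrite E3 in L. rewrite E1, E2, E4.
  pose proof (pinf_neq_0 _ (proj1 (proj2 H))) as N1.
  pose proof (pinf_neq_0 _ qnv_q_self) as N2.
  assert (N3 : pinf (a * q / e) <> 0) by (rewrite <- E3; now apply pinf_neq_0).
  pose proof (one_minus_neq_0 _ (proj1 (proj2 H'))) as K1.
  pose proof (one_minus_neq_0 _ Hr) as K2.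
  assert (K1' : e - a <> 0).
  { intros N. apply K1. replace (1 - a / e) with ((e - a) / e) by (field; auto).
    rewrite N. unfold Cdiv. ring. }
  assert (K2' : e - q * a <> 0).
  { intros N. apply K2. replace (1 - q * a / e) with ((e - q * a) / e) by (field; auto).
    rewrite N. unfold Cdiv. ring. }
  assert (L' : SA a e z = (1 - a * e) * (- (q * a / e)) * (SA (a * q) e z / (1 - q * a / e))
                          + ppinf (a * q) z / (pinf q * pinf (a * q / e))).
  { replace (ppinf (a * q) z / (pinf q * pinf (a * q / e)))
      with (- (- ppinf (a * q) z / (pinf q * pinf (a * q / e)))) by (field; auto).
    rewrite <- L. ring. }
  assert (M' : (1 - a * z) * (1 - a / z) * SA e a z = (1 - a * e) * (1 - a / e) * SA e (a * q) z
               - (1 - a / e) * ppinf e z / (pinf q * pinf (e / a))).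
  { rewrite <- M. ring. }
  replace ((1 - a * z) * (1 - a / z) * ppinf (a * q) z / ((1 - a / e) * pinf (a * q / e)) * SA e a z)
    with (ppinf (a * q) z / ((1 - a / e) * pinf (a * q / e)) * ((1 - a * z) * (1 - a / z) * SA e a z))
    by (field; repeat split; auto).
  rewrite M', L'. clear L L' M M' E1 E2 E3 E4.
  generalize dependent (pinf (a * q / e)). generalize dependent (pinf (e / a)).
  intros. field. repeat split; auto.
  intros N. apply K2'. replace (e - q * a) with (- (a * q - e)) by ring. rewrite N. ring.
Qed.

Lemma ser_minus_1_le (f : nat -> C) (l : C) (eps : R) (X : nat -> R) (S0 : R) :
  ser f l -> (Cmod (f O - 1) <= eps * X O)%R ->
  (forall k, (Cmod (f (S k)) <= eps * X (S k))%R) -> is_lim_seq (rsum X) S0 ->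
  (Cmod (l - 1) <= eps * S0)%R.
Proof.
  intros Hl H0 HS HX.
  set (d := fun k => match k with O => RtoC 1 | S _ => RtoC 0 end).
  assert (Hd : ser d 1).
  { replace (RtoC 1) with (csum d 1) by (simpl; ring). apply ser_finite.
    intros [|n] Hn; [lia | reflexivity]. }
  apply (ser_le (fun k => f k - d k) (fun k => eps * X k)%R).
  - intros [|k]; simpl; auto. replace (f (S k) - 0) with (f (S k)) by ring. apply HS.
  - apply is_lim_seq_ext with (fun n => eps * rsum X n)%R.
    + intros n. now rewrite rsum_scal.
    + now apply (is_lim_seq_scal_l _ _ (Finite S0)).
  - now apply ser_minus.
Qed.

Lemma summable_lim_0 (X : nat -> R) : summable X -> is_lim_seq X 0.
Proof.
  intros [HX [S HS]]. apply is_lim_seq_ext with (fun n => rsum X (n + 1) - rsum X n)%R.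
  - intros n. rewrite Nat.add_1_r. simpl. ring.
  - replace (Finite 0) with (Finite (S - S)) by (f_equal; ring).
    apply is_lim_seq_minus'; auto. now apply (is_lim_seq_incr_n (rsum X)).
Qed.

Lemma summable_pow_tri_base (b K : R) : (0 < b < 1)%R -> (0 <= K)%R ->
  summable (fun n => K ^ n * b ^ tri n)%R.
Proof.
  intros Hb HK.
  assert (Hbp : forall n, (0 < b ^ n)%R) by (intros; apply pow_lt; lra).
  assert (L : is_lim_seq (fun n => K * b ^ n)%R 0).
  { replace (Finite 0) with (Finite (K * 0)) by (f_equal; ring).
    apply (is_lim_seq_scal_l _ _ (Finite 0)), is_lim_seq_geom. rewrite Rabs_pos_eq; lra. }
  apply is_lim_seq_spec in L. assert (Hp : (0 < 1 / 2)%R) by lra.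
  destruct (L (mkposreal _ Hp)) as [N HN]. simpl in HN.
  apply summable_ratio with N (1 / 2)%R; [lra | |].
  - intros n. apply Rmult_le_pos; [now apply pow_le | left; apply Hbp].
  - intros n Hn. specialize (HN n Hn). rewrite Rminus_0_r in HN. apply Rabs_def2 in HN.
    simpl. rewrite pow_add.
    replace (K * K ^ n * (b ^ tri n * b ^ n))%R with (K * b ^ n * (K ^ n * b ^ tri n))%R by ring.
    apply Rmult_le_compat_r; [| lra].
    apply Rmult_le_pos; [now apply pow_le | left; apply Hbp].
Qed.

Lemma summable_pow_tri (K : R) : (0 <= K)%R -> summable (fun n => K ^ n * q ^ tri n)%R.
Proof. intros HK. now apply summable_pow_tri_base. Qed.

(** The homogeneous form $x^n(t/x;q)_n$, free of division. At $x=q^k$, $t=1$ it contains a zero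
    factor as soon as $n>k$. *)
Fixpoint xp (x t : C) (n : nat) : C :=
  match n with O => 1 | S n' => xp x t n' * (x - t * q ^ n') end.

Lemma xp_S (x t : C) (n : nat) : xp x t (S n) = xp x t n * (x - t * q ^ n).
Proof. reflexivity. Qed.

(** Raising $n$ by one changes $(q^{1-n}/t;q)_k$ only at its two ends, and the quotient of these end
    factors is matched by the new factor $q^k-tq^n$. It follows that $1/(q^{1-n}/t;q)_k$ is a
    polynomial in $q^k$ over denominators in which $n$ and $k$ are separated. *)
Lemma qp_xp_cross (t : C) (n k : nat) : t <> 0 ->
  qp (q / t / q ^ n) k * xp (q ^ k) t n = qp t n * qp (q / t) k.
Proof.
  intros Ht. induction n as [|n IH].
  - simpl. replace (q / t / 1) with (q / t) by (field; auto). ring.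
  - set (y := q / t / q ^ n) in *. pose proof (qpow_neq_0 n) as Hn. pose proof q_neq_0 as Hq.
    replace (q / t / q ^ S n) with (y / q) by (unfold y; simpl; field; auto).
    assert (E : qp (y / q) k * (1 - y / q * q ^ k) = (1 - y / q) * qp y k).
    { rewrite <- qp_S, qp_S_l. do 2 f_equal. field; auto. }
    assert (E' : qp (y / q) k * (q ^ k - t * q ^ n) = (1 - t * q ^ n) * qp y k).
    { replace (q ^ k - t * q ^ n) with (- (t * q ^ n) * (1 - y / q * q ^ k)) by (unfold y; field; auto).
      replace ((1 - t * q ^ n) * qp y k) with (- (t * q ^ n) * ((1 - y / q) * qp y k))
        by (unfold y; field; auto).
      rewrite <- E. ring. }
    simpl xp. replace (qp (y / q) k * (xp (q ^ k) t n * (q ^ k - t * q ^ n)))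
      with (qp (y / q) k * (q ^ k - t * q ^ n) * xp (q ^ k) t n) by ring.
    rewrite E', qp_S.
    replace ((1 - t * q ^ n) * qp y k * xp (q ^ k) t n) with ((1 - t * q ^ n) * (qp y k * xp (q ^ k) t n)) by ring.
    rewrite IH. ring.
Qed.

(** Since the exponent is at least $1$, every factor is $q\,(q^k-(t/q)q^i)$; the extracted powers of
    $q$ yield the decay $q^n$. *)
Lemma xp_le (t : C) (k n : nat) : (Cmod (xp (q ^ S k) t n) <= q ^ n * qbd (Cmod (t / q)))%R.
Proof.
  apply Rle_trans with (q ^ n * exp (Cmod (t / q) * (1 - q ^ n) / (1 - q)))%R.
  - induction n as [|n IH].
    + simpl. rewrite Cmod_1. replace (Cmod (t / q) * (1 - 1) / (1 - q))%R with 0%R by (field; lra).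
      rewrite exp_0. lra.
    + change (xp (q ^ S k) t (S n)) with (xp (q ^ S k) t n * (q ^ S k - t * q ^ n)). rewrite Cmod_mult.
      replace (Cmod (t / q) * (1 - q ^ S n) / (1 - q))%R
        with (Cmod (t / q) * (1 - q ^ n) / (1 - q) + Cmod (t / q) * q ^ n)%R
        by (simpl; field; lra).
      rewrite exp_plus. simpl (q ^ S n)%R.
      replace (q * q ^ n * (exp (Cmod (t / q) * (1 - q ^ n) / (1 - q)) * exp (Cmod (t / q) * q ^ n)))%R
        with (q ^ n * exp (Cmod (t / q) * (1 - q ^ n) / (1 - q)) * (q * exp (Cmod (t / q) * q ^ n)))%R by ring.
      apply Rmult_le_compat; auto using Cmod_ge_0.
      replace (q ^ S k - t * q ^ n) with (q * (q ^ k - t / q * q ^ n))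
        by (simpl; field; apply q_neq_0).
      rewrite Cmod_mult, Cmod_R, (Rabs_pos_eq q) by lra.
      apply Rmult_le_compat_l; [lra |].
      eapply Rle_trans; [apply Cmod_triangle_minus |].
      rewrite Cmod_qpow, Cmod_mult, Cmod_qpow.
      eapply Rle_trans; [| apply exp_ineq1_le]. pose proof (qpow_le_1 k). lra.
  - apply Rmult_le_compat_l; [left; apply qpow_pos |].
    pose proof (qpow_pos n). pose proof (Cmod_ge_0 (t / q)) as Hr. unfold qbd.
    assert (K : (Cmod (t / q) * (1 - q ^ n) / (1 - q) <= Cmod (t / q) / (1 - q))%R).
    { unfold Rdiv. apply Rmult_le_compat_r; [left; apply Rinv_0_lt_compat; lra |].
      rewrite <- (Rmult_1_r (Cmod (t / q))) at 2. apply Rmult_le_compat_l; lra. }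
    destruct K as [K | ->]; [left; now apply exp_increasing | lra].
Qed.

Lemma twoterm_iter (a e z : C) (n : nat) : a <> 0 -> e <> 0 -> z <> 0 -> nonintegral (e / a) ->
  twoterm a e z = qp (a * e) n * twoterm (a * q ^ n) e z.
Proof.
  intros Ha He Hz H. induction n as [|n IH].
  - simpl. rewrite Cmult_1_r. ring.
  - pose proof (qpow_neq_0 n) as Hn.
    rewrite IH, (twoterm_step (a * q ^ n)); auto.
    + simpl. replace (a * q ^ n * q) with (a * (q * q ^ n)) by ring.
      replace (a * q ^ n * e) with (a * e * q ^ n) by ring. ring.
    + now apply Cmult_neq_0.
    + replace (e / (a * q ^ n)) with (e / a / q ^ n) by (field; auto). now apply nonintegral_div.
Qed.

Lemma is_lim_seq_0_scal (c : R) (u : nat -> R) :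
  is_lim_seq u 0 -> is_lim_seq (fun n => c * u n)%R 0.
Proof.
  intros H. replace (Finite 0) with (Finite (c * 0)) by (f_equal; ring).
  now apply (is_lim_seq_scal_l _ _ (Finite 0)).
Qed.

(** With $r=e/a$, the first term carries $1/(rq^{-n};q)_\infty$, which decays like $q^{n^2/2}$ up to
    geometric factors by reversal. In the second term the prefactor tends to $1$ and only the term
    $k=0$ of the series survives. *)
Lemma twoterm_lim (a e z : C) : a <> 0 -> e <> 0 -> z <> 0 -> nonintegral (e / a) ->
  cvg (fun n => twoterm (a * q ^ n) e z) 1.
Proof.
  intros Ha He Hz H. pose proof (nonintegral_swap a e Ha He H) as H'.
  destruct H as [H0 [Hr Hri]] eqn:EH. clear EH. set (r := e / a) in *.
  pose proof (nonintegral_q_inv r (conj H0 (conj Hr Hri))) as Hqr.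
  unfold twoterm. replace (RtoC 1) with (0 + 1 * 1) by ring. apply cvg_plus.
  - destruct (SAterm_le a e Ha (conj H0 (conj Hr Hri)) He) as [K [HK HT]].
    destruct summable_qpow as [Hq0 [S0 HS0]].
    destruct (qp_inv_le_0 _ Hqr) as [K' [HK' HM]].
    pose proof (pinf_neq_0 _ Hr) as Np.
    set (B := (Cmod (ppinf e z) * K' * Cmod (/ pinf r) * (K * ppbd a z * S0))%R).
    apply cvg_squeeze with (fun n => B * ((/ Cmod r) ^ n * q ^ tri n))%R.
    + intros n. pose proof (qpow_neq_0 n) as Hn.
      replace (e / (a * q ^ n)) with (r / q ^ n) by (unfold r; field; auto).
      pose proof (qp_rev r n H0) as Rv.
      assert (N1 : qp (q / r) n <> 0) by (now apply qp_neq_0).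
      assert (N2 : qp (r / q ^ n) n <> 0).
      { intros N. rewrite N, Cmult_0_l in Rv. symmetry in Rv. revert Rv.
        apply Cmult_neq_0; auto. apply Cpow_nz. intros N'. apply H0.
        replace r with (- - r) by ring. rewrite N'. ring. }
      assert (N3 : (- r) ^ n <> 0).
      { apply Cpow_nz. intros N'. apply H0. replace r with (- - r) by ring. rewrite N'. ring. }
      assert (E : / pinf (r / q ^ n) = q ^ (tri n + n) * / (- r) ^ n * / qp (q / r) n * / pinf r).
      { rewrite (pinf_split (r / q ^ n) n). replace (r / q ^ n * q ^ n) with r by (field; auto).
        replace (/ (qp (r / q ^ n) n * pinf r)) with (q ^ (tri n + n) * / (qp (r / q ^ n) n * q ^ (tri n + n)) * / pinf r)
          by (field; repeat split; auto using qpow_neq_0).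
        rewrite Rv. field. repeat split; auto. }
      change (ppinf e z / pinf (r / q ^ n)) with (ppinf e z * / pinf (r / q ^ n)). rewrite E.
      replace (ppinf e z * (q ^ (tri n + n) * / (- r) ^ n * / qp (q / r) n * / pinf r) * SA (a * q ^ n) e z - 0)
        with (ppinf e z * / qp (q / r) n * / pinf r * SA (a * q ^ n) e z * (q ^ (tri n + n) * / (- r) ^ n)) by ring.
      rewrite !Cmod_mult. unfold B.
      apply Rmult_le_compat; auto using Cmod_ge_0.
      * repeat apply Rmult_le_pos; apply Cmod_ge_0.
      * rewrite <- Cmod_mult. apply Cmod_ge_0.
      * apply Rmult_le_compat; auto using Cmod_ge_0.
        -- repeat apply Rmult_le_pos; apply Cmod_ge_0.
        -- apply Rmult_le_compat_r; [apply Cmod_ge_0 |].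
           apply Rmult_le_compat_l; [apply Cmod_ge_0 | apply HM].
        -- apply (ser_le (SAterm (a * q ^ n) e z) (fun k => K * ppbd a z * q ^ k)%R); auto.
           ++ apply is_lim_seq_ext with (fun k => K * ppbd a z * rsum (pow q) k)%R.
              { intros k. symmetry. apply (rsum_scal (K * ppbd a z) (pow q)). }
              now apply (is_lim_seq_scal_l _ _ (Finite S0)).
           ++ apply SA_ser; auto; [now apply Cmult_neq_0 |].
              replace (e / (a * q ^ n)) with (r / q ^ n) by (unfold r; field; auto).
              apply nonintegral_div. repeat split; auto.
      * rewrite Cmod_qpow, Cmod_inv, Cmod_pow, Cmod_opp, pow_inv by auto.
        rewrite Rmult_comm. apply Rmult_le_compat_l.
        -- left. apply Rinv_0_lt_compat, pow_lt. now apply Cmod_gt_0.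
        -- rewrite pow_add. pose proof (qpow_le_1 n). pose proof (qpow_pos (tri n)). nra.
    + apply is_lim_seq_0_scal, summable_lim_0, summable_pow_tri.
      left. apply Rinv_0_lt_compat. now apply Cmod_gt_0.
  - apply cvg_mult.
    + apply cvg_ext with (fun n => ppinf (a * q ^ n) z * / pinf (a / e * q ^ n)).
      { intros n. replace (a * q ^ n / e) with (a / e * q ^ n) by (unfold Cdiv; ring). reflexivity. }
      replace (RtoC 1) with (1 * 1 * / 1) by (field).
      apply cvg_mult; [unfold ppinf; apply cvg_mult |].
      * apply cvg_ext with (fun n => pinf (a * z * q ^ n)); [intros; f_equal; ring |].
        apply pinf_qpow_cvg.
      * apply cvg_ext with (fun n => pinf (a / z * q ^ n)); [intros; f_equal; unfold Cdiv; ring |].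
        apply pinf_qpow_cvg.
      * apply cvg_inv; [apply pinf_ge, H' | apply C1_nz | apply pinf_qpow_cvg].
    + set (t := a / e) in *.
      assert (Et : q / t = q * r) by (unfold t, r; field; auto).
      assert (Ht : t <> 0) by apply H'.
      destruct (qp_inv_le_0 (q * r)) as [K1 [HK1 HM1]].
      { rewrite Cmult_comm. now apply qnv_q. }
      destruct inv_qpq_le as [K2 [HK2 HM2]].
      destruct (qp_inv_le_0 t (proj1 (proj2 H'))) as [K3 [HK3 HM3]].
      set (B := (ppbd e z * K2 * (K1 * K3 * qbd (Cmod (t / q))))%R).
      destruct summable_qpow as [Hq0 [S0 HS0]].
      pose proof (ppbd_pos e z). pose proof (qbd_pos (Cmod (t / q))).
      assert (HB : (0 < B)%R) by (unfold B; repeat apply Rmult_lt_0_compat; auto using qbd_pos).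
      apply cvg_squeeze with (fun n => B * S0 * q ^ n)%R.
      2:{ apply is_lim_seq_0_scal, qpow_lim. }
      intros n. pose proof (qpow_neq_0 n) as Hn.
      replace (B * S0 * q ^ n)%R with (B * q ^ n * S0)%R by ring.
      pose proof (qpow_pos n) as Hqn.
      apply (ser_minus_1_le (SAterm e (a * q ^ n) z) _ (B * q ^ n)%R (pow q)); auto.
      * apply SA_ser; auto; [now apply Cmult_neq_0 |].
        replace (a * q ^ n / e) with (t * q ^ n) by (unfold t; field; auto).
        now apply nonintegral_mult.
      * unfold SAterm, pp. simpl. replace (1 * 1 * 1 / (1 * 1) - 1) with (RtoC 0) by field.
        rewrite Cmod_0. rewrite Rmult_1_r. apply Rmult_le_pos; lra.
      * intros k. unfold SAterm.
        replace (q * e / (a * q ^ n)) with (q / t / q ^ n) by (unfold t; field; auto).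
        pose proof (qp_xp_cross t n (S k) Ht) as X.
        assert (N1 : qp t n <> 0) by (apply qp_neq_0, H').
        assert (N2 : qp (q / t) (S k) <> 0).
        { rewrite Et. apply qp_neq_0. rewrite Cmult_comm. now apply qnv_q. }
        assert (N3 : qp (q / t / q ^ n) (S k) <> 0).
        { intros N. rewrite N, Cmult_0_l in X. symmetry in X. revert X. now apply Cmult_neq_0. }
        (* For $k\ge1$ the reciprocal of the growing denominator is rewritten with
           $\prod_{i<n}(q^k-tq^i)$, whose bound $O(q^n)$ is uniform in $k$. *)
        assert (E : / qp (q / t / q ^ n) (S k) = xp (q ^ S k) t n * (/ qp (q / t) (S k) * / qp t n)).
        { replace (/ qp (q / t) (S k) * / qp t n) with (/ (qp t n * qp (q / t) (S k))) by (field; auto).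
          rewrite <- X. field. split; auto. intros N. rewrite N, Cmult_0_r in X.
          symmetry in X. revert X. now apply Cmult_neq_0. }
        pose proof (qpq_neq_0 (S k)) as N4.
        replace (pp e z (S k) * q ^ S k / (qp q (S k) * qp (q / t / q ^ n) (S k)))
          with (pp e z (S k) * / qp q (S k) * / qp (q / t / q ^ n) (S k) * q ^ S k) by (field; auto).
        rewrite E, !Cmod_mult, Cmod_qpow. apply Rmult_le_compat_r; [left; apply qpow_pos |].
        unfold B.
        replace (ppbd e z * K2 * (K1 * K3 * qbd (Cmod (t / q))) * q ^ n)%R
          with (ppbd e z * K2 * (q ^ n * qbd (Cmod (t / q)) * (K1 * K3)))%R by ring.
        apply Rmult_le_compat; auto using Cmod_ge_0.
        -- apply Rmult_le_pos; apply Cmod_ge_0.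
        -- rewrite <- !Cmod_mult. apply Cmod_ge_0.
        -- apply Rmult_le_compat; auto using Cmod_ge_0, pp_le_0.
        -- apply Rmult_le_compat; auto using Cmod_ge_0, xp_le.
           ++ rewrite <- Cmod_mult. apply Cmod_ge_0.
           ++ rewrite Et. apply Rmult_le_compat; auto using Cmod_ge_0.
Qed.

(** The product formula for [twoterm] is the nonterminating q-Saalschütz sum with one
    parameter sent to zero. *)
Lemma twoterm_eq (a e z : C) : a <> 0 -> e <> 0 -> z <> 0 -> nonintegral (e / a) ->
  twoterm a e z = pinf (a * e).
Proof.
  intros Ha He Hz H. apply cvg_unique with (fun n => qp (a * e) n * twoterm (a * q ^ n) e z).
  - apply cvg_ext with (fun _ => twoterm a e z); [| apply cvg_const].
    intros n. now apply twoterm_iter.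
  - replace (pinf (a * e)) with (pinf (a * e) * 1) by ring.
    apply cvg_mult; [apply pinf_cvg | now apply twoterm_lim].
Qed.

(** ** A limit of the very-well-poised 6phi5 sum *)

Definition wA (B D r : C) : C := B * D * r / q.

(** With $B = ab$, $D = ac$ and $r = q/(ad)$, [wA B D r] is $abc/d$, and [vwp] is
    $1 - abc/d$ times the weight of the theorem. *)
Definition vwp (B D r : C) (m : nat) : C :=
  (1 - wA B D r * q ^ (2 * m)) * (qp (wA B D r) m * qp B m * qp D m)
  / (qp q m * qp (r * B) m * qp (r * D) m) * ((- r) ^ m * q ^ tri m).

Lemma qpow_double (m : nat) : RtoC q ^ (2 * m) = q ^ m * q ^ m.
Proof. simpl. rewrite Nat.add_0_r. apply Cpow_add_r. Qed.

Lemma vwp_le (B D r : C) : qnv (r * B) -> qnv (r * D) ->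
  exists K, (0 < K)%R /\ forall n m, (Cmod (vwp B D (r * q ^ n) m) <= K * ((q ^ n * Cmod r) ^ m * q ^ tri m))%R.
Proof.
  intros HB HD.
  destruct (qp_inv_le _ HB) as [K1 [HK1 H1]]. destruct (qp_inv_le _ HD) as [K2 [HK2 H2]].
  destruct inv_qpq_le as [K3 [HK3 H3]].
  set (A := wA B D r).
  pose proof (Cmod_ge_0 A) as HA.
  pose proof (qbd_pos (Cmod A)). pose proof (qbd_pos (Cmod B)). pose proof (qbd_pos (Cmod D)).
  exists ((1 + Cmod A) * (qbd (Cmod A) * qbd (Cmod B) * qbd (Cmod D)) * (K3 * K1 * K2))%R.
  split; [repeat apply Rmult_lt_0_compat; auto; lra |].
  intros n m. unfold vwp.
  replace (wA B D (r * q ^ n)) with (A * q ^ n) by (unfold A, wA; field; apply q_neq_0).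
  replace (r * q ^ n * B) with (r * B * q ^ n) by ring.
  replace (r * q ^ n * D) with (r * D * q ^ n) by ring.
  assert (N1 : qp (r * B * q ^ n) m <> 0) by (apply qp_neq_0; now apply qnv_qpow).
  assert (N2 : qp (r * D * q ^ n) m <> 0) by (apply qp_neq_0; now apply qnv_qpow).
  pose proof (qpq_neq_0 m) as N3.
  unfold Cdiv. replace (/ (qp q m * qp (r * B * q ^ n) m * qp (r * D * q ^ n) m))
    with (/ qp q m * / qp (r * B * q ^ n) m * / qp (r * D * q ^ n) m) by (field; auto).
  rewrite !Cmod_mult.
  assert (Em : Cmod ((- (r * q ^ n)) ^ m) = ((q ^ n * Cmod r) ^ m)%R).
  { rewrite Cmod_pow, Cmod_opp, Cmod_mult, Cmod_qpow. f_equal. ring. }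
  rewrite Em, Cmod_qpow.
  apply Rmult_le_compat_r.
  { apply Rmult_le_pos; [apply pow_le, Rmult_le_pos; [left; apply qpow_pos | apply Cmod_ge_0] | left; apply qpow_pos]. }
  apply Rmult_le_compat; try (repeat apply Rmult_le_pos; apply Cmod_ge_0).
  - apply Rmult_le_compat; try (repeat apply Rmult_le_pos; apply Cmod_ge_0).
    + eapply Rle_trans; [apply Cmod_triangle_minus |]. rewrite Cmod_1.
      apply Rplus_le_compat_l. eapply Rle_trans; [apply Cmod_mult_qpow_le | apply Cmod_mult_qpow_le].
    + repeat apply Rmult_le_compat; try (repeat apply Rmult_le_pos; apply Cmod_ge_0).
      * apply qp_le, Cmod_mult_qpow_le.
      * apply qp_le, Rle_refl.
      * apply qp_le, Rle_refl.
  - repeat apply Rmult_le_compat; try (repeat apply Rmult_le_pos; apply Cmod_ge_0); auto.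
Qed.

Definition vwpS (B D r : C) : C := CSeries (vwp B D r).

Lemma vwp_ser (B D r : C) : qnv (r * B) -> qnv (r * D) -> ser (vwp B D r) (vwpS B D r).
Proof.
  intros HB HD. destruct (vwp_le B D r HB HD) as [K [HK H]].
  apply CSeries_exists with (fun m => K * (Cmod r ^ m * q ^ tri m))%R.
  - intros m. generalize (H O m). simpl (q ^ 0)%R. simpl (RtoC q ^ 0). now rewrite Cmult_1_r, Rmult_1_l.
  - apply summable_scal; [lra | apply summable_pow_tri, Cmod_ge_0].
Qed.

(** An exact difference again, but the certificate vanishes at both ends: at $m=0$ through $1-q^m$,
    and at infinity through the Gaussian factor. The recurrence under $r\to rq$, which sends $A$ to
    $Aq$, is therefore homogeneous. *)
Lemma vwp_step (B D r : C) : qnv (r * B) -> qnv (r * D) ->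
  (1 - r * B) * (1 - r * D) * vwpS B D r = (1 - wA B D r) * (1 - r) * vwpS B D (r * q).
Proof.
  intros HB HD. set (A := wA B D r).
  set (T := fun m => - (1 - r * B) * (1 - r * D) * ((1 - q ^ m) * (qp A m * qp B m * qp D m)
    * (/ qp q m * / qp (r * B) m * / qp (r * D) m) * ((- r) ^ m * q ^ tri m))).
  apply Cminus_eq_0.
  apply ser_unique with (fun m => T (S m) - T m).
  - apply ser_ext with (fun m => (1 - r * B) * (1 - r * D) * vwp B D r m - (1 - A) * (1 - r) * vwp B D (r * q) m).
    + intros m. unfold vwp, T. fold A.
      assert (EA : wA B D (r * q) = A * q) by (unfold A, wA; field; apply q_neq_0).
      rewrite EA.
      replace (r * q * B) with (r * B * q) by ring. replace (r * q * D) with (r * D * q) by ring.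
      pose proof (one_minus_neq_0 _ HB) as O1. pose proof (one_minus_neq_0 _ HD) as O2.
      assert (E1 : qp (r * B * q) m = qp (r * B) (S m) / (1 - r * B)) by (rewrite qp_S_l; field; auto).
      assert (E2 : qp (r * D * q) m = qp (r * D) (S m) / (1 - r * D)) by (rewrite qp_S_l; field; auto).
      rewrite E1, E2.
      assert (E3 : (1 - A) * qp (A * q) m = qp A m * (1 - A * q ^ m)) by (rewrite <- qp_S, qp_S_l; ring).
      pose proof (qp_neq_0 _ (S m) HB) as N1. pose proof (qp_neq_0 _ (S m) HD) as N2.
      pose proof (qpq_neq_0 (S m)) as N3. rewrite !qp_S in *.
      assert (N1' : qp (r * B) m <> 0) by (intros N; apply N1; rewrite N; ring).
      assert (N2' : qp (r * D) m <> 0) by (intros N; apply N2; rewrite N; ring).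
      assert (N3' : qp q m <> 0) by (intros N; apply N3; rewrite N; ring).
      assert (N1'' : 1 - r * B * q ^ m <> 0) by (intros N; apply N1; rewrite N; ring).
      assert (N2'' : 1 - r * D * q ^ m <> 0) by (intros N; apply N2; rewrite N; ring).
      assert (N3'' : 1 - q * q ^ m <> 0) by (intros N; apply N3; rewrite N; ring).
      replace (tri (S m)) with (tri m + m)%nat by reflexivity.
      rewrite !qpow_double, Cpow_add_r.
      replace ((- (r * q)) ^ m) with ((- r) ^ m * q ^ m) by (rewrite <- Cpow_mult_l; f_equal; ring).
      simpl (_ ^ S m).
      assert (E4 : forall a1 p2 p3 d' e' : C, (1 - A) * (1 - r) * (a1 * (qp (A * q) m * p2 * p3) / d' * e')
                   = (1 - r) * (a1 * ((1 - A) * qp (A * q) m * p2 * p3) / d' * e'))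
        by (intros; unfold Cdiv; ring).
      rewrite E4. clear E4.
      rewrite E3.
      assert (EqA : A = B * D * r / q) by reflexivity.
      generalize dependent (qp A m). generalize dependent (qp B m). generalize dependent (qp D m).
      generalize dependent (qp (r * B) m). generalize dependent (qp (r * D) m). generalize dependent (qp q m).
      generalize dependent ((- r) ^ m). generalize dependent (RtoC q ^ tri m). generalize dependent (RtoC q ^ m).
      clear T. clearbody A. intros. subst A. field. repeat split; auto. apply q_neq_0.
    + apply ser_minus; apply ser_scal; apply vwp_ser; auto.
      * replace (r * q * B) with (r * B * q) by ring. now apply qnv_q.
      * replace (r * q * D) with (r * D * q) by ring. now apply qnv_q.
  - replace (RtoC 0) with (0 - T O) by (unfold T; simpl; ring).
    apply ser_telescope; auto. unfold T.
    replace (RtoC 0) with (- (1 - r * B) * (1 - r * D) * ((1 + - (1) * 0) * (pinf A * pinf B * pinf D)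
       * (/ pinf q * / pinf (r * B) * / pinf (r * D)) * 0)) by ring.
    apply cvg_scal. apply cvg_mult; [apply cvg_mult; [apply cvg_mult |] |].
    + apply cvg_ext with (fun n => 1 + (- (1)) * q ^ n); [intros; ring |].
      apply cvg_plus; [apply cvg_const |]. apply cvg_scal, cvg_qpow.
    + repeat apply cvg_mult; apply pinf_cvg.
    + repeat apply cvg_mult; apply cvg_inv_qp; auto using qnv_q_self.
    + apply cvg_squeeze with (fun m => Cmod r ^ m * q ^ tri m)%R.
      * intros n. replace ((- r) ^ n * q ^ tri n - 0) with ((- r) ^ n * q ^ tri n) by ring.
        rewrite Cmod_mult, Cmod_pow, Cmod_opp, Cmod_qpow. lra.
      * apply summable_lim_0, summable_pow_tri, Cmod_ge_0.
Qed.

Lemma vwp_iter (B D r : C) (n : nat) : qnv (r * B) -> qnv (r * D) ->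
  qp (r * B) n * qp (r * D) n * vwpS B D r = qp (wA B D r) n * qp r n * vwpS B D (r * q ^ n).
Proof.
  intros HB HD. induction n as [|n IH].
  - simpl. replace (r * 1) with r by ring. ring.
  - rewrite !qp_S. assert (Hq := q_neq_0).
    pose proof (vwp_step B D (r * q ^ n)) as St.
    replace (wA B D (r * q ^ n)) with (wA B D r * q ^ n) in St by (unfold wA; field; auto).
    replace (r * q ^ n * B) with (r * B * q ^ n) in St by ring.
    replace (r * q ^ n * D) with (r * D * q ^ n) in St by ring.
    replace (r * q ^ n * q) with (r * q ^ S n) in St by (simpl; ring).
    specialize (St (qnv_qpow _ n HB) (qnv_qpow _ n HD)).
    replace (qp (r * B) n * (1 - r * B * q ^ n) * (qp (r * D) n * (1 - r * D * q ^ n)) * vwpS B D r)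
      with ((qp (r * B) n * qp (r * D) n * vwpS B D r) * ((1 - r * B * q ^ n) * (1 - r * D * q ^ n))) by ring.
    rewrite IH.
    replace (qp (wA B D r) n * qp r n * vwpS B D (r * q ^ n) * ((1 - r * B * q ^ n) * (1 - r * D * q ^ n)))
      with (qp (wA B D r) n * qp r n * ((1 - r * B * q ^ n) * (1 - r * D * q ^ n) * vwpS B D (r * q ^ n))) by ring.
    rewrite St. ring.
Qed.

(** Iterating [vwp_step] sends $r$ to $rq^n\to0$, where only the term $m=0$ survives and tends to
    $1$. This is the ${}_6\phi_5$ sum with one numerator parameter sent to infinity. The factor
    $(r;q)_\infty$ on the right makes the sum vanish at $r=1$, on which [cross_moment_bs] relies. *)
Lemma vwp_sum (B D r : C) : qnv (r * B) -> qnv (r * D) ->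
  pinf (r * B) * pinf (r * D) * vwpS B D r = pinf (wA B D r) * pinf r.
Proof.
  intros HB HD.
  apply cvg_unique with (fun n => qp (r * B) n * qp (r * D) n * vwpS B D r).
  - apply cvg_mult; [| apply cvg_const]. apply cvg_mult; apply pinf_cvg.
  - apply cvg_ext with (fun n => qp (wA B D r) n * qp r n * vwpS B D (r * q ^ n)).
    { intros n. symmetry. now apply vwp_iter. }
    replace (pinf (wA B D r) * pinf r) with (pinf (wA B D r) * pinf r * 1) by ring.
    apply cvg_mult; [apply cvg_mult; apply pinf_cvg |].
    destruct (vwp_le B D r HB HD) as [K [HK H]].
    destruct (summable_pow_tri (Cmod r) (Cmod_ge_0 r)) as [Hp [S0 HS]].
    assert (HS' : is_lim_seq (rsum (fun m => (K + Cmod (wA B D r)) * (Cmod r ^ m * q ^ tri m)))%R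
                    ((K + Cmod (wA B D r)) * S0)%R).
    { apply is_lim_seq_ext with (fun n => (K + Cmod (wA B D r)) * rsum (fun m => Cmod r ^ m * q ^ tri m)%R n)%R.
      - intros n. now rewrite rsum_scal.
      - now apply (is_lim_seq_scal_l _ _ (Finite S0)). }
    pose proof (Cmod_ge_0 (wA B D r)) as HA.
    apply cvg_squeeze with (fun n => ((K + Cmod (wA B D r)) * S0) * q ^ n)%R.
    2:{ apply is_lim_seq_0_scal, qpow_lim. }
    intros n. rewrite (Rmult_comm _ (q ^ n)). pose proof (qpow_pos n) as Hn.
    apply (ser_minus_1_le (vwp B D (r * q ^ n)) _ (q ^ n)%R _ _) with (4 := HS').
    + apply vwp_ser.
      * replace (r * q ^ n * B) with (r * B * q ^ n) by ring. now apply qnv_qpow.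
      * replace (r * q ^ n * D) with (r * D * q ^ n) by ring. now apply qnv_qpow.
    + unfold vwp. simpl. replace ((1 - wA B D (r * q ^ n) * 1) * (1 * 1 * 1) / (1 * 1 * 1) * (1 * 1) - 1)
        with (- (wA B D r * q ^ n)) by (unfold wA; field; apply q_neq_0).
      rewrite Cmod_opp, Cmod_mult, Cmod_qpow. nra.
    + intros k. eapply Rle_trans; [apply H |].
      replace ((q ^ n * Cmod r) ^ S k)%R with (q ^ n * ((q ^ n) ^ k * Cmod r ^ S k))%R
        by (rewrite Rpow_mult_distr; simpl; ring).
      assert (Hk : ((q ^ n) ^ k <= 1)%R).
      { rewrite <- (pow1 k). apply pow_incr. pose proof (qpow_le_1 n). lra. }
      assert (Hk0 : (0 < (q ^ n) ^ k)%R) by (now apply pow_lt).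
      pose proof (Hp (S k)) as Hp'. simpl in Hp'.
      change (Cmod r * Cmod r ^ k)%R with (Cmod r ^ S k)%R in Hp'.
      replace (K * (q ^ n * ((q ^ n) ^ k * Cmod r ^ S k) * q ^ tri (S k)))%R
        with (q ^ n * (K * (q ^ n) ^ k * (Cmod r ^ S k * q ^ tri (S k))))%R by ring.
      apply Rmult_le_compat_l; [lra |].
      apply Rmult_le_compat_r; [exact Hp' |]. nra.
Qed.

(** ** Gaussian binomials and terminating summations *)

(** Given by the q-Pascal rule rather than by quotients of factorials, so that the value is zero for
    $k>n$ and inductions need no division. *)
Fixpoint gb (n k : nat) : C :=
  match n, k with
  | _, O => 1
  | O, S _ => 0
  | S n', S k' => gb n' k' + q ^ S k' * gb n' (S k')
  end.

Lemma gb_0_r (n : nat) : gb n 0 = 1.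
Proof. now destruct n. Qed.

Lemma gb_SS (n k : nat) : gb (S n) (S k) = gb n k + q ^ S k * gb n (S k).
Proof. reflexivity. Qed.

Lemma gb_gt (n k : nat) : (n < k)%nat -> gb n k = 0.
Proof.
  revert k. induction n as [|n IH]; intros [|k] H; try lia; auto.
  rewrite gb_SS, !IH by lia. ring.
Qed.

Lemma gb_fact (k j : nat) : gb (k + j) k * (qp q k * qp q j) = qp q (k + j).
Proof.
  assert (H : forall n k j, n = (k + j)%nat -> gb n k * (qp q k * qp q j) = qp q n).
  { induction n as [|n IH]; intros [|k'] [|j'] E; try lia.
    - simpl. ring.
    - rewrite gb_0_r. replace (S j') with (S n) by lia. simpl. ring.
    - rewrite gb_SS, (gb_gt n (S k')) by lia. rewrite !qp_S.
      replace n with k' by lia. specialize (IH k' O ltac:(lia)). replace n with k' in IH by lia.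
      simpl (qp q 0) in *.
      replace ((gb k' k' + q ^ S k' * 0) * (qp q k' * (1 - q * q ^ k') * 1))
        with (gb k' k' * (qp q k' * 1) * (1 - q * q ^ k')) by ring.
      rewrite IH. reflexivity.
    - rewrite gb_SS.
      pose proof (IH k' (S j') ltac:(lia)) as I1. pose proof (IH (S k') j' ltac:(lia)) as I2.
      rewrite (qp_S q n). rewrite !qp_S in *.
      replace ((gb n k' + q ^ S k' * gb n (S k')) * (qp q k' * (1 - q * q ^ k') * (qp q j' * (1 - q * q ^ j'))))
        with (gb n k' * (qp q k' * (qp q j' * (1 - q * q ^ j'))) * (1 - q * q ^ k')
              + q ^ S k' * (1 - q * q ^ j') * (gb n (S k') * (qp q k' * (1 - q * q ^ k') * qp q j'))) by ring.
      rewrite I1, I2. replace n with (k' + S j')%nat by lia. rewrite Cpow_add_r. simpl. ring. }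
  now apply H.
Qed.

Lemma gb_eq (k j : nat) : gb (k + j) k = qp q (k + j) / (qp q k * qp q j).
Proof. rewrite <- gb_fact. field. split; apply qpq_neq_0. Qed.

(** The q-Pascal rule inside a sum; it is the induction step of both binomial expansions that
    follow. *)
Lemma csum_pascal (F : nat -> C) (s : nat) :
  csum (fun r => gb (S s) r * F r) (S (S s))
  = csum (fun r => gb s r * F (S r)) (S s) + csum (fun r => q ^ r * gb s r * F r) (S s).
Proof.
  rewrite csum_S_l.
  rewrite (csum_ext (fun k => gb (S s) (S k) * F (S k))
             (fun k => gb s k * F (S k) + q ^ S k * gb s (S k) * F (S k)))
    by (intros; rewrite gb_SS; ring).
  rewrite csum_plus.
  rewrite (csum_S_l (fun r => q ^ r * gb s r * F r)).
  rewrite (csum_S (fun k => q ^ S k * gb s (S k) * F (S k))), (gb_gt s (S s)) by lia. rewrite !gb_0_r. simpl (q ^ 0). ring.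
Qed.

(** A q-binomial change of basis: the products $\prod_{i<s}(x-tq^i)$ are re-expanded in the products
    with $t=1$. The proof rests on $x-tq^s=(x-q^r)+q^r(1-tq^{s-r})$, one summand for each branch of
    the Pascal rule. *)
Lemma xp_binomial (x t : C) (s : nat) :
  csum (fun r => gb s r * (xp x 1 r * qp t (s - r))) (S s) = xp x t s.
Proof.
  induction s as [|s IH]; [simpl; ring |].
  rewrite csum_pascal. simpl xp at 3. rewrite <- IH, Cmult_comm, <- csum_scal, <- csum_plus.
  apply csum_ext. intros r Hr. simpl (S s - S r)%nat.
  replace (S s - r)%nat with (S (s - r)) by lia. rewrite qp_S. simpl xp.
  replace (q ^ s) with (q ^ r * q ^ (s - r)) by (rewrite <- Cpow_add_r; f_equal; lia). ring.
Qed.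

Lemma qbinomial_sum (z : C) (j : nat) :
  csum (fun s => gb j s * ((- (1)) ^ s * q ^ tri s * z ^ s)) (S j) = qp z j.
Proof.
  revert z. induction j as [|j IH]; intros z; [simpl; ring |].
  rewrite csum_pascal, qp_S_l, <- (IH (z * q)), <- csum_scal, <- csum_plus.
  apply csum_ext. intros s _. simpl tri. rewrite Cpow_add_r, Cpow_mult_l. simpl. ring.
Qed.

Lemma xp_gb (k s : nat) : xp (q ^ k) 1 s = gb k s * qp q s * ((- (1)) ^ s * q ^ tri s).
Proof.
  destruct (le_lt_dec s k) as [H | H].
  - replace k with (s + (k - s))%nat by lia. generalize (k - s)%nat. clear -hq. intros j.
    assert (E : xp (q ^ (s + j)) 1 s * qp q j = (- (1)) ^ s * q ^ tri s * qp q (s + j)).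
    { revert j. induction s as [|s IH]; intros j; [simpl; ring |].
      specialize (IH (S j)). replace (s + S j)%nat with (S s + j)%nat in IH by lia.
      rewrite xp_S. change (tri (S s)) with (tri s + s)%nat. rewrite (Cpow_add_r _ (tri s) s). rewrite (qp_S q j) in IH.
      replace (xp (q ^ (S s + j)) 1 s * (q ^ (S s + j) - 1 * q ^ s) * qp q j)
        with (- q ^ s * (xp (q ^ (S s + j)) 1 s * (qp q j * (1 - q * q ^ j)))).
      2:{ rewrite (Cpow_add_r _ (S s) j). simpl. ring. }
      rewrite IH. simpl. ring. }
    rewrite gb_eq. pose proof (qpq_neq_0 j). pose proof (qpq_neq_0 s).
    replace (xp (q ^ (s + j)) 1 s) with (xp (q ^ (s + j)) 1 s * qp q j / qp q j) by (field; auto).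
    rewrite E. field. auto.
  - rewrite gb_gt by auto. replace s with ((s - k - 1) + S k)%nat by lia.
    generalize (s - k - 1)%nat. clear -hq. intros i. induction i as [|i IH]; simpl.
    + ring.
    + simpl in IH. rewrite IH. ring.
Qed.

Lemma qp_inv_xp (k s : nat) : qp (/ q ^ k) s * (q ^ k) ^ s = xp (q ^ k) 1 s.
Proof.
  pose proof (qpow_neq_0 k) as H. induction s as [|s IH]; [simpl; ring |].
  simpl. rewrite <- IH. field. auto.
Qed.

Lemma qp_inv_gb (k s : nat) :
  qp (/ q ^ k) s * (q ^ k) ^ s = gb k s * qp q s * ((- (1)) ^ s * q ^ tri s).
Proof. now rewrite qp_inv_xp, xp_gb. Qed.

(** The terminating q-Saalschütz sum multiplied through by its denominators. In this polynomial form
    it holds for all parameters, which is what permits substituting parameters that depend on $z$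
    and $m$. *)
Lemma saal_poly (a b g : C) (n : nat) :
  csum (fun j => gb n j * (qp a j * qp b j * (qp (a * b * g * q ^ j) (n - j) * qp g (n - j) * g ^ j))) (S n)
  = qp (a * g) n * qp (b * g) n.
Proof.
  induction n as [|n IH]; [simpl; ring |].
  (* Certificate of a q-Zeilberger recurrence: $F(n+1,j)-(1-agq^n)(1-bgq^n)F(n,j)=G(j+1)-G(j)$, with
     $G$ zero at both ends of the range. *)
  set (G := fun j => match j with O => RtoC 0 | S i =>
    - (q ^ (n - i) * gb n i * (qp a (S i) * qp b (S i)) * (qp (a * b * g * q ^ i) (n - i) * qp g (n - i) * g ^ S i)) end).
  set (F := fun n j => gb n j * (qp a j * qp b j * (qp (a * b * g * q ^ j) (n - j) * qp g (n - j) * g ^ j))).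
  change (csum (F n) (S n) = qp (a * g) n * qp (b * g) n) in IH.
  change (csum (F (S n)) (S (S n)) = qp (a * g) (S n) * qp (b * g) (S n)).
  assert (K : csum (fun j => F (S n) j + - ((1 - a * g * q ^ n) * (1 - b * g * q ^ n)) * F n j) (S (S n)) = 0).
  { rewrite (csum_ext _ (fun j => G (S j) - G j)).
    - rewrite csum_telescope. unfold G. rewrite (gb_gt n (S n)) by lia. ring.
    - intros j Hj. unfold F, G. destruct j as [|i].
      + rewrite !gb_0_r, !Nat.sub_0_r, !qp_S. simpl (q ^ 0). rewrite !Cmult_1_r.
        simpl (qp _ 0). simpl (_ ^ 0). ring.
      + destruct (Nat.eq_dec i n) as [-> | Hin].
        * rewrite (gb_gt n (S n)) by lia. rewrite gb_SS, (gb_gt n (S n)) by lia.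
          rewrite !Nat.sub_diag. simpl (qp _ 0). simpl (_ ^ 0). ring.
        * assert (En : exists l, n = (S i + l)%nat) by (exists (n - S i)%nat; lia).
          destruct En as [l En].
          assert (E1 : (S n - S i = S l)%nat) by lia. assert (E2 : (n - S i = l)%nat) by lia.
          assert (E3 : (n - i = S l)%nat) by lia. rewrite E1, E2, E3.
          pose proof (gb_fact (S i) l) as G1. pose proof (gb_fact i (S l)) as G2.
          replace (i + S l)%nat with n in G2 by lia. rewrite <- En in G1.
          rewrite gb_SS.
          set (k := qp q n / (qp q (S i) * qp q (S l))).
          pose proof (qpq_neq_0 (S i)) as N1. pose proof (qpq_neq_0 (S l)) as N2. rewrite !qp_S in *.
          assert (N3 : qp q i <> 0) by (intros N; apply N1; rewrite N; ring).
          assert (N4 : qp q l <> 0) by (intros N; apply N2; rewrite N; ring).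
          assert (N5 : 1 - q * q ^ i <> 0) by (intros N; apply N1; rewrite N; ring).
          assert (N6 : 1 - q * q ^ l <> 0) by (intros N; apply N2; rewrite N; ring).
          assert (X1 : gb n (S i) = k * (1 - q * q ^ l)).
          { unfold k. rewrite <- G1, !qp_S. field. auto. }
          assert (X2 : gb n i = k * (1 - q * q ^ i)).
          { unfold k. rewrite <- G2, !qp_S. field. auto. }
          rewrite X1, X2.
          rewrite <- (qp_S (a * b * g * q ^ i) l), (qp_S_l (a * b * g * q ^ i) l).
          replace (a * b * g * q ^ i * q) with (a * b * g * q ^ S i) by (simpl; ring).
          clearbody k. clear -En hq. rewrite En, Cpow_add_r. simpl (q ^ S _). simpl (g ^ S _). ring. }
  rewrite csum_plus, csum_scal in K.
  replace (csum (F n) (S (S n))) with (csum (F n) (S n)) in K.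
  2:{ rewrite (csum_S (F n) (S n)). assert (Z : F n (S n) = 0) by (unfold F; rewrite gb_gt by lia; ring).
      rewrite Z. ring. }
  rewrite IH in K. rewrite !qp_S. apply Cminus_eq_0. rewrite <- K. ring.
Qed.

(** Obtained from [saal_poly] by dividing by $(\varepsilon,\zeta;q)_n$ and reversing the factors
    $(h;q)_{n-j}$, where the balancing condition turns $h$ into $q^{1-n}/\zeta$. *)
Lemma saalschutz (al g ep ze : C) (n : nat) :
  al <> 0 -> g <> 0 -> ep <> 0 -> ze <> 0 -> qnv ep -> qnv ze ->
  ep * ze * q ^ n = al * g * q ->
  csum (fun j => qp (/ q ^ n) j * (qp al j * qp g j) * q ^ j / (qp q j * (qp ep j * qp ze j))) (S n)
  = g ^ n * (qp (ep / g) n * qp (ze / g) n) / (qp ep n * qp ze n).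
Proof.
  intros Ha Hg He Hz Ne Nz E. pose proof q_neq_0 as Hq. pose proof (qpow_neq_0 n) as Hqn.
  (* The third parameter of [saal_poly], fixed by requiring the product of the three to be
     $\varepsilon$. *)
  set (h := ep / (al * g)).
  assert (Eh : al * g * h = ep) by (unfold h; field; auto).
  assert (Eh2 : h = q / (ze * q ^ n)).
  { unfold h. replace ep with (al * g * q / (ze * q ^ n)) by (rewrite <- E; field; auto). field. auto. }
  pose proof (saal_poly al g h n) as P. rewrite Eh in P.
  assert (Hrev : forall j, (j <= n)%nat ->
     qp h (n - j) * (q ^ (tri (n - j) + (n - j)) * (- (ze * q ^ j)) ^ (n - j)) = q ^ (n - j) * qp (ze * q ^ j) (n - j)).
  { intros j Hj. pose proof (qp_rev (q / (ze * q ^ j)) (n - j)) as R.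
    pose proof (qpow_neq_0 j) as Hqj. pose proof (qpow_neq_0 (n - j)) as Hqnj.
    replace (q / (ze * q ^ j) / q ^ (n - j)) with h in R.
    2:{ rewrite Eh2. replace (q ^ n) with (q ^ j * q ^ (n - j)) by (rewrite <- Cpow_add_r; f_equal; lia).
        field. auto. }
    replace (q / (q / (ze * q ^ j))) with (ze * q ^ j) in R by (field; auto).
    assert (Hx : q / (ze * q ^ j) <> 0).
    { intros N. apply Hq. replace (RtoC q) with (q / (ze * q ^ j) * (ze * q ^ j)) by (field; auto).
      rewrite N. ring. }
    specialize (R Hx). rewrite Cmult_assoc, R.
    replace (- (q / (ze * q ^ j))) with (q * / (- (ze * q ^ j))).
    2:{ field. split; auto. }
    rewrite Cpow_mult_l, Cpow_inv.
    2:{ intros N. apply (Cmult_neq_0 ze (q ^ j)); auto. replace (ze * q ^ j) with (- - (ze * q ^ j)) by ring.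
        rewrite N. ring. }
    field. apply Cpow_nz. intros N. apply (Cmult_neq_0 ze (q ^ j)); auto.
    replace (ze * q ^ j) with (- - (ze * q ^ j)) by ring. rewrite N. ring. }
  assert (Nep : forall k, qp ep k <> 0) by (intros; now apply qp_neq_0).
  assert (Nze : forall k, qp ze k <> 0) by (intros; now apply qp_neq_0).
  set (c := q ^ tri n * (- ze) ^ n).
  assert (Hmz : - ze <> 0).
  { intros N. apply Hz. replace ze with (- - ze) by ring. rewrite N. ring. }
  assert (Hterm : forall j, (j <= n)%nat ->
    qp (/ q ^ n) j * (qp al j * qp g j) * q ^ j / (qp q j * (qp ep j * qp ze j))
    = c / (qp ep n * qp ze n) *
      (gb n j * (qp al j * qp g j * (qp (ep * q ^ j) (n - j) * qp h (n - j) * h ^ j)))).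
  { intros j Hj. specialize (Hrev j Hj).
    pose proof (qp_inv_gb n j) as B.
    assert (X1 : qp ep n = qp ep j * qp (ep * q ^ j) (n - j)).
    { rewrite <- qp_add. f_equal. lia. }
    assert (X2 : qp ze n = qp ze j * qp (ze * q ^ j) (n - j)).
    { rewrite <- qp_add. f_equal. lia. }
    pose proof (Nep n) as M1. pose proof (Nze n) as M2. rewrite X1 in M1. rewrite X2 in M2.
    assert (M3 : qp (ep * q ^ j) (n - j) <> 0) by (intros N; apply M1; rewrite N; ring).
    assert (M4 : qp (ze * q ^ j) (n - j) <> 0) by (intros N; apply M2; rewrite N; ring).
    rewrite X1, X2.
    assert (Y1 : qp (/ q ^ n) j = gb n j * qp q j * ((- (1)) ^ j * q ^ tri j) / (q ^ n) ^ j).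
    { rewrite <- B. field. now apply Cpow_nz. }
    assert (D : q ^ (tri (n - j) + (n - j)) * (- (ze * q ^ j)) ^ (n - j) <> 0).
    { apply Cmult_neq_0; [apply qpow_neq_0 |]. apply Cpow_nz.
      replace (- (ze * q ^ j)) with (- ze * q ^ j) by ring. apply Cmult_neq_0; auto. apply qpow_neq_0. }
    assert (Y2 : qp h (n - j) = q ^ (n - j) * qp (ze * q ^ j) (n - j) /
                   (q ^ (tri (n - j) + (n - j)) * (- (ze * q ^ j)) ^ (n - j))).
    { rewrite <- Hrev. field. now apply Cmult_neq_0_reg in D || (split; intros N; apply D; rewrite N; ring). }
    rewrite Y1, Y2, Eh2. unfold c.
    replace (- (ze * q ^ j)) with (- ze * q ^ j) by ring.
    replace ((q / (ze * q ^ n)) ^ j) with (q ^ j * (- (1)) ^ j * / ((- ze) ^ j * (q ^ n) ^ j)).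
    2:{ rewrite <- !Cpow_mult_l, <- Cpow_inv.
        - rewrite <- Cpow_mult_l. f_equal. field. auto.
        - apply Cmult_neq_0; auto. }
    assert (Tr : forall i l, tri (i + l) = (tri i + tri l + i * l)%nat).
    { intros i l. induction l as [|l IHl]; simpl; [rewrite Nat.add_0_r; lia |].
      rewrite Nat.add_succ_r. simpl. rewrite IHl. lia. }
    assert (Z : q ^ tri n = q ^ tri j * q ^ tri (n - j) * (q ^ j) ^ (n - j)).
    { rewrite <- Cpow_mult_r, <- !Cpow_add_r, <- Tr. f_equal. f_equal. lia. }
    rewrite Z. replace ((- ze) ^ n) with ((- ze) ^ j * (- ze) ^ (n - j)) by (rewrite <- Cpow_add_r; f_equal; lia).
    rewrite Cpow_mult_l, Cpow_add_r.
    field. repeat split; auto using qpow_neq_0, Cpow_nz, qpq_neq_0. }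
  rewrite (csum_ext _ (fun j => c / (qp ep n * qp ze n) *
      (gb n j * (qp al j * qp g j * (qp (ep * q ^ j) (n - j) * qp h (n - j) * h ^ j)))))
    by (intros; apply Hterm; lia).
  rewrite csum_scal, P.
  replace (g * h) with (ep / al) by (unfold h; field; auto).
  replace (al * h) with (ep / g) by (unfold h; field; auto).
  pose proof (qp_rev (q * g / ze) n) as R.
  replace (q * g / ze / q ^ n) with (ep / al) in R.
  2:{ replace ep with (al * g * q / (ze * q ^ n)) by (rewrite <- E; field; auto). field. auto. }
  replace (q / (q * g / ze)) with (ze / g) in R by (field; auto).
  assert (Hx : q * g / ze <> 0).
  { intros N. apply (Cmult_neq_0 q g); auto. replace (q * g) with (q * g / ze * ze) by (field; auto).
    rewrite N. ring. }
  specialize (R Hx). rewrite Cpow_add_r in R.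
  replace (- (q * g / ze)) with (q * g * / (- ze)) in R by (field; auto).
  rewrite !Cpow_mult_l, Cpow_inv in R by auto.
  assert (R' : c * qp (ep / al) n = g ^ n * qp (ze / g) n).
  { unfold c. replace (q ^ tri n * (- ze) ^ n * qp (ep / al) n)
      with (qp (ep / al) n * (q ^ tri n * q ^ n) * (- ze) ^ n / q ^ n) by (field; auto).
    rewrite R. field. split; auto. now apply Cpow_nz. }
  replace (c / (qp ep n * qp ze n) * (qp (ep / g) n * qp (ep / al) n))
    with ((c * qp (ep / al) n) * qp (ep / g) n / (qp ep n * qp ze n)) by (field; auto).
  rewrite R'. field. auto.
Qed.

Lemma gb_shift_terms (m r n : nat) : (r <= m)%nat ->
  qp (/ q ^ m) (r + n) = qp (/ q ^ m) r * qp (/ q ^ (m - r)) n.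
Proof.
  intros H. rewrite qp_add. do 2 f_equal.
  replace m with (r + (m - r))%nat at 1 by lia. rewrite Cpow_add_r. field.
  split; apply qpow_neq_0.
Qed.

(** The binomial coefficient removes the terms $s<r$. Putting $s=r+j$ leaves a terminating series of
    the same type with parameters shifted by $q^r$, and [saal_bal_shift] carries the balancing
    condition over. *)
Lemma saalschutz_shifted (al g ep ze : C) (m r : nat) : (r <= m)%nat -> qnv ep -> qnv ze ->
  csum (fun s => qp (/ q ^ m) s * qp al s * q ^ s / (qp q s * (qp ep s * qp ze s)) * (gb s r * qp g (s - r))) (S m)
  = qp (/ q ^ m) r * qp al r * q ^ r / (qp q r * (qp ep r * qp ze r)) *
    csum (fun j => qp (/ q ^ (m - r)) j * (qp (al * q ^ r) j * qp g j) * q ^ j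
                   / (qp q j * (qp (ep * q ^ r) j * qp (ze * q ^ r) j))) (S (m - r)).
Proof.
  intros H He Hz. rewrite <- csum_scal.
  replace (S m) with (r + S (m - r))%nat by lia. rewrite csum_add, csum_0.
  2:{ intros k Hk. rewrite (gb_gt k r) by lia. ring. }
  rewrite Cplus_0_l. apply csum_ext. intros n _.
  rewrite gb_shift_terms by auto. replace (r + n - r)%nat with n by lia.
  rewrite gb_eq. rewrite !(qp_add _ r n), Cpow_add_r.
  assert (N1 := qpq_neq_0 r). assert (N2 := qpq_neq_0 n). assert (N3 := qpq_neq_0 (r + n)).
  rewrite qp_add in N3.
  assert (N4 : qp (q * q ^ r) n <> 0) by (intros N; apply N3; rewrite N; ring).
  assert (N5 : qp ep r <> 0) by now apply qp_neq_0. assert (N6 : qp ze r <> 0) by now apply qp_neq_0.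
  assert (N7 : qp (ep * q ^ r) n <> 0) by now apply qp_neq_0, qnv_qpow.
  assert (N8 : qp (ze * q ^ r) n <> 0) by now apply qp_neq_0, qnv_qpow.
  field. repeat split; auto.
Qed.

Lemma saal_bal_shift (al g ep ze : C) (m r : nat) : (r <= m)%nat ->
  ep * ze * q ^ m = al * g * q ->
  ep * q ^ r * (ze * q ^ r) * q ^ (m - r) = al * q ^ r * g * q.
Proof.
  intros H E. replace (ep * q ^ r * (ze * q ^ r) * q ^ (m - r))
    with (ep * ze * (q ^ r * q ^ (m - r)) * q ^ r) by ring.
  rewrite <- Cpow_add_r. replace (r + (m - r))%nat with m by lia. rewrite E. ring.
Qed.

(** * The balanced polynomials and the exchange of $a$ and $ra$ *)

Definition bs (A : C) (m s : nat) : C := qp (/ q ^ m) s * qp (q ^ m * A) s.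

Definition Eterm (p1 p2 r a z : C) (m s : nat) : C :=
  bs (wA p1 p2 r) m s * q ^ s / (qp q s * (qp p1 s * qp p2 s * qp (r * a * a) s)) * pp a z s.

(** With $p_1 = ab$, $p_2 = ac$ and $r = q/(ad)$, both balanced 4phi3 polynomials of the theorem
    are of this form: in $x$, and in $\gamma$ with $a$ replaced by $\tilde a$. *)
Definition EE (p1 p2 r a z : C) (m : nat) : C := csum (Eterm p1 p2 r a z m) (S m).

(** [EE] is normalised to be $1$ at $z=a$, and [kap] is its value at $z=ra$. It is the constant met
    when the first and the fourth Askey-Wilson parameters $a$ and $ra$ trade places. *)
Definition kap (p1 p2 r : C) (m : nat) : C :=
  qp (r * p1) m * qp (r * p2) m / (qp p1 m * qp p2 m) * (/ r) ^ m.

(** The factor [xp (q ^ k) 1 s] vanishes for $s > k$, so that [DD p1 p2 r k] is a polynomial of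
    degree $k$ in $q^{-m} + A q^m$. *)
Definition DD (p1 p2 r : C) (k m : nat) : C :=
  csum (fun s => xp (q ^ k) 1 s / qp q s * (q / r) ^ s * bs (wA p1 p2 r) m s / (qp p1 s * qp p2 s)) (S m).

(** The nonvanishing conditions are collected so as to be invariant under
    $(p_1,p_2,r)\to(rp_1,rp_2,1/r)$; every later statement can then be used for the exchanged data
    too. *)
Definition admissible (p1 p2 r : C) : Prop :=
  p1 <> 0 /\ p2 <> 0 /\ nonintegral r /\ qnv p1 /\ qnv p2 /\ qnv (r * p1) /\ qnv (r * p2).

Lemma admissible_swap (p1 p2 r : C) : admissible p1 p2 r -> admissible (r * p1) (r * p2) (/ r).
Proof.
  intros (H1 & H2 & Hr & Q1 & Q2 & Q3 & Q4). pose proof (proj1 Hr) as H0.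
  repeat split; auto using Cmult_neq_0; try apply nonintegral_inv, Hr.
  - replace (/ r * (r * p1)) with p1 by (field; auto). auto.
  - replace (/ r * (r * p2)) with p2 by (field; auto). auto.
Qed.

Lemma wA_swap (p1 p2 r : C) : r <> 0 -> wA (r * p1) (r * p2) (/ r) = wA p1 p2 r.
Proof. intros H. unfold wA. field. split; auto. apply q_neq_0. Qed.

Lemma wA_neq_0 (p1 p2 r : C) : admissible p1 p2 r -> wA p1 p2 r <> 0.
Proof.
  intros (H1 & H2 & [Hr _] & _) E.
  apply (Cmult_neq_0 (p1 * p2) r); auto using Cmult_neq_0.
  replace (p1 * p2 * r) with (wA p1 p2 r * q) by (unfold wA; field; apply q_neq_0).
  rewrite E. ring.
Qed.

(** The sum over [s] converts coefficients in the basis $(az,a/z;q)_s$ into coefficients in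
    the basis attached to $ra$. *)
Lemma coef_swap (p1 p2 r : C) (m i : nat) : admissible p1 p2 r -> (i <= m)%nat ->
  csum (fun s => bs (wA p1 p2 r) m s * q ^ s / (qp q s * (qp p1 s * qp p2 s)) * (gb s i * qp (/ r) (s - i))) (S m)
  = kap p1 p2 r m * (r ^ i * bs (wA p1 p2 r) m i * q ^ i / (qp q i * (qp (r * p1) i * qp (r * p2) i))).
Proof.
  intros H Hi. pose proof (wA_neq_0 _ _ _ H) as HA.
  destruct H as (H1 & H2 & Hr & Q1 & Q2 & Q3 & Q4). pose proof (proj1 Hr) as H0.
  set (A := wA p1 p2 r) in *. unfold bs.
  rewrite saalschutz_shifted by auto.
  pose proof (qpow_neq_0 i) as Hqi. pose proof (qpow_neq_0 m) as Hqm.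
  assert (Hri : / r <> 0) by apply (nonintegral_inv _ Hr).
  rewrite saalschutz; auto using Cmult_neq_0, qnv_qpow.
  2:{ apply saal_bal_shift; auto. unfold A, wA. field. split; auto. apply q_neq_0. }
  unfold kap.
  replace (p1 * q ^ i / / r) with (r * p1 * q ^ i) by (field; auto).
  replace (p2 * q ^ i / / r) with (r * p2 * q ^ i) by (field; auto).
  assert (Sp : forall y, qp y m = qp y i * qp (y * q ^ i) (m - i)).
  { intros y. rewrite <- qp_add. f_equal. lia. }
  rewrite !(Sp (r * p1)), !(Sp (r * p2)), !(Sp p1), !(Sp p2).
  replace ((/ r) ^ m) with ((/ r) ^ i * (/ r) ^ (m - i)) by (rewrite <- Cpow_add_r; f_equal; lia).
  rewrite (Cpow_inv r i) by auto.
  assert (N1 := qpq_neq_0 i).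
  assert (N2 : qp p1 i <> 0) by now apply qp_neq_0.
  assert (N3 : qp p2 i <> 0) by now apply qp_neq_0.
  assert (N4 : qp (r * p1) i <> 0) by now apply qp_neq_0.
  assert (N5 : qp (r * p2) i <> 0) by now apply qp_neq_0.
  assert (N6 : qp (p1 * q ^ i) (m - i) <> 0) by now apply qp_neq_0, qnv_qpow.
  assert (N7 : qp (p2 * q ^ i) (m - i) <> 0) by now apply qp_neq_0, qnv_qpow.
  field. repeat split; auto. now apply Cpow_nz.
Qed.

(** [saal_poly] at $(raz,\,ra/z,\,1/r)$, whose right side is exactly $(az,a/z;q)_s$. *)
Lemma pp_change_base (r a z : C) (s : nat) : r <> 0 -> z <> 0 ->
  csum (fun i => gb s i * (pp (r * a) z i * (qp (r * a * a * q ^ i) (s - i) * qp (/ r) (s - i) * (/ r) ^ i))) (S s)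
  = pp a z s.
Proof.
  intros Hr Hz. pose proof (saal_poly (r * a * z) (r * a / z) (/ r) s) as P.
  replace (r * a * z * (r * a / z) * / r) with (r * a * a) in P by (field; auto).
  unfold pp. replace (a * z) with (r * a * z * / r) by (field; auto).
  replace (a / z) with (r * a / z * / r) by (field; auto). exact P.
Qed.

(** The symmetry of the Askey-Wilson polynomial in its parameters. Rewriting $(az,a/z;q)_s$ in the
    basis attached to $ra$ and interchanging the finite sums leaves an inner balanced sum, evaluated
    in [coef_swap]. *)
Lemma EE_swap (p1 p2 r a z : C) (m : nat) : admissible p1 p2 r -> z <> 0 -> qnv (r * a * a) ->
  EE p1 p2 r a z m = kap p1 p2 r m * EE (r * p1) (r * p2) (/ r) (r * a) z m.
Proof.
  intros H Hz Ha. pose proof H as (H1 & H2 & Hr & Q1 & Q2 & Q3 & Q4). pose proof (proj1 Hr) as H0.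
  unfold EE. rewrite <- csum_scal.
  rewrite (csum_ext (Eterm p1 p2 r a z m) (fun s => csum (fun i =>
     bs (wA p1 p2 r) m s * q ^ s / (qp q s * (qp p1 s * qp p2 s)) * (gb s i * qp (/ r) (s - i))
     * (pp (r * a) z i * (/ r) ^ i / qp (r * a * a) i)) (S m))).
  - rewrite csum_swap. apply csum_ext. intros i Hi.
    rewrite (csum_ext _ (fun s => pp (r * a) z i * (/ r) ^ i / qp (r * a * a) i *
       (bs (wA p1 p2 r) m s * q ^ s / (qp q s * (qp p1 s * qp p2 s)) * (gb s i * qp (/ r) (s - i)))))
      by (intros; ring).
    rewrite csum_scal, coef_swap by (auto; lia).
    unfold Eterm. rewrite wA_swap by auto.
    replace (/ r * (r * a) * (r * a)) with (r * a * a) by (field; auto).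
    rewrite Cpow_inv by auto.
    assert (N1 := qpq_neq_0 i).
    assert (N4 : qp (r * p1) i <> 0) by now apply qp_neq_0.
    assert (N5 : qp (r * p2) i <> 0) by now apply qp_neq_0.
    assert (N6 : qp (r * a * a) i <> 0) by now apply qp_neq_0.
    field. repeat split; auto. now apply Cpow_nz.
  - intros s Hs. unfold Eterm. rewrite <- (pp_change_base r a z s) by auto.
    replace (S m) with (S s + (m - s))%nat by lia.
    rewrite csum_add, (csum_0 _ (m - s)).
    2:{ intros k _. rewrite (gb_gt s) by lia. ring. }
    rewrite Cplus_0_r, <- csum_scal. apply csum_ext. intros i Hi.
    assert (X : qp (r * a * a) s = qp (r * a * a) i * qp (r * a * a * q ^ i) (s - i)).
    { rewrite <- qp_add. f_equal. lia. }
    rewrite X.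
    assert (N1 := qpq_neq_0 s).
    assert (N4 : qp p1 s <> 0) by now apply qp_neq_0.
    assert (N5 : qp p2 s <> 0) by now apply qp_neq_0.
    assert (N6 : qp (r * a * a) i <> 0) by now apply qp_neq_0.
    assert (N7 : qp (r * a * a * q ^ i) (s - i) <> 0) by now apply qp_neq_0, qnv_qpow.
    field. repeat split; auto.
Qed.

(** * Expansion of the polynomials in two families *)

Definition XK (r a z : C) (k : nat) : C := q ^ k * pp a z k / (qp q k * qp (q / r) k).

Lemma XK_le (r a z : C) : nonintegral r ->
  exists K, (0 < K)%R /\ forall k, (Cmod (XK r a z k) <= K * q ^ k)%R.
Proof.
  intros H. pose proof (nonintegral_q_inv r H) as Hq.
  destruct (qp_inv_le_0 _ Hq) as [K1 [HK1 H1]]. destruct inv_qpq_le as [K2 [HK2 H2]].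
  pose proof (ppbd_pos a z).
  exists (ppbd a z * (K2 * K1))%R. split; [repeat apply Rmult_lt_0_compat; auto using qbd_pos |].
  intros k. unfold XK. pose proof (qpq_neq_0 k). assert (qp (q / r) k <> 0) by now apply qp_neq_0.
  replace (q ^ k * pp a z k / (qp q k * qp (q / r) k))
    with (pp a z k * (/ qp q k * / qp (q / r) k) * q ^ k) by (field; auto).
  rewrite !Cmod_mult, Cmod_qpow. apply Rmult_le_compat_r; [left; apply qpow_pos |].
  apply Rmult_le_compat; auto using Cmod_ge_0, pp_le_0.
  - apply Rmult_le_pos; apply Cmod_ge_0.
  - apply Rmult_le_compat; auto using Cmod_ge_0.
Qed.

(** This is [twoterm_eq] at $(aq^s,ra)$ multiplied by $(az,a/z;q)_s$. In the first series the index
    moves up by $s$, and the factor $\prod_{i<s}(q^k-q^i)$, zero for $k<s$, lets it start at $0$. In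
    the second series [qp_xp_cross] turns the dependence on $s$ into a polynomial in $q^k$. Thus $z$
    and $k$ enter through functions independent of $s$, and the finite sum over $s$ can be taken
    coefficientwise. *)
Lemma basis_expansion (r a z : C) (s : nat) :
  nonintegral r -> a <> 0 -> z <> 0 -> qnv (r * a * a) ->
  exists V1 V2,
    ser (fun k => XK r a z k * (xp (q ^ k) 1 s * (/ r) ^ s)) V1 /\
    ser (fun k => XK (/ r) (r * a) z k * xp (q ^ k) (/ r) s) V2 /\
    pp a z s * pinf (r * a * a) / qp (r * a * a) s
    = ppinf (r * a) z / pinf r * V1 + ppinf a z / pinf (/ r) * V2.
Proof.
  intros Hr Ha Hz Haa. pose proof Hr as [H0 [Hr1 Hr2]].
  set (e := r * a). set (b := a * q ^ s). set (t := / r).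
  pose proof (qpow_neq_0 s) as Hqs.
  assert (He : e <> 0) by (apply Cmult_neq_0; auto).
  assert (Hb : b <> 0) by (apply Cmult_neq_0; auto).
  assert (Ht : t <> 0) by apply (nonintegral_inv _ Hr).
  assert (Eeb : e / b = r / q ^ s) by (unfold e, b; field; auto).
  assert (Ebe : b / e = t * q ^ s) by (unfold e, b, t; field; auto).
  assert (Hn : nonintegral (e / b)) by (rewrite Eeb; now apply nonintegral_div).
  assert (Hn' : nonintegral (b / e)) by now apply nonintegral_swap.
  pose proof (SA_ser b e z Hb He Hn) as S1. pose proof (SA_ser e b z He Hb Hn') as S2.
  pose proof (twoterm_eq b e z Hb He Hz Hn) as T.
  pose proof (nonintegral_q_inv r Hr) as Hqr.
  assert (Nr : pinf r <> 0) by now apply pinf_neq_0.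
  assert (Nt : pinf t <> 0) by now apply pinf_neq_0.
  assert (Nts : qp t s <> 0) by now apply qp_neq_0.
  assert (Nqr : qp (q / r) s <> 0) by now apply qp_neq_0.
  assert (Naa : qp (r * a * a) s <> 0) by now apply qp_neq_0.
  assert (Hmr : - r <> 0).
  { intros N. apply H0. replace r with (- - r) by ring. rewrite N. ring. }
  pose proof (qp_rev r s H0) as Rv.
  assert (Nrs : qp (r / q ^ s) s <> 0).
  { intros N. rewrite N, Cmult_0_l in Rv. symmetry in Rv. revert Rv.
    apply Cmult_neq_0; auto. now apply Cpow_nz. }
  assert (Pr : pinf (r / q ^ s) = qp (r / q ^ s) s * pinf r).
  { rewrite (pinf_split (r / q ^ s) s). do 2 f_equal. field. auto. }
  assert (Pt : pinf t = qp t s * pinf (t * q ^ s)) by apply pinf_split.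
  assert (Nts' : pinf (t * q ^ s) <> 0).
  { intros N. apply Nt. rewrite Pt, N. ring. }
  exists (pp a z s * / qp (r / q ^ s) s * SA b e z), (qp t s * SA e b z). split; [| split].
  - apply ser_shift with s.
    + intros n Hns. rewrite xp_gb, gb_gt by auto. ring.
    + apply ser_ext with (fun n => pp a z s * / qp (r / q ^ s) s * SAterm b e z n); [| now apply ser_scal].
      intros n. unfold SAterm, XK.
      replace (q * b / e) with (q / r * q ^ s) by (unfold b, e; field; auto).
      rewrite xp_gb, gb_eq, pp_add, (qp_add (q / r)), Cpow_add_r. fold b.
      assert (N1 := qpq_neq_0 s). assert (N2 := qpq_neq_0 n). assert (N3 := qpq_neq_0 (s + n)).
      assert (N4 : qp (q / r * q ^ s) n <> 0) by now apply qp_neq_0, qnv_qpow.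
      replace (/ qp (r / q ^ s) s) with (q ^ (tri s + s) / ((- r) ^ s * qp (q / r) s)).
      2:{ rewrite <- Rv. field. auto using qpow_neq_0. }
      rewrite Cpow_add_r. replace ((- r) ^ s) with ((- (1)) ^ s * r ^ s) by (rewrite <- Cpow_mult_l; f_equal; ring).
      unfold t. rewrite (Cpow_inv r s) by auto.
      assert (O : (- (1)) ^ s * (- (1)) ^ s = 1).
      { rewrite <- Cpow_mult_l. replace (- (1) * - (1)) with (RtoC 1) by ring. apply Cpow_1_l. }
      assert (O' : (- (1)) ^ s <> 0) by (intros N; rewrite N, Cmult_0_l in O; symmetry in O; now apply C1_nz).
      assert (O2 : (- (1)) ^ s = / (- (1)) ^ s).
      { replace (/ (- (1)) ^ s) with ((- (1)) ^ s * (- (1)) ^ s / (- (1)) ^ s) by (rewrite O; field; auto).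
        field. auto. }
      rewrite O2 at 2. assert (r ^ s <> 0) by now apply Cpow_nz.
      field. repeat split; auto.
  - apply ser_ext with (fun k => qp t s * SAterm e b z k); [| now apply ser_scal].
    intros k. unfold SAterm, XK. fold e.
    replace (q * e / b) with (q / t / q ^ s) by (unfold e, b, t; field; auto).
    pose proof (qp_xp_cross t s k Ht) as X.
    assert (Nk := qpq_neq_0 k).
    assert (N2 : qp (q / t) k <> 0).
    { apply qp_neq_0. unfold t. replace (q / / r) with (r * q) by (field; auto). now apply qnv_q. }
    assert (N3 : qp (q / t / q ^ s) k <> 0).
    { intros N. rewrite N, Cmult_0_l in X. symmetry in X. revert X. now apply Cmult_neq_0. }
    fold t. replace (xp (q ^ k) t s) with (qp t s * qp (q / t) k / qp (q / t / q ^ s) k).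
    + field. auto.
    + rewrite <- X. field. auto.
  - assert (Paa : pinf (e * a) = qp (e * a) s * pinf (b * e)).
    { rewrite (pinf_split _ s). do 2 f_equal. unfold b, e. ring. }
    rewrite Paa, <- T. unfold twoterm. rewrite Eeb, Ebe, Pr, Pt, (ppinf_split a z s). fold b.
    field. repeat split; auto.
Qed.

(** Summing [basis_expansion] over $s$ gives $D_k$ at once in the first family. In the second family
    the factors $\prod_{i<s}(q^k-q^i/r)$ are re-expanded with [xp_binomial], and [coef_swap]
    performs the sum over $s$; the result is $\kappa_m$ times the exchanged $D_k$. *)
Lemma E_expansion (p1 p2 r a z : C) (m : nat) :
  admissible p1 p2 r -> a <> 0 -> z <> 0 -> qnv (r * a * a) ->
  exists L1 L2,
    ser (fun k => XK r a z k * DD p1 p2 r k m) L1 /\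
    ser (fun k => XK (/ r) (r * a) z k * DD (r * p1) (r * p2) (/ r) k m) L2 /\
    pinf (r * a * a) * EE p1 p2 r a z m
    = ppinf (r * a) z / pinf r * L1 + kap p1 p2 r m * (ppinf a z / pinf (/ r) * L2).
Proof.
  intros H Ha Hz Haa. pose proof H as (H1 & H2 & Hr & Q1 & Q2 & Q3 & Q4). pose proof (proj1 Hr) as H0.
  set (eta := fun s => bs (wA p1 p2 r) m s * q ^ s / (qp q s * (qp p1 s * qp p2 s))).
  set (f1 := fun s k => XK r a z k * (xp (q ^ k) 1 s * (/ r) ^ s)).
  set (f2 := fun s k => XK (/ r) (r * a) z k * xp (q ^ k) (/ r) s).
  assert (B : forall s, ser (f1 s) (CSeries (f1 s)) /\ ser (f2 s) (CSeries (f2 s)) /\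
     pp a z s * pinf (r * a * a) / qp (r * a * a) s
     = ppinf (r * a) z / pinf r * CSeries (f1 s) + ppinf a z / pinf (/ r) * CSeries (f2 s)).
  { intros s. destruct (basis_expansion r a z s Hr Ha Hz Haa) as (V1 & V2 & S1 & S2 & E).
    change (ser (f1 s) V1) in S1. change (ser (f2 s) V2) in S2.
    rewrite (CSeries_ser _ _ S1), (CSeries_ser _ _ S2). auto. }
  assert (T1 : ser (fun k => XK r a z k * DD p1 p2 r k m) (csum (fun s => eta s * CSeries (f1 s)) (S m))).
  { eapply ser_ext; [| apply (ser_csum (fun s k => eta s * f1 s k) (fun s => eta s * CSeries (f1 s)))].
    - intros k. unfold DD. rewrite <- csum_scal. apply csum_ext. intros s _. unfold eta, f1.
      replace ((q / r) ^ s) with (q ^ s * (/ r) ^ s) by (rewrite <- Cpow_mult_l; reflexivity).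
      assert (N1 := qpq_neq_0 s).
      assert (N2 : qp p1 s <> 0) by now apply qp_neq_0. assert (N3 : qp p2 s <> 0) by now apply qp_neq_0.
      field. auto.
    - intros s _. apply (ser_scal (eta s)), (proj1 (B s)). }
  assert (T2 : ser (fun k => kap p1 p2 r m * (XK (/ r) (r * a) z k * DD (r * p1) (r * p2) (/ r) k m))
                 (csum (fun s => eta s * CSeries (f2 s)) (S m))).
  { eapply ser_ext; [| apply (ser_csum (fun s k => eta s * f2 s k) (fun s => eta s * CSeries (f2 s)))].
    2:{ intros s _. apply (ser_scal (eta s)), (proj1 (proj2 (B s))). }
    intros k. cbv beta.
    rewrite (csum_ext _ (fun s => csum (fun i => XK (/ r) (r * a) z k * xp (q ^ k) 1 i *
        (eta s * (gb s i * qp (/ r) (s - i)))) (S m))).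
    + rewrite csum_swap. unfold DD. rewrite wA_swap by auto. rewrite <- !csum_scal. apply csum_ext. intros i Hi.
      rewrite csum_scal. unfold eta. rewrite coef_swap by (auto; lia).
      replace ((q / / r) ^ i) with (q ^ i * r ^ i) by (rewrite <- Cpow_mult_l; f_equal; field; auto).
      assert (N1 := qpq_neq_0 i).
      assert (N2 : qp (r * p1) i <> 0) by now apply qp_neq_0. assert (N3 : qp (r * p2) i <> 0) by now apply qp_neq_0.
      field. auto.
    + intros s Hs. unfold f2. rewrite <- xp_binomial.
      replace (S m) with (S s + (m - s))%nat by lia.
      rewrite csum_add, (csum_0 _ (m - s)).
      2:{ intros i _. rewrite (gb_gt s) by lia. ring. }
      rewrite Cplus_0_r, <- !csum_scal. apply csum_ext. intros i _. ring. }
  (* The second series has been summed with $\kappa_m$ inside; since $\kappa_m\neq0$ it can be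
     divided out again, to display $\kappa_m$ as a separate factor. *)
  pose proof (ser_scal (/ kap p1 p2 r m) _ _ T2) as T2'.
  assert (Nk : kap p1 p2 r m <> 0).
  { unfold kap, Cdiv. repeat apply Cmult_neq_0; try (apply qp_neq_0; assumption).
    - intros N. apply C1_nz. rewrite <- (Cinv_r (qp p1 m * qp p2 m)), N; [ring |].
      apply Cmult_neq_0; now apply qp_neq_0.
    - apply Cpow_nz, (nonintegral_inv _ Hr). }
  eexists. eexists. split; [exact T1 | split].
  - eapply ser_ext; [| exact T2']. intros k. simpl. field. auto.
  - unfold EE. rewrite <- csum_scal.
    replace (kap p1 p2 r m * (ppinf a z / pinf (/ r) * (/ kap p1 p2 r m * csum (fun s => eta s * CSeries (f2 s)) (S m))))
      with (ppinf a z / pinf (/ r) * csum (fun s => eta s * CSeries (f2 s)) (S m)).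
    2:{ field. split; auto. apply pinf_neq_0, Hr. }
    rewrite <- !csum_scal, <- csum_plus. apply csum_ext. intros s _.
    destruct (B s) as (_ & _ & E).
    replace (ppinf (r * a) z / pinf r * (eta s * CSeries (f1 s)) + ppinf a z / pinf (/ r) * (eta s * CSeries (f2 s)))
      with (eta s * (ppinf (r * a) z / pinf r * CSeries (f1 s) + ppinf a z / pinf (/ r) * CSeries (f2 s))) by ring.
    rewrite <- E. unfold eta, Eterm.
    assert (N1 := qpq_neq_0 s). assert (N2 : qp p1 s <> 0) by now apply qp_neq_0.
    assert (N3 : qp p2 s <> 0) by now apply qp_neq_0. assert (N4 : qp (r * a * a) s <> 0) by now apply qp_neq_0.
    field. auto.
Qed.

(** ** The moment functional of the weights *)

Lemma tri_add (i l : nat) : tri (i + l) = (tri i + tri l + i * l)%nat.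
Proof.
  induction l as [|l IH]; simpl; [rewrite Nat.add_0_r; lia |].
  rewrite Nat.add_succ_r. simpl. rewrite IH. lia.
Qed.

Lemma Cpow_m1_sqr (s : nat) : (- (1)) ^ s * (- (1)) ^ s = 1.
Proof.
  rewrite <- Cpow_mult_l. replace (- (1) * - (1)) with (RtoC 1) by ring. apply Cpow_1_l.
Qed.

Lemma Cpow_opp_split (x : C) (s : nat) : (- x) ^ s = (- (1)) ^ s * x ^ s.
Proof. rewrite <- Cpow_mult_l. f_equal. ring. Qed.

Lemma tri_double (s : nat) : (2 * tri s + s = s * s)%nat.
Proof. induction s as [|s IH]; simpl in *; lia. Qed.

(** The factor $(q^{-m},Aq^m;q)_s$ vanishes for $m<s$. With $m=s+n$ its product with the weight is,
    up to a constant, the weight of index $n$ for $(Bq^s,Dq^s,r)$, so [vwp_sum] evaluates the moment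
    in closed form. *)
Lemma moment_bs (B D r : C) (s : nat) : qnv (r * B) -> qnv (r * D) ->
  ser (fun m => vwp B D r m * bs (wA B D r) m s) (qp B s * qp D s * (r / q) ^ s * vwpS B D r).
Proof.
  intros HB HD. set (A := wA B D r).
  assert (EA : wA (B * q ^ s) (D * q ^ s) r = A * q ^ (2 * s)).
  { unfold A, wA. rewrite qpow_double. field. apply q_neq_0. }
  assert (HB' : qnv (r * (B * q ^ s))) by (rewrite Cmult_assoc; now apply qnv_qpow).
  assert (HD' : qnv (r * (D * q ^ s))) by (rewrite Cmult_assoc; now apply qnv_qpow).
  set (c := qp A (2 * s) * qp B s * qp D s / (qp (r * B) s * qp (r * D) s) * (r / q) ^ s).
  pose proof q_neq_0 as Hq.
  assert (N1 : qp (r * B) s <> 0) by now apply qp_neq_0.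
  assert (N2 : qp (r * D) s <> 0) by now apply qp_neq_0.
  replace (qp B s * qp D s * (r / q) ^ s * vwpS B D r) with (c * vwpS (B * q ^ s) (D * q ^ s) r).
  - apply ser_shift with s.
    + intros n Hn. unfold bs. rewrite (qp_zero n s Hn). ring.
    + apply ser_ext with (fun n => c * vwp (B * q ^ s) (D * q ^ s) r n).
      2:{ apply ser_scal. now apply vwp_ser. }
      intros n. unfold vwp. rewrite EA. fold A. unfold bs.
      rewrite !Cmult_assoc.
      pose proof (qpow_neq_0 (s + n)) as Hsn.
      assert (Y1 : qp (/ q ^ (s + n)) s = qp q (s + n) / qp q n * ((- (1)) ^ s * q ^ tri s) / (q ^ (s + n)) ^ s).
      { replace (qp (/ q ^ (s + n)) s) with (qp (/ q ^ (s + n)) s * (q ^ (s + n)) ^ s / (q ^ (s + n)) ^ s)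
          by (field; now apply Cpow_nz).
        rewrite qp_inv_gb, gb_eq. field.
        repeat split; try apply qpq_neq_0; now apply Cpow_nz. }
      assert (Y2 : qp A (s + n) * qp (q ^ (s + n) * A) s = qp A (2 * s) * qp (A * q ^ (2 * s)) n).
      { rewrite (Cmult_comm (q ^ (s + n))), <- !qp_add. f_equal. lia. }
      rewrite Y1, !(qp_add _ s n). rewrite <- (qp_add A s n). unfold c.
      replace (q ^ (2 * (s + n))) with (q ^ (2 * s) * q ^ (2 * n)) by (rewrite <- Cpow_add_r; f_equal; lia).
      assert (Y3 : (- r) ^ (s + n) * q ^ tri (s + n) * ((- (1)) ^ s * q ^ tri s) / (q ^ (s + n)) ^ s
                   = (r / q) ^ s * (- r) ^ n * q ^ tri n).
      { rewrite tri_add, !Cpow_add_r, Cpow_mult_l, <- !Cpow_mult_r.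
        rewrite (Cpow_opp_split r s). replace ((r / q) ^ s) with (r ^ s * / q ^ s).
        2:{ rewrite <- Cpow_inv, <- Cpow_mult_l by auto. reflexivity. }
        rewrite <- tri_double, Cpow_add_r, qpow_double, (Nat.mul_comm n s).
        replace ((- (1)) ^ s * r ^ s * (- r) ^ n * (q ^ tri s * q ^ tri n * q ^ (s * n)) * ((- (1)) ^ s * q ^ tri s) /
          (q ^ tri s * q ^ tri s * q ^ s * q ^ (s * n)))
          with ((- (1)) ^ s * (- (1)) ^ s * (r ^ s * (- r) ^ n * (q ^ tri s * q ^ tri n * q ^ (s * n)) * q ^ tri s /
          (q ^ tri s * q ^ tri s * q ^ s * q ^ (s * n)))) by (unfold Cdiv; ring).
        rewrite Cpow_m1_sqr. field. repeat split; apply qpow_neq_0. }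
      assert (M1 := qpq_neq_0 s). assert (M2 := qpq_neq_0 n).
      assert (M3 : qp (q * q ^ s) n <> 0).
      { pose proof (qpq_neq_0 (s + n)) as M. rewrite qp_add in M. intros N. apply M. rewrite N. ring. }
      assert (M4 : qp (r * B * q ^ s) n <> 0) by now apply qp_neq_0, qnv_qpow.
      assert (M5 : qp (r * D * q ^ s) n <> 0) by now apply qp_neq_0, qnv_qpow.
      assert (M6 : (q ^ (s + n)) ^ s <> 0) by now apply Cpow_nz.
      transitivity ((1 - A * (q ^ (2 * s) * q ^ (2 * n))) * (qp A (2 * s) * qp (A * q ^ (2 * s)) n) *
        (qp B s * qp (B * q ^ s) n) * (qp D s * qp (D * q ^ s) n)
        / (qp q n * (qp (r * B) s * qp (r * B * q ^ s) n) * (qp (r * D) s * qp (r * D * q ^ s) n))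
        * ((r / q) ^ s * (- r) ^ n * q ^ tri n)).
      * field. repeat split; auto.
      * rewrite <- Y2, <- Y3. field. repeat split; auto.
  - pose proof (vwp_sum _ _ _ HB HD) as S1. pose proof (vwp_sum _ _ _ HB' HD') as S2.
    rewrite EA in S2. fold A in S1.
    rewrite (pinf_split A (2 * s)) in S1. rewrite !Cmult_assoc in S2.
    rewrite (pinf_split (r * B) s), (pinf_split (r * D) s) in S1.
    assert (M4 : pinf (r * B * q ^ s) <> 0) by now apply pinf_neq_0, qnv_qpow.
    assert (M5 : pinf (r * D * q ^ s) <> 0) by now apply pinf_neq_0, qnv_qpow.
    assert (X1 : vwpS B D r = qp A (2 * s) * (pinf (A * q ^ (2 * s)) * pinf r)
                   / (qp (r * B) s * qp (r * D) s * (pinf (r * B * q ^ s) * pinf (r * D * q ^ s)))).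
    { rewrite Cmult_assoc, <- S1. field. auto. }
    rewrite <- S2 in X1. rewrite X1. unfold c. field. auto.
Qed.

(** A second basis of the polynomials in $q^{-m}+Aq^m$, with nodes governed by $B$ instead of $1$.
    Moments of products of one element of each basis factor completely, which would fail with two
    elements of the basis [bs]. *)
Definition fs (A B : C) (m l : nat) : C := qp (B * q ^ m) l * qp (B / A / q ^ m) l.

Lemma moment_bs_fs (B D r : C) (l s : nat) :
  B <> 0 -> D <> 0 -> r <> 0 -> qnv (r * B) -> qnv (r * D) ->
  ser (fun m => vwp B D r m * (bs (wA B D r) m s * fs (wA B D r) B m l))
      (vwpS B D r * (qp B (s + l) * qp D s * qp (q / r) l * (/ D) ^ l * (r / q ^ S l) ^ s)).
Proof.
  intros B0 D0 r0 HB HD. pose proof q_neq_0 as Hq.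
  set (A := wA B D r).
  assert (EA : A = B * D * r / q) by reflexivity. 
  assert (A0 : A <> 0).
  { intros N. apply (Cmult_neq_0 (B * D) r); auto using Cmult_neq_0.
    replace (B * D * r) with (A * q) by (rewrite EA; field; auto). rewrite N. ring. }
  revert s. induction l as [|l IH]; intros s.
  - eapply ser_ext; [| eapply ser_eq; [apply (moment_bs B D r s HB HD) |]].
    + intros m. cbv beta. unfold fs. fold A. simpl. ring.
    + rewrite Nat.add_0_r. simpl. replace (q * 1) with (RtoC q) by ring. ring.
  - pose proof (qpow_neq_0 s) as Hs. pose proof (qpow_neq_0 l) as Hl.
    (* The new factor of [fs] and the next factor of [bs] are both affine in $q^{-m}+Aq^m$. Here
       [be] is the quotient of their slopes and [al] the remaining constant, so one factor is traded
       for the other and the induction closes. *)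
    set (be := B / A * q ^ l / q ^ s).
    set (al := 1 + B * B / A * q ^ (2 * l) - be * (1 + A * q ^ (2 * s))).
    pose proof (ser_plus _ _ _ _ (ser_scal al _ _ (IH s)) (ser_scal be _ _ (IH (S s)))) as K.
    eapply ser_ext; [| eapply ser_eq; [exact K |]].
    + intros m. cbv beta. unfold fs, bs. fold A. rewrite !qp_S. pose proof (qpow_neq_0 m) as Hm.
      unfold al, be. rewrite !qpow_double. field. auto.
    + replace (S s + l)%nat with (S (s + l)) by lia. rewrite Nat.add_succ_r, !qp_S.
      replace ((r / q ^ S (S l)) ^ s) with ((r / q ^ S l) ^ s * / q ^ s).
      2:{ rewrite <- Cpow_inv, <- Cpow_mult_l by auto. f_equal. simpl. field. auto. }
      rewrite (Cpow_S (r / q ^ S l) s), (Cpow_S (/ D)).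
      generalize ((r / q ^ S l) ^ s). intros X. unfold al, be. rewrite !qpow_double, EA, Cpow_add_r.
      simpl (RtoC q ^ S _). field. repeat split; auto.
Qed.

(** By the finite q-binomial theorem the alternating sum sends $q^{-is}$ to $(q^{-i};q)_j$, which is
    zero for $0\le i<j$. The factor $q^{-ls}(Bq^s;q)_l$ is a polynomial in $q^{-s}$ of degree $l$
    with leading coefficient $1$, so only the top degree $n+l=j$ can contribute. *)
Lemma binomial_poly_sum (B : C) (j l n : nat) : (n + l <= j)%nat ->
  csum (fun s => gb j s * ((- (1)) ^ s * q ^ tri s * (/ q ^ n) ^ s * (/ q ^ l) ^ s * qp (B * q ^ s) l)) (S j)
  = if Nat.eq_dec (n + l) j then qp (/ q ^ j) j else 0.
Proof.
  revert n. induction l as [|l IH]; intros n H.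
  - rewrite (csum_ext _ (fun s => gb j s * ((- (1)) ^ s * q ^ tri s * (/ q ^ n) ^ s))).
    + rewrite qbinomial_sum. rewrite Nat.add_0_r in *. destruct (Nat.eq_dec n j) as [-> | Hn]; auto.
      apply qp_zero. lia.
    + intros s _. simpl. replace (/ 1) with (RtoC 1) by field. rewrite Cpow_1_l. ring.
  - rewrite (csum_ext _ (fun s =>
      gb j s * ((- (1)) ^ s * q ^ tri s * (/ q ^ S n) ^ s * (/ q ^ l) ^ s * qp (B * q ^ s) l) +
      (- (B * q ^ l)) * (gb j s * ((- (1)) ^ s * q ^ tri s * (/ q ^ n) ^ s * (/ q ^ l) ^ s * qp (B * q ^ s) l)))).
    + rewrite csum_plus, csum_scal, !IH by lia.
      replace (S n + l)%nat with (n + S l)%nat by lia.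
      destruct (Nat.eq_dec (n + l) j); [lia |]. ring.
    + intros s _. rewrite qp_S. pose proof (qpow_neq_0 s) as Hs. pose proof q_neq_0 as Hq.
      assert (E : forall k, (/ q ^ S k) ^ s = / q ^ s * (/ q ^ k) ^ s).
      { intros k. replace (/ q ^ S k) with (/ q * / q ^ k) by (simpl; field; auto using qpow_neq_0).
        now rewrite Cpow_mult_l, (Cpow_inv q s). }
      rewrite !E. field. auto.
Qed.

Lemma xp_vanish (k s : nat) : (k < s)%nat -> xp (q ^ k) 1 s = 0.
Proof. intros H. rewrite xp_gb, gb_gt by auto. ring. Qed.

Lemma bs_vanish (A : C) (m s : nat) : (m < s)%nat -> bs A m s = 0.
Proof. intros H. unfold bs. rewrite qp_zero by auto. ring. Qed.

Lemma csum_extend (f : nat -> C) (m n : nat) : (m <= n)%nat ->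
  (forall s, (m < s)%nat -> f s = 0) -> csum f (S n) = csum f (S m).
Proof.
  intros H Hf. replace (S n) with (S m + (n - m))%nat by lia.
  rewrite csum_add, (csum_0 _ (n - m)); [ring |]. intros k _. apply Hf. lia.
Qed.

Definition dcoef (p1 p2 r : C) (k s : nat) : C :=
  xp (q ^ k) 1 s / qp q s * (q / r) ^ s / (qp p1 s * qp p2 s).

Lemma DD_dcoef (p1 p2 r : C) (k m : nat) :
  DD p1 p2 r k m = csum (fun s => dcoef p1 p2 r k s * bs (wA p1 p2 r) m s) (S k).
Proof.
  unfold DD.
  rewrite (csum_ext _ (fun s => dcoef p1 p2 r k s * bs (wA p1 p2 r) m s))
    by (intros; unfold dcoef, Cdiv; ring).
  destruct (le_lt_dec m k) as [H | H].
  - symmetry. apply csum_extend; auto. intros s Hs. rewrite bs_vanish by auto. ring.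
  - apply csum_extend; [lia |]. intros s Hs. unfold dcoef. rewrite xp_vanish by auto.
    unfold Cdiv. ring.
Qed.

(** In the sum over the coefficients of $D_j$ the quotient $(p_1;q)_{s+l}/(p_1;q)_s=(p_1q^s;q)_l$
    brings the moments to the form of [binomial_poly_sum]. Hence $D_j$ is orthogonal to every
    polynomial in $q^{-m}+Aq^m$ of degree below $j$. *)
Lemma moment_fs_DD (p1 p2 r : C) (l j : nat) : admissible p1 p2 r -> (l <= j)%nat ->
  ser (fun m => vwp p1 p2 r m * (fs (wA p1 p2 r) p1 m l * DD p1 p2 r j m))
      (vwpS p1 p2 r * (qp (q / r) l * (/ p2) ^ l * if Nat.eq_dec l j then qp (/ q ^ j) j else 0)).
Proof.
  intros H Hl. pose proof H as (H1 & H2 & Hr & Q1 & Q2 & Q3 & Q4). pose proof (proj1 Hr) as H0.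
  pose proof q_neq_0 as Hq.
  set (A := wA p1 p2 r).
  set (v := fun s => vwpS p1 p2 r * (qp p1 (s + l) * qp p2 s * qp (q / r) l * (/ p2) ^ l * (r / q ^ S l) ^ s)).
  apply ser_eq with (csum (fun s => dcoef p1 p2 r j s * v s) (S j)).
  - eapply ser_ext; [| apply (ser_csum (fun s m => dcoef p1 p2 r j s * (vwp p1 p2 r m * (bs A m s * fs A p1 m l)))
                                      (fun s => dcoef p1 p2 r j s * v s))].
    + intros m. cbv beta. rewrite DD_dcoef.
      replace (vwp p1 p2 r m * (fs A p1 m l * csum (fun s => dcoef p1 p2 r j s * bs (wA p1 p2 r) m s) (S j)))
        with (vwp p1 p2 r m * fs A p1 m l * csum (fun s => dcoef p1 p2 r j s * bs (wA p1 p2 r) m s) (S j)) by ring.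
      rewrite <- csum_scal. apply csum_ext. intros s _. fold A. ring.
    + intros s _. apply (ser_scal (dcoef p1 p2 r j s)). now apply moment_bs_fs.
  - pose proof (binomial_poly_sum p1 j l 0 Hl) as Bp. simpl (0 + l)%nat in Bp. rewrite <- Bp.
    rewrite !Cmult_assoc, <- csum_scal. apply csum_ext. intros s _.
    unfold dcoef, v. rewrite xp_gb.
    rewrite (qp_add p1 s l).
    replace ((/ q ^ 0) ^ s) with (RtoC 1).
    2:{ simpl. replace (/ 1) with (RtoC 1) by field. now rewrite Cpow_1_l. }
    replace ((/ q ^ l) ^ s) with ((q / r) ^ s * (r / q ^ S l) ^ s).
    2:{ rewrite <- Cpow_mult_l. f_equal. simpl. field. repeat split; auto using qpow_neq_0. }
    assert (N1 := qpq_neq_0 s). assert (N2 : qp p1 s <> 0) by now apply qp_neq_0.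
    assert (N3 : qp p2 s <> 0) by now apply qp_neq_0. field. auto.
Qed.

(** Elements of [bs] are traded for elements of [fs] one factor at a time. As lower degrees are
    annihilated by $D_j$, only the quotient of leading coefficients $(A/p_1)^kq^{-kl}$ remains when
    the total degree is $j$. *)
Lemma moment_bs_fs_DD (p1 p2 r : C) (j k l : nat) : admissible p1 p2 r -> (k + l <= j)%nat ->
  ser (fun m => vwp p1 p2 r m * (bs (wA p1 p2 r) m k * (fs (wA p1 p2 r) p1 m l * DD p1 p2 r j m)))
      (if Nat.eq_dec (k + l) j
       then (wA p1 p2 r / p1) ^ k / q ^ (k * l) *
            (vwpS p1 p2 r * (qp (q / r) j * (/ p2) ^ j * qp (/ q ^ j) j))
       else 0).
Proof.
  intros H. pose proof H as (H1 & H2 & Hr & Q1 & Q2 & Q3 & Q4). pose proof (proj1 Hr) as H0.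
  pose proof q_neq_0 as Hq. pose proof (wA_neq_0 _ _ _ H) as A0. set (A := wA p1 p2 r) in *.
  revert l. induction k as [|k IH]; intros l Hkl.
  - simpl (0 + l)%nat in *.
    eapply ser_ext; [| eapply ser_eq; [apply (moment_fs_DD p1 p2 r l j H Hkl) |]].
    + intros m. unfold bs. simpl. fold A. ring.
    + destruct (Nat.eq_dec l j) as [-> |]; [| ring]. simpl. field.
  - pose proof (qpow_neq_0 k) as Hk. pose proof (qpow_neq_0 l) as Hl.
    set (be := A / p1 * q ^ k / q ^ l).
    set (al := 1 + A * q ^ (2 * k) - be * (1 + p1 * p1 / A * q ^ (2 * l))).
    pose proof (ser_plus _ _ _ _ (ser_scal al _ _ (IH l ltac:(lia))) (ser_scal be _ _ (IH (S l) ltac:(lia)))) as K.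
    eapply ser_ext; [| eapply ser_eq; [exact K |]].
    + intros m. cbv beta. unfold fs, bs. rewrite !qp_S. pose proof (qpow_neq_0 m) as Hm.
      unfold al, be. rewrite !qpow_double. field. auto.
    + destruct (Nat.eq_dec (k + l) j) as [|_]; [lia |].
      replace (S k + l)%nat with (k + S l)%nat by lia.
      destruct (Nat.eq_dec (k + S l) j) as [E |]; [| ring].
      replace (S k * l)%nat with (l + k * l)%nat by lia.
      replace (k * S l)%nat with (k + k * l)%nat by lia.
      rewrite !Cpow_add_r, Cpow_S. unfold be. field. repeat split; auto using qpow_neq_0.
Qed.

(** Only the top coefficient of $D_k$ meets $D_j$, and only for $k=j$. The polynomials are
    ${}_3\phi_2(q^{-k},q^{-m},Aq^m;p_1,p_2;q,q^{k+1}/r)$, the continuous dual $q^{-1}$-Hahn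
    polynomials in $q^{-m}+Aq^m$. *)
Lemma orthogonality_le (p1 p2 r : C) (k j : nat) : admissible p1 p2 r -> (k <= j)%nat ->
  ser (fun m => vwp p1 p2 r m * (DD p1 p2 r k m * DD p1 p2 r j m))
      (if Nat.eq_dec k j
       then vwpS p1 p2 r * (qp q j * qp (q / r) j) / (q ^ j * (qp p1 j * qp p2 j))
       else 0).
Proof.
  intros H Hk. pose proof H as (H1 & H2 & Hr & Q1 & Q2 & Q3 & Q4). pose proof (proj1 Hr) as H0.
  pose proof q_neq_0 as Hq. set (A := wA p1 p2 r) in *.
  set (X := vwpS p1 p2 r * (qp (q / r) j * (/ p2) ^ j * qp (/ q ^ j) j)).
  set (v := fun s => if Nat.eq_dec (s + 0) j then (A / p1) ^ s / q ^ (s * 0) * X else 0).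
  apply ser_eq with (csum (fun s => dcoef p1 p2 r k s * v s) (S k)).
  - eapply ser_ext; [| apply (ser_csum (fun s m => dcoef p1 p2 r k s *
       (vwp p1 p2 r m * (bs A m s * (fs A p1 m 0 * DD p1 p2 r j m)))) (fun s => dcoef p1 p2 r k s * v s))].
    + intros m. cbv beta. rewrite (DD_dcoef p1 p2 r k).
      rewrite (Cmult_comm (csum _ _)), Cmult_assoc, <- csum_scal.
      apply csum_ext. intros s _. fold A. unfold fs. simpl. ring.
    + intros s Hs. apply (ser_scal (dcoef p1 p2 r k s)). apply moment_bs_fs_DD; auto. lia.
  - destruct (Nat.eq_dec k j) as [-> | Hkj].
    + rewrite csum_S, csum_0.
      2:{ intros s Hs. unfold v. destruct (Nat.eq_dec (s + 0) j); [lia | ring]. }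
      unfold v. destruct (Nat.eq_dec (j + 0) j); [| lia]. unfold dcoef, X.
      rewrite Nat.mul_0_r. simpl (q ^ 0).
      rewrite xp_gb.
      assert (G : gb j j = 1).
      { replace (gb j j) with (gb (j + 0) j) by (f_equal; lia). rewrite gb_eq, Nat.add_0_r. simpl.
        field. apply qpq_neq_0. }
      pose proof (qp_inv_gb j j) as B. rewrite G in *. rewrite <- Cpow_mult_r in B.
      rewrite <- tri_double, Cpow_add_r, qpow_double in B.
      assert (Y : qp (/ q ^ j) j = qp q j * (- (1)) ^ j / (q ^ tri j * q ^ j)).
      { replace (qp (/ q ^ j) j) with (qp (/ q ^ j) j * (q ^ tri j * q ^ tri j * q ^ j) / (q ^ tri j * q ^ tri j * q ^ j))
          by (field; repeat split; apply qpow_neq_0).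
        rewrite B. field. repeat split; apply qpow_neq_0. }
      rewrite Y.
      assert (Z : (q / r) ^ j * ((A / p1) ^ j * (/ p2) ^ j) = 1).
      { rewrite <- !Cpow_mult_l. replace (q / r * (A / p1 * / p2)) with (RtoC 1); [apply Cpow_1_l |].
        unfold A, wA. field. auto. }
      assert (N1 := qpq_neq_0 j). assert (N2 : qp p1 j <> 0) by now apply qp_neq_0.
      assert (N3 : qp p2 j <> 0) by now apply qp_neq_0.
      transitivity (((- (1)) ^ j * (- (1)) ^ j) * ((q / r) ^ j * ((A / p1) ^ j * (/ p2) ^ j)) *
         (vwpS p1 p2 r * (qp q j * qp (q / r) j) / (q ^ j * (qp p1 j * qp p2 j)))).
      * field. repeat split; auto using qpow_neq_0.
      * rewrite Z, Cpow_m1_sqr. ring.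
    + apply csum_0. intros s Hs. unfold v. destruct (Nat.eq_dec (s + 0) j); [lia | ring].
Qed.

Lemma orthogonality (p1 p2 r : C) (k j : nat) : admissible p1 p2 r ->
  ser (fun m => vwp p1 p2 r m * (DD p1 p2 r k m * DD p1 p2 r j m))
      (if Nat.eq_dec k j
       then vwpS p1 p2 r * (qp q k * qp (q / r) k) / (q ^ k * (qp p1 k * qp p2 k))
       else 0).
Proof.
  intros H. destruct (le_lt_dec k j) as [Hk | Hk].
  - eapply ser_eq; [now apply orthogonality_le |].
    destruct (Nat.eq_dec k j) as [-> |]; reflexivity.
  - eapply ser_ext; [| eapply ser_eq; [apply (orthogonality_le p1 p2 r j k H); lia |]].
    + intros m. cbv beta. ring.
    + destruct (Nat.eq_dec j k); [lia |]. destruct (Nat.eq_dec k j); [lia | reflexivity].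
Qed.

(** The factors $(p_2;q)_m$ and $(rp_1;q)_m$ cancel together with the power of $r$. The mixed weight
    is thus of the same very-well-poised shape with the third parameter equal to $1$ and the same
    $A$. *)
Lemma vwp_kap (p1 p2 r : C) (m : nat) : admissible p1 p2 r ->
  vwp p1 p2 r m * kap p1 p2 r m = vwp p1 (r * p2) 1 m.
Proof.
  intros (H1 & H2 & Hr & Q1 & Q2 & Q3 & Q4). pose proof (proj1 Hr) as H0. unfold vwp, kap.
  replace (wA p1 (r * p2) 1) with (wA p1 p2 r) by (unfold wA; field; apply q_neq_0).
  rewrite !Cmult_1_l, (Cpow_opp_split r), Cpow_inv by auto.
  assert (N1 := qpq_neq_0 m). assert (N2 : qp p1 m <> 0) by now apply qp_neq_0.
  assert (N3 : qp p2 m <> 0) by now apply qp_neq_0.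
  assert (N4 : qp (r * p1) m <> 0) by now apply qp_neq_0.
  assert (N5 : qp (r * p2) m <> 0) by now apply qp_neq_0.
  field. repeat split; auto. now apply Cpow_nz.
Qed.

(** The total mass of the mixed weight contains $(1;q)_\infty=0$, and [moment_bs] makes every single
    moment a multiple of this mass. Products of two basis elements reduce to single ones by the same
    trade of affine factors as in [moment_bs_fs]. *)
Lemma cross_moment_bs (p1 p2 r : C) (s i : nat) : admissible p1 p2 r ->
  ser (fun m => vwp p1 (r * p2) 1 m * (bs (wA p1 p2 r) m s * bs (wA p1 p2 r) m i)) 0.
Proof.
  intros (H1 & H2 & Hr & Q1 & Q2 & Q3 & Q4). pose proof q_neq_0 as Hq.
  assert (EA : wA p1 (r * p2) 1 = wA p1 p2 r) by (unfold wA; field; auto).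
  set (A := wA p1 p2 r) in *.
  assert (HB : qnv (1 * p1)) by (rewrite Cmult_1_l; auto).
  assert (HD : qnv (1 * (r * p2))) by (rewrite Cmult_1_l; auto).
  assert (P1 : pinf 1 = 0) by (rewrite pinf_S; ring).
  revert s. induction i as [|i IH]; intros s.
  - eapply ser_ext; [| eapply ser_eq; [apply (moment_bs p1 (r * p2) 1 s HB HD) |]].
    + intros m. cbv beta. rewrite EA. unfold bs. simpl. ring.
    + pose proof (vwp_sum _ _ _ HB HD) as S1. rewrite P1 in S1.
      assert (Z : vwpS p1 (r * p2) 1 = 0).
      { pose proof (pinf_neq_0 _ HB). pose proof (pinf_neq_0 _ HD).
        replace (vwpS p1 (r * p2) 1) with (pinf (1 * p1) * pinf (1 * (r * p2)) * vwpS p1 (r * p2) 1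
          / (pinf (1 * p1) * pinf (1 * (r * p2)))) by (field; auto).
        rewrite S1. field. auto. }
      rewrite Z. ring.
  - pose proof (qpow_neq_0 s) as Hs. set (be := q ^ i / q ^ s).
    set (al := 1 + A * q ^ (2 * i) - be * (1 + A * q ^ (2 * s))).
    pose proof (ser_plus _ _ _ _ (ser_scal al _ _ (IH s)) (ser_scal be _ _ (IH (S s)))) as K.
    eapply ser_ext; [| eapply ser_eq; [exact K | ring]].
    intros m. cbv beta. unfold bs. rewrite !qp_S. pose proof (qpow_neq_0 m) as Hm.
    unfold al, be. rewrite !qpow_double. field. auto.
Qed.

Lemma cross_orthogonality (p1 p2 r : C) (k j : nat) : admissible p1 p2 r ->
  ser (fun m => vwp p1 p2 r m * kap p1 p2 r m *
         (DD p1 p2 r k m * DD (r * p1) (r * p2) (/ r) j m)) 0.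
Proof.
  intros H. pose proof (proj1 (proj1 (proj2 (proj2 H)))) as H0.
  set (A := wA p1 p2 r).
  set (g := fun s i m => vwp p1 (r * p2) 1 m * (bs A m s * bs A m i)).
  apply ser_eq with (csum (fun s => csum (fun i => dcoef p1 p2 r k s * dcoef (r * p1) (r * p2) (/ r) j i * 0) (S j)) (S k)).
  - eapply ser_ext; [| apply (ser_csum
      (fun s m => csum (fun i => dcoef p1 p2 r k s * dcoef (r * p1) (r * p2) (/ r) j i * g s i m) (S j))
      (fun s => csum (fun i => dcoef p1 p2 r k s * dcoef (r * p1) (r * p2) (/ r) j i * 0) (S j)))].
    + intros m. cbv beta. rewrite vwp_kap, !DD_dcoef, wA_swap by auto. fold A.
      set (S2 := csum (fun s => dcoef (r * p1) (r * p2) (/ r) j s * bs A m s) (S j)).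
      rewrite (csum_ext _ (fun s => vwp p1 (r * p2) 1 m * S2 * (dcoef p1 p2 r k s * bs A m s))).
      * rewrite csum_scal. ring.
      * intros s _.
        replace (vwp p1 (r * p2) 1 m * S2 * (dcoef p1 p2 r k s * bs A m s))
          with (vwp p1 (r * p2) 1 m * (dcoef p1 p2 r k s * bs A m s) * S2) by ring.
        unfold S2. rewrite <- csum_scal. apply csum_ext. intros i _. unfold g. ring.
    + intros s _. apply (ser_csum (fun i m => dcoef p1 p2 r k s * dcoef (r * p1) (r * p2) (/ r) j i * g s i m)
        (fun i => dcoef p1 p2 r k s * dcoef (r * p1) (r * p2) (/ r) j i * 0)).
      intros i _. apply (ser_scal (dcoef p1 p2 r k s * dcoef (r * p1) (r * p2) (/ r) j i)).
      now apply cross_moment_bs.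
  - apply csum_0. intros s _. apply csum_0. intros i _. ring.
Qed.

(** ** Growth estimates *)

(** The defining sum has terms of size up to $q^{-m^2/2}$ that cancel. Expanding $(q^mA,a/z;q)_k$ by
    [saal_poly] and evaluating the resulting balanced sum over $k$ gives another terminating form,
    whose terms are individually of geometric size. *)
Lemma Sears_form (p1 p2 r a z : C) (m : nat) :
  admissible p1 p2 r -> a <> 0 -> z <> 0 -> qnv (r * a * a) ->
  EE p1 p2 r a z m = csum (fun i =>
    qp (p1 * z / a) i * qp (p1 / wA p1 p2 r / q ^ m) i * (a / z * (wA p1 p2 r / p1) * q ^ m) ^ i / qp p1 i
    * (qp (/ q ^ m) i * qp (a * z) i * q ^ i / qp q i)
    * ((a * z * q ^ i) ^ (m - i) * (qp (p2 / (a * z)) (m - i) * qp (r * a / z) (m - i)))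
    / (qp p2 m * qp (r * a * a) m)) (S m).
Proof.
  intros H Ha Hz Haa. pose proof (wA_neq_0 _ _ _ H) as HA.
  pose proof H as (H1 & H2 & Hr & Q1 & Q2 & Q3 & Q4). pose proof (proj1 Hr) as H0.
  pose proof q_neq_0 as Hq. pose proof (qpow_neq_0 m) as Hqm.
  assert (EA : wA p1 p2 r = p1 * p2 * r / q) by reflexivity.
  set (A := wA p1 p2 r) in *.
  set (g := a / z * (A / p1) * q ^ m).
  assert (Hg : g <> 0).
  { intros N. assert (K : a * A * q ^ m <> 0) by auto using Cmult_neq_0.
    apply K. replace (a * A * q ^ m) with (g * p1 * z) by (unfold g; field; auto). rewrite N. ring. }
  assert (Haz : a * z <> 0) by now apply Cmult_neq_0.
  assert (Hraa : r * a * a <> 0) by (repeat apply Cmult_neq_0; auto).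
  unfold EE.
  rewrite (csum_ext (Eterm p1 p2 r a z m) (fun k => csum (fun i =>
     qp (p1 * z / a) i * qp (p1 / A / q ^ m) i * g ^ i / qp p1 i *
     (qp (/ q ^ m) k * qp (a * z) k * q ^ k / (qp q k * (qp p2 k * qp (r * a * a) k)) * (gb k i * qp g (k - i)))) (S m))).
  - rewrite csum_swap. apply csum_ext. intros i Hi. rewrite csum_scal, saalschutz_shifted by (auto; lia).
    rewrite (csum_ext _ (fun j => qp (/ q ^ (m - i)) j * (qp g j * qp (a * z * q ^ i) j) * q ^ j
               / (qp q j * (qp (p2 * q ^ i) j * qp (r * a * a * q ^ i) j)))) by (intros; unfold Cdiv; ring).
    pose proof (qpow_neq_0 i) as Hqi.
    rewrite saalschutz; auto using Cmult_neq_0, qnv_qpow.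
    2:{ rewrite (Cmult_comm g). apply saal_bal_shift; [lia |]. unfold g. rewrite EA. field. auto. }
    replace (p2 * q ^ i / (a * z * q ^ i)) with (p2 / (a * z)) by (field; auto).
    replace (r * a * a * q ^ i / (a * z * q ^ i)) with (r * a / z) by (field; auto).
    assert (Sp : forall y, qp y m = qp y i * qp (y * q ^ i) (m - i)).
    { intros y. rewrite <- qp_add. f_equal. lia. }
    rewrite (Sp p2), (Sp (r * a * a)).
    assert (N1 := qpq_neq_0 i). assert (N2 : qp p1 i <> 0) by now apply qp_neq_0.
    assert (N3 : qp p2 i <> 0) by now apply qp_neq_0.
    assert (N4 : qp (r * a * a) i <> 0) by now apply qp_neq_0.
    assert (N6 : qp (p2 * q ^ i) (m - i) <> 0) by now apply qp_neq_0, qnv_qpow.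
    assert (N7 : qp (r * a * a * q ^ i) (m - i) <> 0) by now apply qp_neq_0, qnv_qpow.
    field. repeat split; auto.
  - intros k Hk. unfold Eterm, bs, pp. fold A.
    pose proof (saal_poly (p1 * z / a) (p1 / A / q ^ m) g k) as P.
    replace (p1 * z / a * (p1 / A / q ^ m) * g) with p1 in P by (unfold g; field; auto).
    replace (p1 * z / a * g) with (q ^ m * A) in P by (unfold g; field; auto).
    replace (p1 / A / q ^ m * g) with (a / z) in P by (unfold g; field; auto).
    replace (qp (/ q ^ m) k * qp (q ^ m * A) k * q ^ k / (qp q k * (qp p1 k * qp p2 k * qp (r * a * a) k)) *
             (qp (a * z) k * qp (a / z) k))
      with (qp (/ q ^ m) k * qp (a * z) k * q ^ k / (qp q k * (qp p1 k * qp p2 k * qp (r * a * a) k)) *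
             (qp (q ^ m * A) k * qp (a / z) k)) by (unfold Cdiv; ring).
    rewrite <- P. replace (S m) with (S k + (m - k))%nat by lia.
    rewrite csum_add, (csum_0 _ (m - k)).
    2:{ intros i _. rewrite (gb_gt k) by lia. unfold Cdiv. ring. }
    rewrite Cplus_0_r, <- csum_scal. apply csum_ext. intros i Hi.
    assert (X : qp p1 k = qp p1 i * qp (p1 * q ^ i) (k - i)).
    { rewrite <- qp_add. f_equal. lia. }
    rewrite X.
    assert (N1 := qpq_neq_0 k). assert (N2 : qp p1 i <> 0) by now apply qp_neq_0.
    assert (N3 : qp p2 k <> 0) by now apply qp_neq_0.
    assert (N4 : qp (r * a * a) k <> 0) by now apply qp_neq_0.
    assert (N6 : qp (p1 * q ^ i) (k - i) <> 0) by now apply qp_neq_0, qnv_qpow.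
    field. repeat split; auto.
Qed.

Lemma qp_big_le (y : C) (Y : R) (m i : nat) : (Cmod y <= Y)%R -> (i <= m)%nat ->
  (Cmod (qp (y / q ^ m) i) * (q ^ m) ^ i <= (1 + Y) ^ i * q ^ tri i)%R.
Proof.
  intros Hy. assert (HY : (0 <= Y)%R) by (eapply Rle_trans; [apply Cmod_ge_0 | eauto]).
  induction i as [|i IH]; intros Hi; [simpl; rewrite Cmod_1; lra |].
  rewrite qp_S, Cmod_mult. change (tri (S i)) with (tri i + i)%nat. rewrite pow_add.
  replace (Cmod (qp (y / q ^ m) i) * Cmod (1 - y / q ^ m * q ^ i) * (q ^ m) ^ S i)%R
    with ((Cmod (qp (y / q ^ m) i) * (q ^ m) ^ i) * (Cmod (1 - y / q ^ m * q ^ i) * q ^ m))%R by (simpl; ring).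
  replace ((1 + Y) ^ S i * (q ^ tri i * q ^ i))%R with ((1 + Y) ^ i * q ^ tri i * ((1 + Y) * q ^ i))%R by (simpl; ring).
  pose proof (qpow_pos m) as Hm. pose proof (qpow_pos i) as Hi'.
  apply Rmult_le_compat; [| | apply IH; lia |].
  - apply Rmult_le_pos; [apply Cmod_ge_0 | left; now apply pow_lt].
  - apply Rmult_le_pos; [apply Cmod_ge_0 | lra].
  - rewrite <- (Cmod_qpow m) at 1. rewrite <- Cmod_mult.
    replace ((1 - y / q ^ m * q ^ i) * q ^ m) with (q ^ m - y * q ^ i) by (field; apply qpow_neq_0).
    eapply Rle_trans; [apply Cmod_triangle_minus |]. rewrite Cmod_mult, !Cmod_qpow.
    assert (K : (q ^ m <= q ^ i)%R).
    { replace m with (i + (m - i))%nat by lia. rewrite pow_add.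
      pose proof (qpow_le_1 (m - i)). pose proof (qpow_pos (m - i)). nra. }
    nra.
Qed.

Definition expbd (f : nat -> C) : Prop :=
  exists M K, (0 < M)%R /\ (1 <= K)%R /\ forall m, (Cmod (f m) <= M * K ^ m)%R.

Lemma rsum_const_le (X : nat -> R) (M : R) (m : nat) :
  (0 <= M)%R -> (forall i, (i < S m)%nat -> (X i <= M)%R) -> (rsum X (S m) <= M * 2 ^ m)%R.
Proof.
  intros HM H. apply Rle_trans with (M * INR (S m))%R.
  - assert (G : forall n, (n <= S m)%nat -> (rsum X n <= M * INR n)%R).
    { induction n as [|n IH]; intros Hn; [simpl; lra |].
      rewrite S_INR. simpl rsum. specialize (IH ltac:(lia)). specialize (H n ltac:(lia)). lra. }
    now apply G.
  - apply Rmult_le_compat_l; auto.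
    clear. induction m as [|m IH]; [simpl; lra |].
    rewrite S_INR. assert (1 <= 2 ^ m)%R by (apply pow_R1_Rle; lra). simpl pow. lra.
Qed.

Lemma pow_le_max (x K : R) (i m : nat) : (0 <= x)%R -> (x <= K)%R -> (1 <= K)%R -> (i <= m)%nat -> (x ^ i <= K ^ m)%R.
Proof.
  intros Hx HxK HK Hi. apply Rle_trans with (K ^ i)%R; [now apply pow_incr |].
  now apply Rle_pow.
Qed.

(** The constants depend on $z$ only through a bound for $|z|$ and $|1/z|$. This uniformity on
    annuli serves the continuity of the bilinear sum in $(\gamma,x)$. *)
Lemma EE_le (p1 p2 r a : C) (R0 : R) : admissible p1 p2 r -> a <> 0 -> qnv (r * a * a) ->
  exists M K, (0 < M)%R /\ (1 <= K)%R /\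
    forall (z : C) (m : nat), z <> 0 -> (Cmod z <= R0)%R -> (Cmod (/ z) <= R0)%R ->
      (Cmod (EE p1 p2 r a z m) <= M * K ^ m)%R.
Proof.
  intros H Ha Haa. pose proof (wA_neq_0 _ _ _ H) as HA.
  pose proof H as (H1 & H2 & Hr & Q1 & Q2 & Q3 & Q4). pose proof (proj1 Hr) as H0.
  pose proof q_neq_0 as Hq. set (A := wA p1 p2 r) in *.
  destruct (qp_inv_le_0 _ Q1) as [K1 [HK1 I1]]. destruct (qp_inv_le_0 _ Q2) as [K2 [HK2 I2]].
  destruct (qp_inv_le_0 _ Haa) as [K3 [HK3 I3]]. destruct inv_qpq_le as [K4 [HK4 I4]].
  set (Y := Cmod (p1 / A)). set (G := (Cmod (a * (A / p1)) * R0)%R). set (Z := (Cmod a * R0)%R).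
  set (M1 := qbd (Cmod (p1 / a) * R0)). set (M2 := qbd Z).
  set (M3 := qbd (Cmod (p2 / a) * R0)). set (M4 := qbd (Cmod (r * a) * R0)).
  assert (HM1 := qbd_pos (Cmod (p1 / a) * R0)). assert (HM2 := qbd_pos Z).
  assert (HM3 := qbd_pos (Cmod (p2 / a) * R0)). assert (HM4 := qbd_pos (Cmod (r * a) * R0)).
  fold M1 in HM1. fold M2 in HM2. fold M3 in HM3. fold M4 in HM4.
  set (M := (M1 * K1 * (M2 * K4) * (M3 * M4) * (K2 * K3))%R).
  assert (HM : (0 < M)%R) by (unfold M; repeat apply Rmult_lt_0_compat; auto).
  set (Kx := (2 * ((1 + Y) * 2 * Rmax 1 G * Rmax 1 Z))%R).
  assert (HY : (0 <= Y)%R) by apply Cmod_ge_0.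
  assert (HG1 : (1 <= Rmax 1 G)%R) by apply Rmax_l. assert (HZ1 : (1 <= Rmax 1 Z)%R) by apply Rmax_l.
  set (Kb := ((1 + Y) * 2 * Rmax 1 G * Rmax 1 Z)%R).
  assert (HKb : (1 <= Kb)%R).
  { assert (P1 : forall x y : R, (1 <= x)%R -> (1 <= y)%R -> (1 <= x * y)%R) by (intros; nra).
    unfold Kb. repeat apply P1; lra. }
  exists M, Kx. split; [auto |]. split; [unfold Kx; fold Kb; lra |].
  intros z m Hz Hz1 Hz2.
  assert (HR0 : (0 <= R0)%R) by (eapply Rle_trans; [apply Cmod_ge_0 | eauto]).
  assert (HG : (0 <= G)%R) by (apply Rmult_le_pos; auto using Cmod_ge_0).
  assert (HZ : (0 <= Z)%R) by (apply Rmult_le_pos; auto using Cmod_ge_0).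
  rewrite (Sears_form p1 p2 r a z m H Ha Hz Haa). fold A.
  eapply Rle_trans; [apply (csum_Cmod _ (fun _ => M * Kb ^ m)%R) |].
  2:{ unfold Kx. fold Kb. rewrite Rpow_mult_distr.
      eapply Rle_trans; [apply (rsum_const_le _ (M * Kb ^ m)%R) |].
      - apply Rmult_le_pos; [lra |]. apply pow_le. lra.
      - intros; lra.
      - right. ring. }
  intros i Hi.
  assert (N1 := qpq_neq_0 i). assert (N2 : qp p1 i <> 0) by now apply qp_neq_0.
  assert (N3 : qp p2 m <> 0) by now apply qp_neq_0.
  assert (N4 : qp (r * a * a) m <> 0) by now apply qp_neq_0.
  set (u1 := qp (p1 * z / a) i). set (u2 := qp (p1 / A / q ^ m) i). set (u3 := qp (/ q ^ m) i).
  set (u4 := qp (a * z) i). set (u5 := qp (p2 / (a * z)) (m - i)). set (u6 := qp (r * a / z) (m - i)).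
  assert (B1 : (Cmod u1 <= M1)%R).
  { apply qp_le. replace (p1 * z / a) with (p1 / a * z) by (field; auto). rewrite Cmod_mult.
    apply Rmult_le_compat_l; auto using Cmod_ge_0. }
  assert (B4 : (Cmod u4 <= M2)%R).
  { apply qp_le. rewrite Cmod_mult. apply Rmult_le_compat_l; auto using Cmod_ge_0. }
  assert (B5 : (Cmod u5 <= M3)%R).
  { apply qp_le. replace (p2 / (a * z)) with (p2 / a * / z) by (field; auto). rewrite Cmod_mult.
    apply Rmult_le_compat_l; auto using Cmod_ge_0. }
  assert (B6 : (Cmod u6 <= M4)%R).
  { apply qp_le. unfold Cdiv. rewrite Cmod_mult. apply Rmult_le_compat_l; auto using Cmod_ge_0. }
  assert (B2 : (Cmod u2 * (q ^ m) ^ i <= (1 + Y) ^ i * q ^ tri i)%R)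
    by (apply qp_big_le; [apply Rle_refl | lia]).
  assert (B3 : (Cmod u3 * (q ^ m) ^ i <= 2 ^ i * q ^ tri i)%R).
  { replace 2%R with (1 + 1)%R by ring. unfold u3. replace (/ q ^ m) with (1 / q ^ m) by (field; apply qpow_neq_0).
    apply qp_big_le; [rewrite Cmod_1; lra | lia]. }
  (* All factors involving powers of $q$ with exponents quadratic in $m$ and $i$ are gathered here.
     As $2\binom i2+i=i^2$, the total exponent $i^2-2mi+mi+i(m-i)$ is zero, and a geometric bound is
     left. *)
  set (w := u2 * u3 * (q ^ m) ^ i * q ^ i * q ^ (i * (m - i))).
  assert (Bw : (Cmod w <= (1 + Y) ^ i * 2 ^ i)%R).
  { unfold w. rewrite !Cmod_mult, !Cmod_qpow, Cmod_pow, Cmod_qpow.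
    pose proof (qpow_pos m) as Pm. pose proof (pow_lt _ i Pm) as Pmi.
    apply Rmult_le_reg_r with ((q ^ m) ^ i)%R; auto.
    replace (Cmod u2 * Cmod u3 * (q ^ m) ^ i * q ^ i * q ^ (i * (m - i)) * (q ^ m) ^ i)%R
      with ((Cmod u2 * (q ^ m) ^ i) * (Cmod u3 * (q ^ m) ^ i) * (q ^ i * q ^ (i * (m - i))))%R by ring.
    apply Rle_trans with (((1 + Y) ^ i * q ^ tri i) * (2 ^ i * q ^ tri i) * (q ^ i * q ^ (i * (m - i))))%R.
    - apply Rmult_le_compat_r.
      + apply Rmult_le_pos; left; apply qpow_pos.
      + apply Rmult_le_compat; auto; apply Rmult_le_pos; auto using Cmod_ge_0; lra.
    - right. rewrite <- pow_mult.
      replace (m * i)%nat with (tri i + tri i + i + i * (m - i))%nat.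
      + rewrite !pow_add. ring.
      + pose proof (tri_double i). assert (i * m = i * i + i * (m - i))%nat by (rewrite <- Nat.mul_add_distr_l; f_equal; lia). lia. }
  replace (u1 * u2 * (a / z * (A / p1) * q ^ m) ^ i / qp p1 i * (u3 * u4 * q ^ i / qp q i) *
           ((a * z * q ^ i) ^ (m - i) * (u5 * u6)) / (qp p2 m * qp (r * a * a) m))
    with (u1 * / qp p1 i * (u4 * / qp q i) * (u5 * u6) * (/ qp p2 m * / qp (r * a * a) m)
          * (w * (a * (A / p1) * / z) ^ i * (a * z) ^ (m - i))).
  2:{ unfold w. replace ((a / z * (A / p1) * q ^ m) ^ i) with ((a * (A / p1) * / z) ^ i * (q ^ m) ^ i)
        by (rewrite <- Cpow_mult_l; f_equal; unfold Cdiv; ring).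
      rewrite (Cpow_mult_l (a * z) (q ^ i)), <- (Cpow_mult_r q i). field. repeat split; auto. }
  rewrite Cmod_mult. apply Rmult_le_compat; auto using Cmod_ge_0.
  - unfold M. rewrite !Cmod_mult.
    repeat apply Rmult_le_compat; try (repeat apply Rmult_le_pos; apply Cmod_ge_0); auto.
  - unfold Kb. rewrite !Rpow_mult_distr, !Cmod_mult, !Cmod_pow.
    apply Rmult_le_compat; [| apply pow_le, Cmod_ge_0 | |].
    + apply Rmult_le_pos; [apply Cmod_ge_0 | apply pow_le, Cmod_ge_0].
    + apply Rmult_le_compat; [apply Cmod_ge_0 | apply pow_le, Cmod_ge_0 | |].
      * eapply Rle_trans; [apply Bw |]. apply Rmult_le_compat; try (apply pow_le; lra).
        -- apply Rle_pow; [lra | lia].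
        -- apply Rle_pow; [lra | lia].
      * apply pow_le_max; auto using Cmod_ge_0; [| lia].
        rewrite Cmod_mult. eapply Rle_trans; [| apply Rmax_r]. unfold G.
        apply Rmult_le_compat_l; auto using Cmod_ge_0.
    + apply pow_le_max; auto using Cmod_ge_0; [| lia].
      rewrite Cmod_mult. eapply Rle_trans; [| apply Rmax_r]. unfold Z.
      apply Rmult_le_compat_l; auto using Cmod_ge_0.
Qed.

(** $q^{1/4}$, so that $q^{m^2/4}$ is a power with a natural exponent. *)
Let th : R := sqrt (sqrt q).

Lemma th_bounds : (0 < th < 1)%R.
Proof.
  assert (H1 : (0 < sqrt q < 1)%R).
  { split; [apply sqrt_lt_R0; lra |]. rewrite <- sqrt_1. apply sqrt_lt_1; lra. }
  split; [apply sqrt_lt_R0; lra |]. rewrite <- sqrt_1. apply sqrt_lt_1; lra.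
Qed.

Lemma th_pow (n : nat) : (th ^ (4 * n) = q ^ n)%R.
Proof.
  rewrite pow_mult. f_equal. unfold th.
  replace (sqrt (sqrt q) ^ 4)%R with ((sqrt (sqrt q) * sqrt (sqrt q)) * (sqrt (sqrt q) * sqrt (sqrt q)))%R by ring.
  rewrite sqrt_sqrt by apply sqrt_pos. apply sqrt_sqrt. lra.
Qed.

Lemma th_pos (n : nat) : (0 < th ^ n)%R.
Proof. apply pow_lt, th_bounds. Qed.

(** What is left of the Gaussian part of the weight after one uniformly bounded coefficient $D_k(m)$
    has been absorbed; still of order $q^{m^2/4}$ up to geometric factors. *)
Definition gw (m : nat) : R := (q ^ tri m / th ^ (m * m))%R.

Lemma gw_pos (m : nat) : (0 < gw m)%R.
Proof. apply Rdiv_lt_0_compat; [apply qpow_pos | apply th_pos]. Qed.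

Lemma summable_gw (M K : R) : (0 <= M)%R -> (0 <= K)%R -> summable (fun m => M * K ^ m * gw m)%R.
Proof.
  intros HM HK. pose proof th_bounds as Ht.
  apply summable_le with (fun m => M * ((K / th ^ 1) ^ m * (th ^ 2) ^ tri m))%R.
  - intros m. pose proof (gw_pos m). split.
    + apply Rmult_le_pos; [apply Rmult_le_pos; auto; now apply pow_le | lra].
    + rewrite Rmult_assoc. apply Rmult_le_compat_l; auto. right.
      unfold gw, Rdiv. rewrite Rpow_mult_distr, pow_inv, <- !pow_mult, Rmult_assoc. f_equal.
      rewrite <- th_pow, <- tri_double. pose proof (th_pos (1 * m)). pose proof (th_pos (2 * tri m + m)).
      apply Rmult_eq_reg_r with (th ^ (2 * tri m + m) * th ^ (1 * m))%R; [| apply Rmult_integral_contrapositive; lra].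
      replace (th ^ (4 * tri m) * / th ^ (2 * tri m + m) * (th ^ (2 * tri m + m) * th ^ (1 * m)))%R
        with (th ^ (4 * tri m) * th ^ (1 * m))%R by (field; lra).
      replace (/ th ^ (1 * m) * th ^ (2 * tri m) * (th ^ (2 * tri m + m) * th ^ (1 * m)))%R
        with (th ^ (2 * tri m) * th ^ (2 * tri m + m))%R by (field; lra).
      rewrite <- !pow_add. f_equal. lia.
  - apply summable_scal; auto. apply summable_pow_tri_base.
    + split; [apply th_pos |]. simpl. rewrite Rmult_1_r. nra.
    + apply Rmult_le_pos; auto. left. apply Rinv_0_lt_compat, th_pos.
Qed.

Lemma xp_le_tri (k s : nat) : (Cmod (xp (q ^ k) 1 s) <= q ^ tri s)%R.
Proof.
  destruct (le_lt_dec s k) as [H | H].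
  2:{ rewrite xp_vanish by auto. rewrite Cmod_0. left; apply qpow_pos. }
  induction s as [|s IH]; [simpl; rewrite Cmod_1; lra |].
  rewrite xp_S, Cmod_mult. change (tri (S s)) with (tri s + s)%nat. rewrite pow_add.
  apply Rmult_le_compat; auto using Cmod_ge_0; [apply IH; lia |].
  replace (q ^ k - 1 * q ^ s) with (RtoC (q ^ k - q ^ s)) by (rewrite RtoC_minus, !RtoC_pow; ring).
  rewrite Cmod_R, Rabs_minus_sym, Rabs_pos_eq.
  - pose proof (qpow_pos k). lra.
  - replace k with (s + (k - s))%nat by lia. rewrite pow_add.
    pose proof (qpow_pos s). pose proof (qpow_le_1 (k - s)). nra.
Qed.

Lemma bs_le (A : C) (m s : nat) : (Cmod (bs A m s) * (q ^ m) ^ s <= q ^ tri s * qbd (Cmod A))%R.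
Proof.
  unfold bs. rewrite Cmod_mult.
  replace (Cmod (qp (/ q ^ m) s) * Cmod (qp (q ^ m * A) s) * (q ^ m) ^ s)%R
    with (Cmod (qp (/ q ^ m) s) * (q ^ m) ^ s * Cmod (qp (q ^ m * A) s))%R by ring.
  pose proof (qpow_pos m) as Hm. pose proof (pow_lt _ s Hm).
  apply Rmult_le_compat; auto using Cmod_ge_0.
  - apply Rmult_le_pos; [apply Cmod_ge_0 | lra].
  - rewrite <- (Cmod_qpow m), <- Cmod_pow, <- Cmod_mult, qp_inv_xp. apply xp_le_tri.
  - apply qp_le. rewrite Cmult_comm. apply Cmod_mult_qpow_le.
Qed.

(** The factor $\prod_{i<s}(q^k-q^i)$ is at most $q^{s(s-1)/2}$ whatever $k$, and [bs] contributes
    $q^{s(s-1)/2-ms}$. Up to geometric factors each term is bounded by $q^{s^2-ms}$, hence by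
    $q^{-m^2/4}$, the worst case being $s=m/2$. *)
Lemma DD_le (p1 p2 r : C) : admissible p1 p2 r ->
  exists M K, (0 < M)%R /\ (1 <= K)%R /\
    forall k m, (Cmod (DD p1 p2 r k m) <= M * K ^ m / th ^ (m * m))%R.
Proof.
  intros (H1 & H2 & Hr & Q1 & Q2 & Q3 & Q4). set (A := wA p1 p2 r).
  destruct (qp_inv_le_0 _ Q1) as [K1 [HK1 I1]]. destruct (qp_inv_le_0 _ Q2) as [K2 [HK2 I2]].
  destruct inv_qpq_le as [K4 [HK4 I4]].
  pose proof (qbd_pos (Cmod A)) as HA.
  set (c := Rmax 1 (Cmod (q / r))). assert (Hc : (1 <= c)%R) by apply Rmax_l.
  set (M := (K4 * (K1 * K2) * qbd (Cmod A))%R).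
  assert (HM : (0 < M)%R) by (unfold M; repeat apply Rmult_lt_0_compat; auto).
  exists M, (2 * (c / q))%R.
  assert (Hcq : (1 <= c / q)%R).
  { apply Rmult_le_reg_r with q; [lra |]. unfold Rdiv. rewrite Rmult_assoc, Rinv_l by lra. lra. }
  split; [auto |]. split; [lra |]. intros k m.
  unfold DD. fold A.
  pose proof (th_pos (m * m)) as Ht.
  eapply Rle_trans; [apply (csum_Cmod _ (fun _ => M * (c / q) ^ m / th ^ (m * m))%R) |].
  2:{ rewrite Rpow_mult_distr.
      eapply Rle_trans; [apply (rsum_const_le _ (M * (c / q) ^ m / th ^ (m * m))%R) |].
      - apply Rmult_le_pos; [apply Rmult_le_pos; [lra | apply pow_le; lra] |].
        left. now apply Rinv_0_lt_compat.
      - intros; lra.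
      - right. unfold Rdiv. ring. }
  intros s Hs. pose proof (qpq_neq_0 s) as N1. assert (N2 : qp p1 s <> 0) by now apply qp_neq_0.
  assert (N3 : qp p2 s <> 0) by now apply qp_neq_0.
  replace (xp (q ^ k) 1 s / qp q s * (q / r) ^ s * bs A m s / (qp p1 s * qp p2 s))
    with (/ qp q s * (/ qp p1 s * / qp p2 s) * ((q / r) ^ s * (xp (q ^ k) 1 s * bs A m s)))
    by (generalize ((q / r) ^ s); intros; field; auto).
  rewrite !Cmod_mult.
  replace (M * (c / q) ^ m / th ^ (m * m))%R
    with (K4 * (K1 * K2) * (c ^ m * (qbd (Cmod A) * ((/ q) ^ m / th ^ (m * m)))))%R
    by (unfold M, Rdiv; rewrite Rpow_mult_distr; ring).
  apply Rmult_le_compat; try (repeat apply Rmult_le_pos; apply Cmod_ge_0).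
  { repeat apply Rmult_le_compat; try (repeat apply Rmult_le_pos; apply Cmod_ge_0); auto. }
  apply Rmult_le_compat; try (repeat apply Rmult_le_pos; apply Cmod_ge_0).
  { rewrite Cmod_pow. apply pow_le_max; auto using Cmod_ge_0; [apply Rmax_r | lia]. }
  pose proof (bs_le A m s) as Hb. pose proof (xp_le_tri k s) as Hx.
  pose proof (pow_lt _ s (qpow_pos m)) as Hms.
  apply Rmult_le_reg_r with ((q ^ m) ^ s)%R; auto.
  apply Rle_trans with (q ^ tri s * (q ^ tri s * qbd (Cmod A)))%R.
  { rewrite Rmult_assoc. apply Rmult_le_compat; auto using Cmod_ge_0.
    apply Rmult_le_pos; [apply Cmod_ge_0 | lra]. }
  replace (q ^ tri s * (q ^ tri s * qbd (Cmod A)))%R with (qbd (Cmod A) * (q ^ tri s * q ^ tri s))%R by ring.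
  rewrite Rmult_assoc. apply Rmult_le_compat_l; [lra |].
  apply Rmult_le_reg_r with (q ^ s * th ^ (m * m))%R; [apply Rmult_lt_0_compat; [apply qpow_pos | auto] |].
  replace (q ^ tri s * q ^ tri s * (q ^ s * th ^ (m * m)))%R
    with (q ^ (2 * tri s + s) * th ^ (m * m))%R by (rewrite <- !Rmult_assoc, <- !pow_add; do 2 f_equal; lia).
  replace ((/ q) ^ m / th ^ (m * m) * (q ^ m) ^ s * (q ^ s * th ^ (m * m)))%R
    with (((/ q) ^ m * q ^ s) * (q ^ (m * s)))%R by (rewrite pow_mult; field; lra).
  rewrite tri_double, <- !th_pow, <- pow_add.
  apply Rle_trans with (1 * th ^ (4 * (m * s)))%R.
  - rewrite Rmult_1_l.
    (* Completion of the square, $(m-2s)^2\ge0$. *)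
    assert (G : (4 * (m * s) <= 4 * (s * s) + m * m)%nat).
    { destruct (le_lt_dec m (2 * s)) as [L | L].
      - assert (Ed : (2 * s = m + (2 * s - m))%nat) by lia. revert Ed. generalize (2 * s - m)%nat. intros; nia.
      - assert (Ed : (m = 2 * s + (m - 2 * s))%nat) by lia. revert Ed. generalize (m - 2 * s)%nat. intros; nia. }
    replace (4 * (s * s) + m * m)%nat with (4 * (m * s) + (4 * (s * s) + m * m - 4 * (m * s)))%nat by lia.
    rewrite pow_add. pose proof (th_pos (4 * (m * s))).
    assert (th ^ (4 * (s * s) + m * m - 4 * (m * s)) <= 1)%R.
    { rewrite <- (pow1 (4 * (s * s) + m * m - 4 * (m * s))). apply pow_incr. pose proof th_bounds; lra. }
    nra.
  - apply Rmult_le_compat_r; [left; apply th_pos |]. rewrite th_pow.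
    replace m with (s + (m - s))%nat by lia. rewrite pow_add.
    replace ((/ q) ^ s * (/ q) ^ (m - s) * q ^ s)%R with ((/ q * q) ^ s * (/ q) ^ (m - s))%R
      by (rewrite Rpow_mult_distr; ring).
    rewrite Rinv_l, pow1, Rmult_1_l by lra. apply pow_R1_Rle.
    rewrite <- Rinv_1. apply Rinv_le_contravar; lra.
Qed.

Lemma expbd_mult (f g : nat -> C) : expbd f -> expbd g -> expbd (fun m => f m * g m).
Proof.
  intros (M & K & HM & HK & H) (M' & K' & HM' & HK' & H').
  exists (M * M')%R, (K * K')%R. split; [now apply Rmult_lt_0_compat |]. split; [nra |].
  intros m. rewrite Cmod_mult, Rpow_mult_distr.
  replace (M * M' * (K ^ m * K' ^ m))%R with (M * K ^ m * (M' * K' ^ m))%R by ring.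
  apply Rmult_le_compat; auto using Cmod_ge_0.
Qed.

Lemma expbd_const (c : C) : expbd (fun _ => c).
Proof.
  exists (Cmod c + 1)%R, 1%R. pose proof (Cmod_ge_0 c). split; [lra |]. split; [lra |].
  intros m. rewrite pow1. lra.
Qed.

Lemma expbd_pow (c : C) : expbd (fun m => c ^ m).
Proof.
  exists 1%R, (Rmax 1 (Cmod c)). split; [lra |]. split; [apply Rmax_l |].
  intros m. rewrite Cmod_pow, Rmult_1_l. apply pow_incr. split; [apply Cmod_ge_0 | apply Rmax_r].
Qed.

Lemma expbd_bounded (f : nat -> C) (M : R) : (forall m, (Cmod (f m) <= M)%R) -> expbd f.
Proof.
  intros H. assert (HM : (0 <= M)%R) by (eapply Rle_trans; [apply Cmod_ge_0 | apply (H O)]).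
  exists (M + 1)%R, 1%R. split; [lra |]. split; [lra |].
  intros m. rewrite pow1. specialize (H m). lra.
Qed.

Lemma expbd_ext (f g : nat -> C) : (forall m, f m = g m) -> expbd f -> expbd g.
Proof.
  intros E (M & K & HM & HK & H). exists M, K. repeat split; auto. intros m. now rewrite <- E.
Qed.

Lemma expbd_plus (f g : nat -> C) : expbd f -> expbd g -> expbd (fun m => f m + g m).
Proof.
  intros (M & K & HM & HK & H) (M' & K' & HM' & HK' & H').
  exists (M + M')%R, (Rmax K K'). split; [lra |].
  split; [eapply Rle_trans; [apply HK | apply Rmax_l] |].
  intros m. eapply Rle_trans; [apply Cmod_triangle |]. rewrite Rmult_plus_distr_r.
  apply Rplus_le_compat.
  - eapply Rle_trans; [apply H |]. apply Rmult_le_compat_l; [lra |]. apply pow_incr.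
    split; [lra | apply Rmax_l].
  - eapply Rle_trans; [apply H' |]. apply Rmult_le_compat_l; [lra |]. apply pow_incr.
    split; [lra | apply Rmax_r].
Qed.

Lemma expbd_csum (f : nat -> nat -> C) (n : nat) : (forall s, expbd (f s)) ->
  expbd (fun m => csum (fun s => f s m) n).
Proof.
  intros H. induction n as [|n IH]; simpl; [apply expbd_const | apply expbd_plus; auto].
Qed.

Lemma expbd_qp (x : C) : expbd (qp x).
Proof. apply expbd_bounded with (qbd (Cmod x)). intros m. apply qp_le, Rle_refl. Qed.

Lemma expbd_inv_qp (x : C) : qnv x -> expbd (fun m => / qp x m).
Proof. intros H. destruct (qp_inv_le_0 x H) as [K [_ HK]]. now apply expbd_bounded with K. Qed.

Lemma expbd_kap (p1 p2 r : C) : admissible p1 p2 r -> expbd (kap p1 p2 r).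
Proof.
  intros (H1 & H2 & Hr & Q1 & Q2 & Q3 & Q4).
  apply expbd_ext with (fun m => qp (r * p1) m * qp (r * p2) m * (/ qp p1 m * / qp p2 m) * (/ r) ^ m).
  - intros m. unfold kap. assert (N1 : qp p1 m <> 0) by now apply qp_neq_0.
    assert (N2 : qp p2 m <> 0) by now apply qp_neq_0. field. auto.
  - repeat apply expbd_mult; auto using expbd_qp, expbd_inv_qp, expbd_pow.
Qed.

Lemma expbd_bs (A : C) (s : nat) : expbd (fun m => bs A m s).
Proof.
  exists (qbd (Cmod A)), (/ q ^ s)%R. split; [apply qbd_pos |].
  pose proof (qpow_pos s) as Hs. pose proof (qpow_le_1 s) as Hs1. split.
  - rewrite <- Rinv_1. apply Rinv_le_contravar; lra.
  - intros m. pose proof (bs_le A m s) as H. pose proof (pow_lt _ s (qpow_pos m)) as Hms.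
    apply Rmult_le_reg_r with ((q ^ m) ^ s)%R; auto. eapply Rle_trans; [apply H |].
    rewrite pow_inv. replace ((q ^ s) ^ m)%R with ((q ^ m) ^ s)%R
      by (rewrite <- !pow_mult; f_equal; lia).
    rewrite Rmult_assoc, Rinv_l by lra. pose proof (qbd_pos (Cmod A)). pose proof (qpow_le_1 (tri s)). nra.
Qed.

(** For fixed $k$ the degree in $q^{-m}$ is fixed, so the growth is geometric. In contrast to
    [DD_le] the constants depend on $k$; this bound is meant for a $D_k$ that acts as a multiplier
    and is not summed over. *)
Lemma expbd_DD (p1 p2 r : C) (k : nat) : expbd (DD p1 p2 r k).
Proof.
  eapply expbd_ext; [intros m; symmetry; apply DD_dcoef |].
  apply expbd_csum. intros s. apply expbd_mult; [apply expbd_const | apply expbd_bs].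
Qed.

Lemma expbd_EE (p1 p2 r a z : C) : admissible p1 p2 r -> a <> 0 -> z <> 0 -> qnv (r * a * a) ->
  expbd (EE p1 p2 r a z).
Proof.
  intros H Ha Hz Haa.
  destruct (EE_le p1 p2 r a (Rmax (Cmod z) (Cmod (/ z))) H Ha Haa) as (M & K & HM & HK & HE).
  exists M, K. repeat split; auto. intros m. apply HE; auto; [apply Rmax_l | apply Rmax_r].
Qed.

Lemma vwp_expbd (p1 p2 r : C) : admissible p1 p2 r ->
  exists M K, (0 < M)%R /\ (1 <= K)%R /\ forall m, (Cmod (vwp p1 p2 r m) <= M * K ^ m * q ^ tri m)%R.
Proof.
  intros (H1 & H2 & Hr & Q1 & Q2 & Q3 & Q4). destruct (vwp_le p1 p2 r Q3 Q4) as [K [HK H]].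
  exists K, (Rmax 1 (Cmod r)). split; auto. split; [apply Rmax_l |]. intros m.
  generalize (H O m). simpl (RtoC q ^ 0). simpl (q ^ 0)%R. rewrite Cmult_1_r, Rmult_1_l. intros L.
  eapply Rle_trans; [apply L |]. rewrite Rmult_assoc. apply Rmult_le_compat_l; [lra |].
  apply Rmult_le_compat_r; [left; apply qpow_pos |].
  apply pow_incr. split; [apply Cmod_ge_0 | apply Rmax_r].
Qed.

(** ** The bilinear sum *)

(** The contributions of index $k$ from both families are kept in one row entry, so that a single
    interchange of summations handles the two families together. *)
Definition erow (p1 p2 r a z : C) (m k : nat) : C :=
  / pinf (r * a * a) *
  (ppinf (r * a) z / pinf r * (XK r a z k * DD p1 p2 r k m)
   + kap p1 p2 r m * (ppinf a z / pinf (/ r) * (XK (/ r) (r * a) z k * DD (r * p1) (r * p2) (/ r) k m))).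

Lemma erow_ser (p1 p2 r a z : C) (m : nat) :
  admissible p1 p2 r -> a <> 0 -> z <> 0 -> qnv (r * a * a) ->
  ser (erow p1 p2 r a z m) (EE p1 p2 r a z m).
Proof.
  intros H Ha Hz Haa. destruct (E_expansion p1 p2 r a z m H Ha Hz Haa) as (L1 & L2 & S1 & S2 & E).
  apply ser_eq with (/ pinf (r * a * a) * (ppinf (r * a) z / pinf r * L1
                       + kap p1 p2 r m * (ppinf a z / pinf (/ r) * L2))).
  - apply (ser_scal (/ pinf (r * a * a))). apply ser_plus; [now apply ser_scal |].
    apply (ser_scal (kap p1 p2 r m)). now apply ser_scal.
  - rewrite <- E. field. now apply pinf_neq_0.
Qed.

Lemma erow_le (p1 p2 r a z : C) :
  admissible p1 p2 r -> a <> 0 -> z <> 0 -> qnv (r * a * a) ->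
  exists M K, (0 < M)%R /\ (1 <= K)%R /\
    forall k m, (Cmod (erow p1 p2 r a z m k) <= M * K ^ m / th ^ (m * m) * q ^ k)%R.
Proof.
  intros H Ha Hz Haa. pose proof (admissible_swap _ _ _ H) as H'.
  destruct (DD_le _ _ _ H) as (M1 & K1 & HM1 & HK1 & B1).
  destruct (DD_le _ _ _ H') as (M2 & K2 & HM2 & HK2 & B2).
  destruct (expbd_kap _ _ _ H) as (M3 & K3 & HM3 & HK3 & B3).
  destruct (XK_le r a z (proj1 (proj2 (proj2 H)))) as (X1 & HX1 & BX1).
  destruct (XK_le (/ r) (r * a) z (proj1 (proj2 (proj2 H')))) as (X2 & HX2 & BX2).
  set (c0 := Cmod (/ pinf (r * a * a))).
  set (c1 := Cmod (ppinf (r * a) z / pinf r)). set (c2 := Cmod (ppinf a z / pinf (/ r))).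
  assert (P0 : (0 <= c0)%R) by apply Cmod_ge_0. assert (P1 : (0 <= c1)%R) by apply Cmod_ge_0.
  assert (P2 : (0 <= c2)%R) by apply Cmod_ge_0.
  exists (1 + c0 * (c1 * (X1 * M1) + M3 * (c2 * (X2 * M2))))%R, (K1 * (K2 * K3))%R.
  assert (Pos : (0 <= c0 * (c1 * (X1 * M1) + M3 * (c2 * (X2 * M2))))%R).
  { repeat (apply Rmult_le_pos || apply Rplus_le_le_0_compat); lra. }
  split; [lra |]. split.
  { assert (P : forall x y : R, (1 <= x)%R -> (1 <= y)%R -> (1 <= x * y)%R) by (intros; nra).
    repeat apply P; lra. }
  intros k m. unfold erow.
  pose proof (th_pos (m * m)) as Ht. pose proof (qpow_pos k) as Hk.
  assert (P23 : (1 <= K2 * K3)%R) by nra.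
  assert (KK1 : (K1 ^ m <= (K1 * (K2 * K3)) ^ m)%R) by (apply pow_incr; nra).
  assert (KK2 : (K3 ^ m * K2 ^ m <= (K1 * (K2 * K3)) ^ m)%R).
  { rewrite <- Rpow_mult_distr, (Rmult_comm K3). apply pow_incr. nra. }
  set (KM := ((K1 * (K2 * K3)) ^ m)%R) in *.
  set (T := (/ th ^ (m * m))%R). assert (HT : (0 < T)%R) by now apply Rinv_0_lt_compat.
  unfold Rdiv. fold T.
  rewrite Cmod_mult. fold c0.
  apply Rle_trans with (c0 * (c1 * (X1 * M1) + M3 * (c2 * (X2 * M2))) * KM * T * q ^ k)%R.
  2:{ assert (0 <= KM * T * q ^ k)%R.
      { repeat apply Rmult_le_pos; try lra. unfold KM. apply pow_le. nra. }
      nra. }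
  rewrite !Rmult_assoc. apply Rmult_le_compat_l; auto.
  eapply Rle_trans; [apply Cmod_triangle |].
  rewrite Rmult_plus_distr_r. apply Rplus_le_compat.
  - rewrite !Cmod_mult. fold c1. rewrite !Rmult_assoc. apply Rmult_le_compat_l; auto.
    replace (X1 * (M1 * (KM * (T * q ^ k))))%R with (X1 * q ^ k * (M1 * KM * T))%R by ring.
    apply Rmult_le_compat; auto using Cmod_ge_0.
    eapply Rle_trans; [apply B1 |]. unfold Rdiv. fold T.
    apply Rmult_le_compat_r; [lra |]. apply Rmult_le_compat_l; lra.
  - rewrite !Cmod_mult. fold c2.
    apply Rle_trans with (M3 * K3 ^ m * (c2 * (X2 * q ^ k * (M2 * K2 ^ m * T))))%R.
    + apply Rmult_le_compat; auto using Cmod_ge_0; [repeat apply Rmult_le_pos; auto using Cmod_ge_0 |].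
      apply Rmult_le_compat_l; auto. apply Rmult_le_compat; auto using Cmod_ge_0.
    + replace (M3 * K3 ^ m * (c2 * (X2 * q ^ k * (M2 * K2 ^ m * T))))%R
        with (M3 * (c2 * (X2 * M2)) * ((K3 ^ m * K2 ^ m) * (T * q ^ k)))%R by ring.
      apply Rmult_le_compat_l; [repeat apply Rmult_le_pos; lra |].
      apply Rmult_le_compat_r; [apply Rmult_le_pos; lra | auto].
Qed.

(** The weight affords exactly one factor of size $q^{-m^2/4}$, spent on the row; the other factor
    $f$ may grow at most geometrically. The lemma is applied with $f=D_k$ and with $f=E_m$. *)
Lemma weight_row_le (p1 p2 r u z : C) (f : nat -> C) :
  admissible p1 p2 r -> u <> 0 -> z <> 0 -> qnv (r * u * u) -> expbd f ->
  exists X, summable X /\ forall m k, (Cmod (vwp p1 p2 r m * f m * erow p1 p2 r u z m k) <= X m * q ^ k)%R.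
Proof.
  intros H Hu Hz Huu (Mf & Kf & HMf & HKf & Hf).
  destruct (vwp_expbd _ _ _ H) as (Mv & Kv & HMv & HKv & Hv).
  destruct (erow_le _ _ _ _ _ H Hu Hz Huu) as (M & K & HM & HK & HE).
  exists (fun m => (Mv * Mf * M) * (Kv * Kf * K) ^ m * gw m)%R. split.
  - apply summable_gw; repeat apply Rmult_le_pos; lra.
  - intros m k. rewrite !Cmod_mult. unfold gw.
    replace (Mv * Mf * M * (Kv * Kf * K) ^ m * (q ^ tri m / th ^ (m * m)) * q ^ k)%R
      with ((Mv * Kv ^ m * q ^ tri m) * (Mf * Kf ^ m) * (M * K ^ m / th ^ (m * m) * q ^ k))%R
      by (rewrite !Rpow_mult_distr; unfold Rdiv; ring).
    apply Rmult_le_compat; auto using Cmod_ge_0; [apply Rmult_le_pos; apply Cmod_ge_0 |].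
    apply Rmult_le_compat; auto using Cmod_ge_0.
Qed.

(** After the interchange, orthogonality keeps the single index $j=k$ of the first family and
    [cross_orthogonality] kills the second family altogether. The norm of $D_k$ cancels the
    denominators of [XK]. *)
Lemma weight_E_DD (p1 p2 r a z : C) (k : nat) :
  admissible p1 p2 r -> a <> 0 -> z <> 0 -> qnv (r * a * a) ->
  ser (fun m => vwp p1 p2 r m * EE p1 p2 r a z m * DD p1 p2 r k m)
      (vwpS p1 p2 r * ppinf (r * a) z / (pinf (r * a * a) * pinf r) * (pp a z k / (qp p1 k * qp p2 k))).
Proof.
  intros H Ha Hz Haa. pose proof H as (H1 & H2 & Hr & Q1 & Q2 & Q3 & Q4). pose proof (proj1 Hr) as H0.
  destruct (weight_row_le p1 p2 r a z (DD p1 p2 r k) H Ha Hz Haa (expbd_DD _ _ _ _)) as (X & HX & HB).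
  set (s := fun j => / pinf (r * a * a) * (ppinf (r * a) z / pinf r * XK r a z j *
     (if Nat.eq_dec k j then vwpS p1 p2 r * (qp q k * qp (q / r) k) / (q ^ k * (qp p1 k * qp p2 k)) else 0))).
  assert (Ns : pinf r <> 0) by (apply pinf_neq_0, Hr).
  assert (Na : pinf (r * a * a) <> 0) by now apply pinf_neq_0.
  eapply ser_ext; [| apply (ser_fubini (fun m j => vwp p1 p2 r m * DD p1 p2 r k m * erow p1 p2 r a z m j)
     X (pow q) (fun m => vwp p1 p2 r m * DD p1 p2 r k m * EE p1 p2 r a z m) s)].
  - intros m. cbv beta. ring.
  - exact HX.
  - exact summable_qpow.
  - exact HB.
  - intros m. apply (ser_scal (vwp p1 p2 r m * DD p1 p2 r k m)). now apply erow_ser.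
  - intros j.
    pose proof (ser_scal (/ pinf (r * a * a) * (ppinf (r * a) z / pinf r * XK r a z j)) _ _
                  (orthogonality p1 p2 r k j H)) as O1.
    pose proof (ser_scal (/ pinf (r * a * a) * (ppinf a z / pinf (/ r) * XK (/ r) (r * a) z j)) _ _
                  (cross_orthogonality p1 p2 r k j H)) as O2.
    eapply ser_ext; [| eapply ser_eq; [apply (ser_plus _ _ _ _ O1 O2) |]].
    + intros m. cbv beta. unfold erow. ring.
    + unfold s. ring.
  - apply ser_eq with (csum s (S k)).
    + apply ser_finite. intros n Hn. unfold s. destruct (Nat.eq_dec k n); [lia | ring].
    + rewrite csum_S, csum_0.
      2:{ intros j Hj. unfold s. destruct (Nat.eq_dec k j); [lia | ring]. }
      unfold s. destruct (Nat.eq_dec k k); [| lia]. unfold XK.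
      assert (N1 := qpq_neq_0 k). assert (N2 : qp p1 k <> 0) by now apply qp_neq_0.
      assert (N3 : qp p2 k <> 0) by now apply qp_neq_0.
      assert (N4 : qp (q / r) k <> 0) by now apply qp_neq_0, nonintegral_q_inv.
      field. repeat split; auto using qpow_neq_0.
Qed.

(** One factor $\kappa_m$ leads to the mixed weight of parameter $1$, and a second one completes the
    exchange. *)
Lemma vwp_swap (p1 p2 r : C) (m : nat) : admissible p1 p2 r ->
  vwp p1 p2 r m * kap p1 p2 r m * kap p1 p2 r m = vwp (r * p1) (r * p2) (/ r) m.
Proof.
  intros H. rewrite vwp_kap by auto. destruct H as (H1 & H2 & Hr & Q1 & Q2 & Q3 & Q4). pose proof (proj1 Hr) as H0.
  unfold vwp, kap. rewrite wA_swap by auto.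
  replace (wA p1 (r * p2) 1) with (wA p1 p2 r) by (unfold wA; field; apply q_neq_0).
  replace (/ r * (r * p1)) with p1 by (field; auto). replace (/ r * (r * p2)) with p2 by (field; auto).
  rewrite !Cmult_1_l, (Cpow_opp_split (/ r)).
  assert (N1 := qpq_neq_0 m). assert (N2 : qp p1 m <> 0) by now apply qp_neq_0.
  assert (N3 : qp p2 m <> 0) by now apply qp_neq_0.
  assert (N4 : qp (r * p1) m <> 0) by now apply qp_neq_0.
  assert (N5 : qp (r * p2) m <> 0) by now apply qp_neq_0.
  generalize ((/ r) ^ m). intros. field. repeat split; auto.
Qed.

Definition phiterm (p1 p2 r a u x g : C) (k : nat) : C :=
  pp a x k * pp u g k * q ^ k / (qp q k * (qp p1 k * qp p2 k * qp (q / r) k)).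

Lemma phiterm_ser (p1 p2 r a u x g : C) : admissible p1 p2 r ->
  ser (phiterm p1 p2 r a u x g) (CSeries (phiterm p1 p2 r a u x g)).
Proof.
  intros (H1 & H2 & Hr & Q1 & Q2 & Q3 & Q4).
  destruct (XK_le r a x Hr) as (X1 & HX1 & BX1).
  destruct (qp_inv_le_0 _ Q1) as [K1 [HK1 I1]]. destruct (qp_inv_le_0 _ Q2) as [K2 [HK2 I2]].
  pose proof (ppbd_pos u g).
  apply CSeries_exists with (fun k => (ppbd u g * (K1 * K2) * X1) * q ^ k)%R.
  - intros k. unfold phiterm.
    assert (N1 := qpq_neq_0 k). assert (N2 : qp p1 k <> 0) by now apply qp_neq_0.
    assert (N3 : qp p2 k <> 0) by now apply qp_neq_0.
    assert (N4 : qp (q / r) k <> 0) by now apply qp_neq_0, nonintegral_q_inv.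
    replace (pp a x k * pp u g k * q ^ k / (qp q k * (qp p1 k * qp p2 k * qp (q / r) k)))
      with (pp u g k * (/ qp p1 k * / qp p2 k) * XK r a x k) by (unfold XK; field; repeat split; auto).
    replace (ppbd u g * (K1 * K2) * X1 * q ^ k)%R with (ppbd u g * (K1 * K2) * (X1 * q ^ k))%R by ring.
    rewrite !Cmod_mult. apply Rmult_le_compat; auto using Cmod_ge_0.
    + repeat apply Rmult_le_pos; apply Cmod_ge_0.
    + apply Rmult_le_compat; auto using Cmod_ge_0, pp_le_0; [apply Rmult_le_pos; apply Cmod_ge_0 |].
      apply Rmult_le_compat; auto using Cmod_ge_0.
  - apply summable_scal; [| apply summable_qpow].
    apply Rmult_le_pos; [apply Rmult_le_pos; [lra | apply Rmult_le_pos; lra] | lra].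
Qed.

(** One of the two ${}_4\phi_3$ terms of the analytic part, up to the factor $1-A$; the other is its
    image under the exchange. *)
Definition half (p1 p2 r a u x g : C) : C :=
  vwpS p1 p2 r * (ppinf (r * a) x * ppinf (r * u) g) / (pinf (r * a * a) * pinf (r * u * u) * (pinf r * pinf r))
  * CSeries (phiterm p1 p2 r a u x g).

(** Only $E_m(\gamma)$ is expanded, while $E_m(x)$ stays whole and is integrated against each
    coefficient by [weight_E_DD], once for the given data and once for the exchanged data. *)
Lemma bilinear_sum (p1 p2 r a u x g : C) :
  admissible p1 p2 r -> a <> 0 -> u <> 0 -> x <> 0 -> g <> 0 -> qnv (r * a * a) -> qnv (r * u * u) ->
  ser (fun m => vwp p1 p2 r m * EE p1 p2 r a x m * EE p1 p2 r u g m)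
      (half p1 p2 r a u x g + half (r * p1) (r * p2) (/ r) (r * a) (r * u) x g).
Proof.
  intros H Ha Hu Hx Hg Haa Huu. pose proof H as (H1 & H2 & Hr & Q1 & Q2 & Q3 & Q4). pose proof (proj1 Hr) as H0.
  pose proof (admissible_swap _ _ _ H) as H'.
  assert (Ha' : r * a <> 0) by now apply Cmult_neq_0. assert (Hu' : r * u <> 0) by now apply Cmult_neq_0.
  assert (Ea : / r * (r * a) * (r * a) = r * a * a) by (field; auto).
  assert (Eu : / r * (r * u) * (r * u) = r * u * u) by (field; auto).
  assert (Era : / r * (r * a) = a) by (field; auto). assert (Eru : / r * (r * u) = u) by (field; auto).
  assert (Haa' : qnv (/ r * (r * a) * (r * a))) by (rewrite Ea; auto).
  assert (Huu' : qnv (/ r * (r * u) * (r * u))) by (rewrite Eu; auto).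
  assert (N1 : pinf r <> 0) by (apply pinf_neq_0, Hr).
  assert (N2 : pinf (/ r) <> 0) by (apply pinf_neq_0, Hr).
  assert (N3 : pinf (r * a * a) <> 0) by now apply pinf_neq_0.
  assert (N4 : pinf (r * u * u) <> 0) by now apply pinf_neq_0.
  destruct (weight_row_le p1 p2 r u g (EE p1 p2 r a x) H Hu Hg Huu (expbd_EE _ _ _ _ _ H Ha Hx Haa)) as (X & HX & HB).
  set (V := fun k => vwpS p1 p2 r * ppinf (r * a) x / (pinf (r * a * a) * pinf r) * (pp a x k / (qp p1 k * qp p2 k))).
  set (V' := fun k => vwpS (r * p1) (r * p2) (/ r) * ppinf a x / (pinf (r * a * a) * pinf (/ r))
                      * (pp (r * a) x k / (qp (r * p1) k * qp (r * p2) k))).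
  set (s := fun k => / pinf (r * u * u) * (ppinf (r * u) g / pinf r * XK r u g k * V k
                       + ppinf u g / pinf (/ r) * XK (/ r) (r * u) g k * V' k)).
  apply (ser_fubini (fun m k => vwp p1 p2 r m * EE p1 p2 r a x m * erow p1 p2 r u g m k) X (pow q)
           (fun m => vwp p1 p2 r m * EE p1 p2 r a x m * EE p1 p2 r u g m) s).
  - exact HX.
  - exact summable_qpow.
  - exact HB.
  - intros m. apply (ser_scal (vwp p1 p2 r m * EE p1 p2 r a x m)). now apply erow_ser.
  - intros k.
    pose proof (ser_scal (/ pinf (r * u * u) * (ppinf (r * u) g / pinf r * XK r u g k)) _ _
                  (weight_E_DD p1 p2 r a x k H Ha Hx Haa)) as O1.
    pose proof (weight_E_DD (r * p1) (r * p2) (/ r) (r * a) x k H' Ha' Hx Haa') as O2.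
    rewrite Ea, Era in O2.
    pose proof (ser_scal (/ pinf (r * u * u) * (ppinf u g / pinf (/ r) * XK (/ r) (r * u) g k)) _ _ O2) as O3.
    eapply ser_ext; [| eapply ser_eq; [apply (ser_plus _ _ _ _ O1 O3) |]].
    (* The row carries one factor $\kappa_m$ in the second family and [EE_swap] applied to $E_m(x)$
       supplies another; together they convert the weight into the exchanged weight. *)
    + intros m. cbv beta. unfold erow. rewrite <- (vwp_swap p1 p2 r m H).
      rewrite (EE_swap p1 p2 r a x m H Hx Haa). ring.
    + unfold s, V, V'. ring.
  - set (c1 := vwpS p1 p2 r * (ppinf (r * a) x * ppinf (r * u) g) / (pinf (r * a * a) * pinf (r * u * u) * (pinf r * pinf r))).
    set (c2 := vwpS (r * p1) (r * p2) (/ r) * (ppinf a x * ppinf u g)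
               / (pinf (r * a * a) * pinf (r * u * u) * (pinf (/ r) * pinf (/ r)))).
    apply ser_ext with (fun k => c1 * phiterm p1 p2 r a u x g k
                                 + c2 * phiterm (r * p1) (r * p2) (/ r) (r * a) (r * u) x g k).
    + intros k. unfold s, c1, c2, V, V', phiterm, XK.
      assert (M1 := qpq_neq_0 k). assert (M2 : qp p1 k <> 0) by now apply qp_neq_0.
      assert (M3 : qp p2 k <> 0) by now apply qp_neq_0.
      assert (M4 : qp (q / r) k <> 0) by now apply qp_neq_0, nonintegral_q_inv.
      assert (M5 : qp (q / / r) k <> 0) by now apply qp_neq_0, nonintegral_q_inv, nonintegral_inv.
      assert (M6 : qp (r * p1) k <> 0) by now apply qp_neq_0.
      assert (M7 : qp (r * p2) k <> 0) by now apply qp_neq_0.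
      generalize dependent (qp (q / / r) k). generalize dependent (pinf (/ r)). generalize dependent (qp (q / r) k).
      intros. field. repeat split; auto.
    + unfold half. rewrite Ea, Eu, Era, Eru. fold c1 c2.
      apply ser_plus; apply ser_scal; now apply phiterm_ser.
Qed.

(** ** Specialization to the Askey-Wilson function *)

Lemma Csqrt_sqr (z : C) : Csqrt z * Csqrt z = z.
Proof.
  destruct z as [x y]. unfold Csqrt, Cmult, Cmod, Re, Im. cbn [fst snd].
  assert (Hp : (0 <= x ^ 2 + y ^ 2)%R) by nra.
  set (n := sqrt (x ^ 2 + y ^ 2)).
  assert (Hn : (0 <= n)%R) by apply sqrt_pos.
  assert (Hn2 : (n * n = x ^ 2 + y ^ 2)%R) by now apply sqrt_sqrt.
  assert (Hx : (- n <= x <= n)%R).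
  { apply Rabs_le_between. apply Rsqr_incr_0; auto using Rabs_pos.
    rewrite <- Rsqr_abs. unfold Rsqr. nra. }
  assert (Hx1 : (0 <= (n + x) / 2)%R) by lra.
  assert (Hx2 : (0 <= (n - x) / 2)%R) by lra.
  pose proof (sqrt_sqrt _ Hx1) as S1. pose proof (sqrt_sqrt _ Hx2) as S2.
  assert (S3 : (sqrt ((n + x) / 2) * sqrt ((n - x) / 2) = Rabs y / 2)%R).
  { rewrite <- sqrt_mult by auto.
    replace ((n + x) / 2 * ((n - x) / 2))%R with (Rsqr (Rabs y / 2)).
    - apply sqrt_Rsqr. pose proof (Rabs_pos y). lra.
    - unfold Rsqr. replace (Rabs y / 2 * (Rabs y / 2))%R with (Rsqr (Rabs y) / 4)%R by (unfold Rsqr; field).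
      rewrite <- Rsqr_abs. unfold Rsqr. nra. }
  set (s := sqrt ((n + x) / 2)) in *. set (t := sqrt ((n - x) / 2)) in *.
  clearbody s t n.
  destruct (Rlt_dec y 0) as [L | L].
  - rewrite Rabs_left in S3 by auto. apply injective_projections; simpl; nra.
  - rewrite Rabs_right in S3 by lra. apply injective_projections; simpl; nra.
Qed.

Lemma Csqrt_neq_0 (z : C) : z <> 0 -> Csqrt z <> 0.
Proof. intros H N. apply H. rewrite <- (Csqrt_sqr z), N. ring. Qed.

Lemma phi43_EE (p1 p2 r a z : C) (m : nat) :
  phi43 q (/ q ^ m) (q ^ m * wA p1 p2 r) (a * z) (a / z) p1 p2 (r * a * a) q = EE p1 p2 r a z m.
Proof.
  apply CSeries_ser. apply ser_ext with (Eterm p1 p2 r a z m).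
  - intros k. unfold Eterm, bs, pp, qpochs. simpl fold_right. rewrite !Cmult_1_r.
    unfold Cdiv. rewrite !Cmult_assoc. ring.
  - apply ser_finite. intros n Hn. unfold Eterm. rewrite bs_vanish by lia. unfold Cdiv. ring.
Qed.

Lemma phi43_phiterm (p1 p2 r a u x g : C) :
  phi43 q (a * x) (a / x) (u * g) (u / g) p1 p2 (q / r) q = CSeries (phiterm p1 p2 r a u x g).
Proof.
  unfold phi43. f_equal. apply FunctionalExtensionality.functional_extensionality. intros k.
  unfold phiterm, pp, qpochs. simpl fold_right. rewrite !Cmult_1_r. unfold Cdiv. rewrite !Cmult_assoc. ring.
Qed.

Lemma triangle_div (m : nat) : Nat.div (m * (m + 1)) 2 = (tri m + m)%nat.
Proof.
  replace (m * (m + 1))%nat with ((tri m + m) * 2)%nat.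
  - now apply Nat.div_mul.
  - pose proof (tri_double m). lia.
Qed.

Section Application.
Context (a b c d : C) (hgen : generic q (Params a b c d)).

Let al : params := Params a b c d.
Let ta : C := pa (inv_sigma q al).
Let p1 : C := a * b.
Let p2 : C := a * c.
Let r : C := q / (a * d).
Let A : C := a * b * c / d.

Lemma abcd_neq_0 : a <> 0 /\ b <> 0 /\ c <> 0 /\ d <> 0.
Proof. apply hgen. Qed.

Lemma generic_qnv : qnv (a * b) /\ qnv (a * c) /\ qnv (b * c) /\ qnv (q * b / d) /\ qnv (q * c / d) /\
  qnv (a * d) /\ qnv (/ (a * d)) /\ qnv (a / d) /\ qnv (d / a).
Proof.
  destruct hgen as (_ & _ & H). rewrite Forall_forall in H.
  repeat split; apply H; simpl; tauto.
Qed.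

Lemma ta_sqr : ta * ta = / q * (a * b * c * d).
Proof. unfold ta, inv_sigma, al. simpl. apply Csqrt_sqr. Qed.

Lemma ta_neq_0 : ta <> 0.
Proof.
  destruct abcd_neq_0 as (Ha & Hb & Hc & Hd). pose proof q_neq_0 as Hq.
  apply Csqrt_neq_0. simpl. intros N.
  assert (K : a * b * c * d <> 0) by auto using Cmult_neq_0.
  apply K. replace (a * b * c * d) with (q * (/ q * (a * b * c * d))) by (field; auto). rewrite N. ring.
Qed.

Lemma r_mult_p1 : r * p1 = q * b / d.
Proof. destruct abcd_neq_0 as (Ha & Hb & Hc & Hd). unfold r, p1. field. auto. Qed.

Lemma r_mult_p2 : r * p2 = q * c / d.
Proof. destruct abcd_neq_0 as (Ha & Hb & Hc & Hd). unfold r, p2. field. auto. Qed.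

Lemma r_mult_aa : r * a * a = q * a / d.
Proof. destruct abcd_neq_0 as (Ha & Hb & Hc & Hd). unfold r. field. auto. Qed.

(** From $\tilde a^2=abcd/q$. This is the reason why $bc$ stands in the polynomial in $\gamma$ where
    $qa/d$ stands in the polynomial in $x$. *)
Lemma r_mult_uu : r * ta * ta = b * c.
Proof.
  destruct abcd_neq_0 as (Ha & Hb & Hc & Hd). pose proof q_neq_0 as Hq.
  rewrite <- Cmult_assoc, ta_sqr. unfold r. field. auto.
Qed.

Lemma wA_eq : wA p1 p2 r = A.
Proof.
  destruct abcd_neq_0 as (Ha & Hb & Hc & Hd). pose proof q_neq_0 as Hq.
  unfold wA, A, p1, p2, r. field. auto.
Qed.

Lemma r_nonintegral : nonintegral r.
Proof.
  destruct abcd_neq_0 as (Ha & Hb & Hc & Hd). pose proof q_neq_0 as Hq.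
  destruct generic_qnv as (_ & _ & _ & _ & _ & G1 & G2 & _ & _).
  assert (Hi : / r = a * d / q) by (unfold r; field; auto).
  split; [| split].
  - intros N. apply Hq. replace (RtoC q) with (r * (a * d)) by (unfold r; field; auto). rewrite N. ring.
  - replace r with (/ (a * d) * q) by (unfold r; field; auto). now apply qnv_q.
  (* $1/r=ad/q$ lies one step beyond $ad$: the case $k=0$ means $ad=q$, which is excluded by the
     condition on $1/(ad)$ instead. *)
  - rewrite Hi. intros [|k] E.
    + apply (G2 1%nat). simpl in E. simpl.
      replace (/ (a * d) * (q * 1)) with (/ (a * d / q * 1)) by (field; auto). rewrite E. field.
    + apply (G1 k). rewrite <- E. simpl. field. auto.
Qed.

Lemma params_admissible : admissible p1 p2 r.
Proof.
  destruct abcd_neq_0 as (Ha & Hb & Hc & Hd). destruct generic_qnv as (G1 & G2 & G3 & G4 & G5 & _).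
  unfold admissible. rewrite r_mult_p1, r_mult_p2.
  pose proof r_nonintegral. assert (p1 <> 0) by now apply Cmult_neq_0.
  assert (p2 <> 0) by now apply Cmult_neq_0. tauto.
Qed.

Lemma qnv_raa : qnv (r * a * a).
Proof.
  destruct abcd_neq_0 as (Ha & Hb & Hc & Hd). destruct generic_qnv as (_ & _ & _ & _ & _ & _ & _ & G & _).
  rewrite r_mult_aa. replace (q * a / d) with (a / d * q) by (field; auto). now apply qnv_q.
Qed.

Lemma qnv_ruu : qnv (r * ta * ta).
Proof. rewrite r_mult_uu. apply generic_qnv. Qed.

Lemma one_minus_A : 1 - A <> 0.
Proof.
  intros N. destruct hgen as (_ & H & _). apply H. symmetry. now apply Cminus_eq_0.
Qed.

Definition bilin_term (g x : C) (m : nat) : C :=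
  / (1 - A) * (vwp p1 p2 r m * EE p1 p2 r a x m * EE p1 p2 r ta g m).

(** Its denominators are independent of $(\gamma,x)$, so it also makes sense on the polar divisor
    and serves there as the value of the analytic part. *)
Definition bilin (g x : C) : C :=
  / (1 - A) * (half p1 p2 r a ta x g + half (r * p1) (r * p2) (/ r) (r * a) (r * ta) x g).

Lemma bilin_ser (g x : C) : g <> 0 -> x <> 0 -> ser (bilin_term g x) (bilin g x).
Proof.
  intros Hg Hx. apply (ser_scal (/ (1 - A))).
  apply bilinear_sum; auto using params_admissible, ta_neq_0, qnv_raa, qnv_ruu. apply abcd_neq_0.
Qed.

Lemma phi_x_EE (x : C) (m : nat) :
  phi43 q (/ q ^ m) (q ^ m * a * b * c / d) (a * x) (a / x) (a * b) (a * c) (q * a / d) q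
  = EE p1 p2 r a x m.
Proof.
  rewrite <- phi43_EE, wA_eq, r_mult_aa.
  replace (q ^ m * a * b * c / d) with (q ^ m * A) by (unfold A, Cdiv; ring). reflexivity.
Qed.

Lemma phi_g_EE (g : C) (m : nat) :
  phi43 q (/ q ^ m) (q ^ m * a * b * c / d) (ta * g) (ta / g) (a * b) (a * c) (b * c) q
  = EE p1 p2 r ta g m.
Proof.
  rewrite <- phi43_EE, wA_eq, r_mult_uu.
  replace (q ^ m * a * b * c / d) with (q ^ m * A) by (unfold A, Cdiv; ring). reflexivity.
Qed.

Lemma term_eq (g x : C) (m : nat) :
  phi43 q (/ q ^ m) (q ^ m * a * b * c / d) (a * x) (a / x) (a * b) (a * c) (q * a / d) q
  * phi43 q (/ q ^ m) (q ^ m * a * b * c / d) (ta * g) (ta / g) (a * b) (a * c) (b * c) q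
  * (((1 - a * b * c * q ^ (2 * m) / d) * qpochs q [a * b * c / d; a * b; a * c] m)
     / ((1 - a * b * c / d) * qpochs q [RtoC q; q * b / d; q * c / d] m))
  * (- (1) / (a * d)) ^ m * q ^ (Nat.div (m * (m + 1)) 2)
  = bilin_term g x m.
Proof.
  destruct abcd_neq_0 as (Ha & Hb & Hc & Hd). pose proof q_neq_0 as Hq.
  rewrite phi_x_EE, phi_g_EE, triangle_div, Cpow_add_r. unfold bilin_term, vwp.
  rewrite wA_eq, r_mult_p1, r_mult_p2. unfold qpochs. simpl fold_right. rewrite !Cmult_1_r.
  replace (a * b * c * q ^ (2 * m) / d) with (A * q ^ (2 * m)) by (unfold A, Cdiv; ring).
  fold A p1 p2.
  (* $-r=q\cdot(-1/(ad))$: the extra $q^m$ raises the exponent $m(m-1)/2$ of the weight to the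
     $m(m+1)/2$ of the theorem. *)
  replace ((- r) ^ m) with ((- (1) / (a * d)) ^ m * q ^ m).
  2:{ rewrite <- Cpow_mult_l. f_equal. unfold r. field. auto. }
  destruct generic_qnv as (_ & _ & _ & G4 & G5 & _).
  assert (N1 := qpq_neq_0 m). assert (N2 : qp (q * b / d) m <> 0) by now apply qp_neq_0.
  assert (N3 : qp (q * c / d) m <> 0) by now apply qp_neq_0. pose proof one_minus_A as N4.
  generalize ((- (1) / (a * d)) ^ m). clearbody A. generalize dependent (qp (q * b / d) m).
  generalize dependent (qp (q * c / d) m). intros. field. repeat split; auto.
Qed.

Lemma gauss_den_tau (x : C) : gauss_den q (inv_tau q al) x = ppinf (r * a) x.
Proof.
  destruct abcd_neq_0 as (Ha & Hb & Hc & Hd).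
  unfold gauss_den, qpochs_inf, ppinf. simpl. rewrite Cmult_1_r.
  replace (r * a) with (q / d) by (unfold r; field; auto). reflexivity.
Qed.

Lemma gauss_den_sigma_tau (g : C) : gauss_den q (sigma_tau q al) g = ppinf (r * ta) g.
Proof.
  destruct abcd_neq_0 as (Ha & Hb & Hc & Hd). pose proof ta_neq_0 as Ht.
  unfold gauss_den, qpochs_inf, ppinf. simpl. rewrite Cmult_1_r.
  fold al. change (Csqrt (/ q * (a * b * c * d))) with ta.
  replace (r * ta) with (q / (a * d / ta)) by (unfold r; field; auto). reflexivity.
Qed.

(** Both total masses are evaluated by [vwp_sum], one at $r$ and one at $1/r$ with the same $A$.
    Then $(A;q)_\infty=(1-A)(qA;q)_\infty$ absorbs the normalisation, and the two halves match the
    two ${}_4\phi_3$ terms coefficient by coefficient. *)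
Lemma AWfun_regular (g x : C) : g <> 0 -> x <> 0 ->
  ppinf (r * a) x <> 0 -> ppinf (r * ta) g <> 0 ->
  ppinf (r * a) x * ppinf (r * ta) g * AWfun q al g x = bilin g x.
Proof.
  intros Hg Hx Nx Ng.
  destruct abcd_neq_0 as (Ha & Hb & Hc & Hd). pose proof q_neq_0 as Hq. pose proof ta_neq_0 as Ht.
  pose proof params_admissible as Had. pose proof Had as (H1 & H2 & Hr & Q1 & Q2 & Q3 & Q4). pose proof (proj1 Hr) as H0.
  unfold AWfun, al. unfold inv_sigma. cbn [pa pb pc pd].
  fold al. change (Csqrt (/ q * (a * b * c * d))) with ta.
  cbv zeta.
  assert (E1 : phi43 q (a * x) (a / x) (ta * g) (ta / g) (a * b) (a * c) (a * d) q
               = CSeries (phiterm p1 p2 r a ta x g)).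
  { rewrite <- phi43_phiterm. f_equal. unfold r. field. auto. }
  assert (E2 : phi43 q (q * x / d) (q / (d * x)) (q * g / (a * d / ta)) (q / (a * d / ta * g))
                 (q * b / d) (q * c / d) (q ^ 2 / (a * d)) q
               = CSeries (phiterm (r * p1) (r * p2) (/ r) (r * a) (r * ta) x g)).
  { rewrite <- phi43_phiterm, r_mult_p1, r_mult_p2. f_equal; unfold r; simpl; field; auto. }
  rewrite E1, E2. unfold bilin, half.
  pose proof (vwp_sum p1 p2 r Q3 Q4) as V1.
  pose proof (admissible_swap _ _ _ Had) as (_ & _ & Hr' & _ & _ & Q3' & Q4').
  pose proof (vwp_sum (r * p1) (r * p2) (/ r) Q3' Q4') as V2.
  rewrite wA_swap in V2 by auto. rewrite wA_eq in V1, V2.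
  replace (/ r * (r * p1)) with p1 in * by (field; auto).
  replace (/ r * (r * p2)) with p2 in * by (field; auto).
  replace (/ r * (r * a)) with a by (field; auto). replace (/ r * (r * ta)) with ta by (field; auto).
  replace (a * (r * a)) with (r * a * a) by ring. replace (ta * (r * ta)) with (r * ta * ta) by ring.
  assert (M1 : pinf (r * p1) <> 0) by now apply pinf_neq_0.
  assert (M2 : pinf (r * p2) <> 0) by now apply pinf_neq_0.
  assert (M3 : pinf p1 <> 0) by now apply pinf_neq_0.
  assert (M4 : pinf p2 <> 0) by now apply pinf_neq_0.
  assert (M5 : pinf r <> 0) by now apply pinf_neq_0, Hr.
  assert (M6 : pinf (/ r) <> 0) by now apply pinf_neq_0, Hr.
  assert (M7 : pinf (r * a * a) <> 0) by apply pinf_neq_0, qnv_raa.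
  assert (M8 : pinf (r * ta * ta) <> 0) by apply pinf_neq_0, qnv_ruu.
  assert (W1 : vwpS p1 p2 r = pinf A * pinf r / (pinf (r * p1) * pinf (r * p2))).
  { rewrite <- V1. field. auto. }
  assert (W2 : vwpS (r * p1) (r * p2) (/ r) = pinf A * pinf (/ r) / (pinf p1 * pinf p2)).
  { rewrite <- V2. field. auto. }
  rewrite W1, W2. pose proof one_minus_A as NA.
  rewrite (pinf_S A). unfold qpochs_inf. simpl fold_right. rewrite !Cmult_1_r.
  rewrite <- r_mult_p1, <- r_mult_p2, <- r_mult_aa, <- r_mult_uu.
  replace (q * a * b * c / d) with (A * q) by (unfold A, Cdiv; ring).
  fold p1 p2 r. replace (a * d / q) with (/ r) by (unfold r; field; auto).
  unfold ppinf in *.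
  replace (q * x / d) with (r * a * x) by (unfold r; field; auto).
  replace (q / (d * x)) with (r * a / x) by (unfold r; field; auto).
  replace (q * g / (a * d / ta)) with (r * ta * g) by (unfold r; field; auto).
  replace (q / (a * d / ta * g)) with (r * ta / g) by (unfold r; field; auto).
  assert (Nx1 : pinf (r * a * x) <> 0) by (intros N; apply Nx; rewrite N; ring).
  assert (Nx2 : pinf (r * a / x) <> 0) by (intros N; apply Nx; rewrite N; ring).
  assert (Ng1 : pinf (r * ta * g) <> 0) by (intros N; apply Ng; rewrite N; ring).
  assert (Ng2 : pinf (r * ta / g) <> 0) by (intros N; apply Ng; rewrite N; ring).
  generalize (CSeries (phiterm p1 p2 r a ta x g)). generalize (CSeries (phiterm (r * p1) (r * p2) (/ r) (r * a) (r * ta) x g)).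
  intros X1 X2. clear - M1 M2 M3 M4 M5 M6 M7 M8 Nx1 Nx2 Ng1 Ng2 NA.
  generalize dependent (pinf (r * p1)). generalize dependent (pinf (r * p2)).
  generalize dependent (pinf p1). generalize dependent (pinf p2).
  generalize dependent (pinf (/ r)). generalize dependent (pinf r).
  generalize dependent (pinf (r * a * a)). generalize dependent (pinf (r * ta * ta)).
  generalize dependent (pinf (r * a * x)). generalize dependent (pinf (r * a / x)).
  generalize dependent (pinf (r * ta * g)). generalize dependent (pinf (r * ta / g)).
  generalize (pinf (a * x)), (pinf (a / x)), (pinf (ta * g)), (pinf (ta / g)), (pinf (A * q)).
  intros. field. repeat split; auto.
Qed.

(** ** Points of the polar divisor *)

(** Limits along an arbitrary filter in terms of moduli, so that the same algebra of limits applies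
    to functions of the pair $(\gamma,x)$ near a point and within the regular set. *)
Definition flim {T : Type} (G : (T -> Prop) -> Prop) (f : T -> C) (l : C) : Prop :=
  forall eps : R, (0 < eps)%R -> G (fun t => (Cmod (f t - l) < eps)%R).

Lemma flim_filterlim {T : Type} (G : (T -> Prop) -> Prop) {FG : Filter G} (f : T -> C) (l : C) :
  flim G f l -> filterlim f G (locally l).
Proof.
  intros H. apply (filterlim_locally_ball_norm (K := C_AbsRing) (U := C_NormedModule)).
  intros eps. apply H, cond_pos.
Qed.

Lemma filterlim_flim {T : Type} (G : (T -> Prop) -> Prop) {FG : Filter G} (f : T -> C) (l : C) :
  filterlim f G (locally l) -> flim G f l.
Proof.
  intros H eps Heps.
  exact (proj1 (filterlim_locally_ball_norm (K := C_AbsRing) (U := C_NormedModule) f l) H (mkposreal eps Heps)).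
Qed.

Lemma flim_const {T : Type} (G : (T -> Prop) -> Prop) {FG : Filter G} (c0 : C) : flim G (fun _ => c0) c0.
Proof.
  intros eps Heps. apply filter_forall. intros _.
  replace (c0 - c0) with (RtoC 0) by ring. now rewrite Cmod_0.
Qed.

Lemma flim_plus {T : Type} (G : (T -> Prop) -> Prop) {FG : Filter G} (f h : T -> C) (l l' : C) :
  flim G f l -> flim G h l' -> flim G (fun t => f t + h t) (l + l').
Proof.
  intros H H' eps Heps.
  generalize (filter_and (F := G) _ _ (H (eps / 2)%R ltac:(lra)) (H' (eps / 2)%R ltac:(lra))).
  apply filter_imp. intros t [K K'].
  replace (f t + h t - (l + l')) with ((f t - l) + (h t - l')) by ring.
  eapply Rle_lt_trans; [apply Cmod_triangle | lra].
Qed.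

Lemma flim_mult {T : Type} (G : (T -> Prop) -> Prop) {FG : Filter G} (f h : T -> C) (l l' : C) :
  flim G f l -> flim G h l' -> flim G (fun t => f t * h t) (l * l').
Proof.
  intros H H' eps Heps.
  pose proof (Cmod_ge_0 l) as Hl. pose proof (Cmod_ge_0 l') as Hl'.
  set (D := (Cmod l + Cmod l' + 1)%R).
  set (e := Rmin 1 (eps / D)).
  assert (HD : (0 < D)%R) by (unfold D; lra).
  assert (He : (0 < e)%R) by (apply Rmin_pos; [lra | now apply Rdiv_lt_0_compat]).
  generalize (filter_and (F := G) _ _ (H e He) (H' e He)).
  apply filter_imp. intros t [K K'].
  replace (f t * h t - l * l') with ((f t - l) * (h t - l') + (l * (h t - l') + l' * (f t - l))) by ring.
  eapply Rle_lt_trans; [apply Cmod_triangle |].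
  assert (T2 := Cmod_triangle (l * (h t - l')) (l' * (f t - l))). rewrite !Cmod_mult in *.
  pose proof (Cmod_ge_0 (f t - l)). pose proof (Cmod_ge_0 (h t - l')).
  assert (E1 : (e <= 1)%R) by apply Rmin_l.
  assert (E2 : (e * D <= eps)%R).
  { apply Rle_trans with (eps / D * D)%R; [apply Rmult_le_compat_r; [lra | apply Rmin_r] | right; field; lra]. }
  assert (Cmod (f t - l) * Cmod (h t - l') < e * 1)%R by nra.
  assert (Cmod l * Cmod (h t - l') <= Cmod l * e)%R by nra.
  assert (Cmod l' * Cmod (f t - l) <= Cmod l' * e)%R by nra.
  unfold D in E2. nra.
Qed.

Lemma flim_inv {T : Type} (G : (T -> Prop) -> Prop) {FG : Filter G} (f : T -> C) (l : C) :
  l <> 0 -> flim G f l -> flim G (fun t => / f t) (/ l).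
Proof.
  intros Hl H eps Heps. pose proof (proj1 (Cmod_gt_0 l) Hl) as Hp.
  set (e := Rmin (Cmod l / 2) (eps * (Cmod l * Cmod l) / 2)).
  assert (He : (0 < e)%R).
  { apply Rmin_pos; [lra |]. apply Rdiv_lt_0_compat; [repeat apply Rmult_lt_0_compat; lra | lra]. }
  generalize (H e He). apply filter_imp. intros t K.
  assert (E1 : (e <= Cmod l / 2)%R) by apply Rmin_l.
  assert (E2 : (e <= eps * (Cmod l * Cmod l) / 2)%R) by apply Rmin_r.
  assert (F : (Cmod l / 2 < Cmod (f t))%R).
  { rewrite Cmod_minus_sym in K. pose proof (Cmod_triangle_inv l (f t)). lra. }
  assert (Nf : f t <> 0) by (apply Cmod_gt_0; lra).
  replace (/ f t - / l) with ((l - f t) * / (f t * l)) by (field; auto).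
  assert (Nfl : f t * l <> 0) by now apply Cmult_neq_0.
  rewrite Cmod_mult, Cmod_inv, Cmod_mult, Cmod_minus_sym by auto.
  assert (P : (0 < Cmod (f t) * Cmod l)%R) by (apply Rmult_lt_0_compat; lra).
  apply Rmult_lt_reg_r with (Cmod (f t) * Cmod l)%R; auto.
  rewrite Rmult_assoc, Rinv_l by lra. rewrite Rmult_1_r.
  eapply Rlt_le_trans; [apply K |]. eapply Rle_trans; [apply E2 |].
  replace (eps * (Cmod l * Cmod l) / 2)%R with (eps * (Cmod l / 2 * Cmod l))%R by field.
  apply Rmult_le_compat_l; [lra |]. apply Rmult_le_compat_r; lra.
Qed.

Lemma flim_csum {T : Type} (G : (T -> Prop) -> Prop) {FG : Filter G} (f : nat -> T -> C) (l : nat -> C) (n : nat) :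
  (forall k, flim G (f k) (l k)) -> flim G (fun t => csum (fun k => f k t) n) (csum l n).
Proof.
  intros H. induction n as [|n IH]; simpl; [now apply flim_const | now apply (flim_plus G)].
Qed.

(** Dominated convergence along a filter: a common summable majorant makes both tails smaller than
    $\varepsilon/3$, and the remaining finite sum converges termwise. *)
Lemma flim_ser {T : Type} (G : (T -> Prop) -> Prop) {FG : Filter G}
  (f : T -> nat -> C) (s : T -> C) (f0 : nat -> C) (s0 : C) (X : nat -> R) :
  summable X -> G (fun t => (forall m, (Cmod (f t m) <= X m)%R) /\ ser (f t) (s t)) ->
  (forall m, (Cmod (f0 m) <= X m)%R) -> ser f0 s0 ->
  (forall m, flim G (fun t => f t m) (f0 m)) -> flim G s s0.
Proof.
  intros [HX [S HS]] HG H0 Hs0 Hf eps Heps.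
  assert (L := HS). apply is_lim_seq_spec in L.
  assert (H3 : (0 < eps / 3)%R) by lra.
  destruct (L (mkposreal _ H3)) as [N HN]. specialize (HN N (le_n N)). simpl in HN.
  apply Rabs_def2 in HN.
  generalize (filter_and _ _ HG (flim_csum G (fun k t => f t k) f0 N Hf (eps / 3)%R H3)).
  apply filter_imp. intros t [[B1 B2] B3].
  pose proof (ser_tail_le _ X _ S N B1 HS B2) as T1.
  pose proof (ser_tail_le _ X _ S N H0 HS Hs0) as T2.
  replace (s t - s0) with ((s t - csum (f t) N) + ((csum (f t) N - csum f0 N) - (s0 - csum f0 N))) by ring.
  eapply Rle_lt_trans; [apply Cmod_triangle |].
  assert (T3 := Cmod_triangle_minus (csum (f t) N - csum f0 N) (s0 - csum f0 N)).
  change (fun k => f t k) with (f t) in B3. lra.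
Qed.

Lemma flim_qp {T : Type} (G : (T -> Prop) -> Prop) {FG : Filter G} (f : T -> C) (l : C) (k : nat) :
  flim G f l -> flim G (fun t => qp (f t) k) (qp l k).
Proof.
  intros H. induction k as [|k IH]; simpl; [now apply flim_const |].
  apply (flim_mult G); auto. unfold Cminus. apply (flim_plus G); auto using flim_const.
  intros eps Heps. generalize (flim_mult G f (fun _ => q ^ k) l (q ^ k) H (flim_const G _) eps Heps).
  apply filter_imp. intros t. rewrite Cmod_minus_sym.
  replace (l * q ^ k - f t * q ^ k) with (- (f t * q ^ k) - - (l * q ^ k)) by ring. auto.
Qed.

Lemma flim_EE {T : Type} (G : (T -> Prop) -> Prop) {FG : Filter G} (f : T -> C) (l a0 : C) (m : nat) :
  l <> 0 -> flim G f l -> flim G (fun t => EE p1 p2 r a0 (f t) m) (EE p1 p2 r a0 l m).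
Proof.
  intros Hl H. unfold EE. apply (flim_csum G (fun s t => Eterm p1 p2 r a0 (f t) m s)).
  intros s. unfold Eterm, pp, Cdiv. apply (flim_mult G); auto using flim_const.
  apply (flim_mult G); apply (flim_qp G); auto; apply (flim_mult G); auto using flim_const, flim_inv.
Qed.

(** Continuity is read off the bilinear series rather than the closed form: each term is a Laurent
    polynomial in $x$ and in $\gamma$, and [EE_le] gives a majorant valid on a whole
    neighbourhood. *)
Lemma bilin_flim (G : (C * C -> Prop) -> Prop) {FG : Filter G} (g x : C) : g <> 0 -> x <> 0 ->
  flim G fst g -> flim G snd x -> flim G (fun p => bilin (fst p) (snd p)) (bilin g x).
Proof.
  intros Hg Hx Lg Lx.
  pose proof params_admissible as Had. pose proof ta_neq_0 as Ht. destruct abcd_neq_0 as (Ha & _).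
  (* The margin $1$ leaves room for all nearby points and for their inverses. *)
  set (R1 := Rmax (Cmod x + 1) (Cmod (/ x) + 1)). set (R2 := Rmax (Cmod g + 1) (Cmod (/ g) + 1)).
  destruct (EE_le p1 p2 r a R1 Had Ha qnv_raa) as (M1 & K1 & HM1 & HK1 & B1).
  destruct (EE_le p1 p2 r ta R2 Had Ht qnv_ruu) as (M2 & K2 & HM2 & HK2 & B2).
  destruct (vwp_expbd p1 p2 r Had) as (M3 & K3 & HM3 & HK3 & B3).
  set (X := fun m => (Cmod (/ (1 - A)) * (M3 * M1 * M2) * ((K3 * K1 * K2) ^ m * q ^ tri m))%R).
  assert (Bd : forall g' x' : C, g' <> 0 -> x' <> 0 -> (Cmod x' <= R1)%R -> (Cmod (/ x') <= R1)%R ->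
     (Cmod g' <= R2)%R -> (Cmod (/ g') <= R2)%R -> forall m, (Cmod (bilin_term g' x' m) <= X m)%R).
  { intros g' x' Ng Nx I1 I2 I3 I4 m. unfold bilin_term, X. rewrite !Cmod_mult.
    replace (Cmod (/ (1 - A)) * (M3 * M1 * M2) * ((K3 * K1 * K2) ^ m * q ^ tri m))%R
      with (Cmod (/ (1 - A)) * (M3 * K3 ^ m * q ^ tri m * (M1 * K1 ^ m) * (M2 * K2 ^ m)))%R
      by (rewrite !Rpow_mult_distr; ring).
    apply Rmult_le_compat_l; [apply Cmod_ge_0 |].
    apply Rmult_le_compat; auto using Cmod_ge_0; [apply Rmult_le_pos; apply Cmod_ge_0 |].
    apply Rmult_le_compat; auto using Cmod_ge_0. }
  apply (flim_ser G (fun p m => bilin_term (fst p) (snd p) m) (fun p => bilin (fst p) (snd p))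
           (bilin_term g x) (bilin g x) X).
  - apply summable_scal; [| apply summable_pow_tri; repeat apply Rmult_le_pos; lra].
    apply Rmult_le_pos; [apply Cmod_ge_0 | repeat apply Rmult_le_pos; lra].
  - assert (NZ : forall l : C, l <> 0 -> (0 < Cmod l)%R) by (intros; now apply Cmod_gt_0).
    assert (Near : forall (f : C * C -> C) (l : C), l <> 0 -> flim G f l ->
       G (fun p => f p <> 0 /\ (Cmod (f p) <= Cmod l + 1)%R /\ (Cmod (/ f p) <= Cmod (/ l) + 1)%R)).
    { intros f l Hl Hf.
      generalize (filter_and (F := G) _ _ (Hf (Rmin 1 (Cmod l)) ltac:(apply Rmin_pos; [lra | auto]))
                    (flim_inv G f l Hl Hf 1%R ltac:(lra))).
      apply filter_imp. intros p [P1 P2].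
      pose proof (Rmin_l 1 (Cmod l)). pose proof (Rmin_r 1 (Cmod l)).
      repeat split.
      - intros N. rewrite N in P1. replace (0 - l) with (- l) in P1 by ring. rewrite Cmod_opp in P1. lra.
      - pose proof (Cmod_triangle_inv (f p) l). lra.
      - pose proof (Cmod_triangle_inv (/ f p) (/ l)). lra. }
    generalize (filter_and (F := G) _ _ (Near _ _ Hx Lx) (Near _ _ Hg Lg)).
    apply filter_imp. intros p [(P1 & P2 & P3) (P4 & P5 & P6)]. split.
    + apply Bd; auto; eapply Rle_trans; try eassumption; (apply Rmax_l || apply Rmax_r).
    + now apply bilin_ser.
  - pose proof (Rmax_l (Cmod x + 1) (Cmod (/ x) + 1)). pose proof (Rmax_r (Cmod x + 1) (Cmod (/ x) + 1)).
    pose proof (Rmax_l (Cmod g + 1) (Cmod (/ g) + 1)). pose proof (Rmax_r (Cmod g + 1) (Cmod (/ g) + 1)).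
    apply Bd; auto; unfold R1, R2; lra.
  - now apply bilin_ser.
  - intros m. unfold bilin_term. apply (flim_mult G); auto using flim_const.
    apply (flim_mult G); auto; [apply (flim_mult G); auto using flim_const |]; now apply (flim_EE G).
Qed.

Lemma qnv_nonreal (y : C) : Im y <> 0%R -> qnv y.
Proof.
  intros H k E. apply H. destruct y as [y1 y2]. simpl.
  rewrite <- RtoC_pow in E. apply (f_equal Im) in E. simpl in E.
  pose proof (qpow_pos k) as Hk.
  assert (K : (y2 * q ^ k = 0)%R) by lra.
  apply Rmult_integral in K. destruct K; lra.
Qed.

(** $(u;q)_\infty$ can vanish only at real $u$. Moving $z$ to $z(1+it)$ makes $c_0z$ and $c_0/z$
    nonreal for suitable small $t>0$; regular points therefore accumulate at every point. *)
Lemma regular_near (c0 z : C) (eps : R) : c0 <> 0 -> z <> 0 -> (0 < eps)%R ->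
  exists z' : C, z' <> 0 /\ (Cmod (z' - z) < eps)%R /\ ppinf c0 z' <> 0.
Proof.
  intros Hc Hz Heps.
  (* Chosen so that three times [del], the largest value of $t$ tried, moves $z$ by less than
     [eps]. *)
  set (del := (eps / (4 * (Cmod z + 1)))%R). pose proof (Cmod_ge_0 z) as Hz0.
  assert (Hdel : (0 < del)%R) by (apply Rdiv_lt_0_compat; lra).
  set (al1 := c0 * z). set (be1 := c0 / z).
  assert (Na : al1 <> 0) by now apply Cmult_neq_0.
  assert (Nb : be1 <> 0).
  { intros N. apply Hc. replace c0 with (be1 * z) by (unfold be1; field; auto). rewrite N. ring. }
  (* Each of the two conditions excludes at most one $t$, being the nonvanishing of an affine
     function that is not identically zero. One of the three candidates $\delta,2\delta,3\delta$
     therefore satisfies both. *)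
  assert (Ex : exists t, (0 < t <= 3 * del)%R /\ (Im al1 + Re al1 * t <> 0)%R /\ (Im be1 - Re be1 * t <> 0)%R).
  { assert (Two : forall (y1 y2 t1 t2 : R), t1 <> t2 -> (y2 + y1 * t1 = 0)%R -> (y2 + y1 * t2 = 0)%R -> y1 = 0%R /\ y2 = 0%R).
    { intros y1 y2 t1 t2 Ht E1 E2. assert (E : (y1 * (t1 - t2) = 0)%R) by lra.
      apply Rmult_integral in E. destruct E as [-> | E]; [lra | exfalso; apply Ht; lra]. }
    assert (Za : ~ (Re al1 = 0%R /\ Im al1 = 0%R)).
    { intros [E1 E2]. apply Na. apply injective_projections; simpl; auto. }
    assert (Zb : ~ (Re be1 = 0%R /\ Im be1 = 0%R)).
    { intros [E1 E2]. apply Nb. apply injective_projections; simpl; auto. }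
    assert (TwoA : forall t1 t2, t1 <> t2 -> (Im al1 + Re al1 * t1 = 0)%R -> (Im al1 + Re al1 * t2 <> 0)%R).
    { intros t1 t2 Ht E1 E2. now apply Za, (Two _ _ t1 t2). }
    assert (TwoB : forall t1 t2, t1 <> t2 -> (Im be1 - Re be1 * t1 = 0)%R -> (Im be1 - Re be1 * t2 <> 0)%R).
    { intros t1 t2 Ht E1 E2. apply Zb. destruct (Two (- Re be1)%R (Im be1) t1 t2 Ht); [lra | lra |]. split; lra. }
    assert (D1 : del <> (2 * del)%R) by lra. assert (D2 : del <> (3 * del)%R) by lra.
    assert (D3 : (2 * del)%R <> (3 * del)%R) by lra.
    destruct (Req_dec (Im al1 + Re al1 * del) 0) as [A1 | A1].
    - destruct (Req_dec (Im be1 - Re be1 * (2 * del)) 0) as [B2 | B2].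
      + exists (3 * del)%R. split; [lra |]. split; [now apply TwoA with del | now apply TwoB with (2 * del)%R].
      + exists (2 * del)%R. split; [lra |]. split; [now apply TwoA with del | auto].
    - destruct (Req_dec (Im be1 - Re be1 * del) 0) as [B1 | B1].
      + destruct (Req_dec (Im al1 + Re al1 * (2 * del)) 0) as [A2 | A2].
        * exists (3 * del)%R. split; [lra |]. split; [now apply TwoA with (2 * del)%R | now apply TwoB with del].
        * exists (2 * del)%R. split; [lra |]. split; [auto | now apply TwoB with del].
      + exists del. split; [lra |]. auto. }
  destruct Ex as (t & Ht & E1 & E2).
  set (w := (1%R, t) : C).
  assert (Nw : w <> 0).
  { intros N. apply (f_equal fst) in N. simpl in N. lra. }
  assert (Nwi : ((1, - t)%R : C) <> 0).
  { intros N. apply (f_equal fst) in N. simpl in N. lra. }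
  exists (z * w). split; [now apply Cmult_neq_0 | split].
  - replace (z * w - z) with (z * (w - 1)) by ring. rewrite Cmod_mult.
    assert (Ew : Cmod (w - 1) = t).
    { unfold w, Cmod. simpl. replace ((1 + - (1)) * ((1 + - (1)) * 1) + (t + - 0) * ((t + - 0) * 1))%R with (Rsqr t)
        by (unfold Rsqr; ring).
      apply sqrt_Rsqr. lra. }
    rewrite Ew. apply Rle_lt_trans with ((Cmod z + 1) * (3 * del))%R.
    + apply Rmult_le_compat; lra.
    + unfold del. replace ((Cmod z + 1) * (3 * (eps / (4 * (Cmod z + 1)))))%R with (3 / 4 * eps)%R by (field; lra). lra.
  - apply Cmult_neq_0; apply pinf_neq_0, qnv_nonreal.
    + replace (c0 * (z * w)) with (al1 * w) by (unfold al1; ring).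
      unfold w. destruct al1 as [y1 y2]. simpl in *. lra.
    + replace (c0 / (z * w)) with (be1 * (1, - t)%R * (/ (1 + t * t))%R).
      * destruct be1 as [y1 y2]. simpl in *.
        assert (P : (0 < / (1 + t * t))%R) by (apply Rinv_0_lt_compat; nra).
        intros N. assert (N' : ((y2 - y1 * t) * / (1 + t * t) = 0)%R) by lra.
        apply Rmult_integral in N'. destruct N'; lra.
      * assert (W : w * (1, - t)%R = RtoC (1 + t * t)).
        { unfold w. apply injective_projections; simpl; ring. }
        assert (P : (1 + t * t <> 0)%R) by nra.
        rewrite RtoC_inv, <- W by auto. unfold be1. field. repeat split; auto.
Qed.

Definition regular_filter (g x : C) := within (AW_regular q al) (locally (g, x)).

Lemma AW_regular_iff (g x : C) :
  AW_regular q al (g, x) <-> g <> 0 /\ x <> 0 /\ ppinf (r * a) x <> 0 /\ ppinf (r * ta) g <> 0.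
Proof. unfold AW_regular. simpl fst. simpl snd. now rewrite gauss_den_tau, gauss_den_sigma_tau. Qed.

(** Properness of the filter gives uniqueness of limits within the regular set, without which [iota]
    in [AWfun_an] would select nothing definite. *)
Lemma regular_filter_proper (g x : C) : g <> 0 -> x <> 0 -> ProperFilter' (regular_filter g x).
Proof.
  intros Hg Hx. destruct abcd_neq_0 as (Ha & _). pose proof ta_neq_0 as Ht.
  assert (H0 : r <> 0) by apply r_nonintegral.
  constructor; [| apply within_filter, locally_filter].
  intros [eps H].
  destruct (regular_near (r * a) x eps) as (x' & X1 & X2 & X3); auto using Cmult_neq_0, cond_pos.
  destruct (regular_near (r * ta) g eps) as (g' & G1 & G2 & G3); auto using Cmult_neq_0, cond_pos.
  apply (H (g', x')).
  - split.
    + apply (norm_compat1 (K := C_AbsRing) (V := C_NormedModule)). exact G2.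
    + apply (norm_compat1 (K := C_AbsRing) (V := C_NormedModule)). exact X2.
  - now apply AW_regular_iff.
Qed.

(** At regular points this is [AWfun_regular]. Elsewhere the defining limit is taken along regular
    points, where the function coincides with [bilin], and [bilin] is continuous. *)
Lemma AWfun_an_eq (g x : C) : g <> 0 -> x <> 0 -> AWfun_an q al g x = bilin g x.
Proof.
  intros Hg Hx. unfold AWfun_an.
  set (f := fun p : C * C => / gauss q (inv_tau q al) (snd p) * / gauss q (sigma_tau q al) (fst p)
                             * AWfun q al (fst p) (snd p)).
  assert (F : forall p, AW_regular q al p -> f p = bilin (fst p) (snd p)).
  { intros [g' x'] Hp. apply AW_regular_iff in Hp. destruct Hp as (P1 & P2 & P3 & P4).
    unfold f, gauss. simpl fst. simpl snd. rewrite gauss_den_tau, gauss_den_sigma_tau.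
    rewrite <- AWfun_regular by auto. field. auto. }
  cbv zeta. destruct (excluded_middle_informative (AW_regular q al (g, x))) as [Hp | _].
  - now apply (F (g, x)).
  - pose proof (regular_filter_proper g x Hg Hx) as PF.
    apply (iota_filterlim_locally (V := C_CompleteNormedModule) (F := regular_filter g x)).
    + assert (FF : Filter (regular_filter g x)) by apply within_filter, locally_filter.
      apply filterlim_ext_loc with (fun p => bilin (fst p) (snd p)).
      { unfold regular_filter, within. apply filter_forall. intros p Hp. symmetry. now apply F. }
      apply (flim_filterlim _ (FG := FF)).
      apply bilin_flim; auto; apply (filterlim_flim _ (FG := FF)).
      * intros P HP. apply filter_le_within.
        exact (continuous_fst (U := C_UniformSpace) (V := C_UniformSpace) g x P HP).
      * intros P HP. apply filter_le_within.
        exact (continuous_snd (U := C_UniformSpace) (V := C_UniformSpace) g x P HP).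
Qed.

(** * The spectrum and the sum over it *)

Lemma qpow_inj (m n : nat) : RtoC q ^ m = q ^ n -> m = n.
Proof.
  intros E. assert (K : (q ^ m = q ^ n)%R) by (rewrite <- !Cmod_qpow; now rewrite E).
  assert (Lt : forall i j, (i < j)%nat -> (q ^ j < q ^ i)%R).
  { intros i j H. replace j with (i + S (j - i - 1))%nat by lia. rewrite pow_add.
    pose proof (qpow_pos i). pose proof (qpow_le_1 (j - i - 1)). pose proof (qpow_pos (j - i - 1)).
    assert (q * q ^ (j - i - 1) < 1)%R by nra. simpl. nra. }
  destruct (lt_eq_lt_dec m n) as [[L | L] | L]; auto; apply Lt in L; lra.
Qed.

(** The choice operator returns some index of the given point, and injectivity of $m\mapsto q^m$
    forces it to be $m$. *)
Lemma spec_index_spec (al' : params) (m : nat) :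
  pa (inv_sigma q al') <> 0 -> spec_index q al' (spec q al' m) = m.
Proof.
  intros H. unfold spec_index.
  pose proof (epsilon_spec (inhabits O) (fun n => spec q al' m = spec q al' n) (ex_intro _ m eq_refl)) as E.
  set (n := epsilon _ _) in *. cbv beta in E. unfold spec in E.
  symmetry. apply qpow_inj.
  replace (RtoC q ^ m) with (pa (inv_sigma q al') * q ^ m / pa (inv_sigma q al')) by (field; auto).
  rewrite E. field. auto.
Qed.

Let s0 : C := pa (inv_sigma q (inv_tau q al)).

Lemma s0_sqr : s0 * s0 = A.
Proof.
  destruct abcd_neq_0 as (Ha & Hb & Hc & Hd). pose proof q_neq_0 as Hq.
  unfold s0. simpl. rewrite Csqrt_sqr. unfold A. field. auto.
Qed.

Lemma s0_neq_0 : s0 <> 0.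
Proof.
  intros N. destruct abcd_neq_0 as (Ha & Hb & Hc & Hd).
  assert (K : a * b * c <> 0) by auto using Cmult_neq_0.
  apply K. replace (a * b * c) with (A * d) by (unfold A; field; auto).
  rewrite <- s0_sqr, N. ring.
Qed.

(** $\tilde a\tilde b\tilde c\,q/\tilde d=abc\,q/d$: the two square roots have the same argument, so
    the spectra agree point by point and no choice of sign arises. *)
Lemma spec_sigma_tau (m : nat) : spec q (inv_tau q al) m = spec q (sigma_tau q al) m.
Proof.
  destruct abcd_neq_0 as (Ha & Hb & Hc & Hd). pose proof q_neq_0 as Hq. pose proof ta_neq_0 as Ht.
  unfold spec, sigma_tau, inv_tau. f_equal. unfold inv_sigma at 1 2. cbn [pa pb pc pd]. f_equal.
  unfold inv_sigma. cbn [pa pb pc pd]. fold al. unfold al. cbn [pa pb pc pd].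
  change (Csqrt (/ q * (a * b * c * d))) with ta.
  field. repeat split; auto.
Qed.

Lemma spec_index_tau (m : nat) : spec_index q (inv_tau q al) (spec q (inv_tau q al) m) = m.
Proof. apply spec_index_spec, s0_neq_0. Qed.

Lemma spec_index_sigma_tau (m : nat) : spec_index q (sigma_tau q al) (spec q (inv_tau q al) m) = m.
Proof.
  rewrite spec_sigma_tau. apply spec_index_spec.
  pose proof (spec_sigma_tau 0) as E. unfold spec in E. simpl (q ^ 0) in E. rewrite !Cmult_1_r in E.
  rewrite <- E. apply s0_neq_0.
Qed.

Lemma AWpoly_tau (x : C) (m : nat) :
  AWpoly q (inv_tau q al) (spec q (inv_tau q al) m) x = EE p1 p2 r a x m.
Proof.
  destruct abcd_neq_0 as (Ha & Hb & Hc & Hd). pose proof q_neq_0 as Hq.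
  rewrite <- phi_x_EE. unfold AWpoly.
  pose proof (spec_index_tau m) as E. unfold al, inv_tau in E |- *. cbn [pa pb pc pd] in E |- *. cbv zeta.
  rewrite E. f_equal; field; auto.
Qed.

Lemma AWpoly_sigma_tau (g : C) (m : nat) :
  AWpoly q (sigma_tau q al) (spec q (inv_tau q al) m) g = EE p1 p2 r ta g m.
Proof.
  destruct abcd_neq_0 as (Ha & Hb & Hc & Hd). pose proof q_neq_0 as Hq. pose proof ta_neq_0 as Ht.
  rewrite <- phi_g_EE. unfold AWpoly.
  pose proof (spec_index_sigma_tau m) as E.
  set (s := spec q (inv_tau q al) m) in *. clearbody s.
  unfold sigma_tau, inv_sigma, inv_tau, al in E |- *. cbn [pa pb pc pd] in E |- *.
  change (Csqrt (/ q * (a * b * c * d))) with ta in E |- *. cbv zeta.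
  rewrite E. f_equal; try (field; auto).
  replace (ta * (q / (a * d / ta))) with (ta * ta * q / (a * d)) by (field; auto).
  rewrite ta_sqr. field. auto.
Qed.

(** The last parameter after $\tau\sigma\tau$ is $s_0d/a$. Multiplied by $s_0q^m$ it becomes $bcq^m$
    because $s_0^2=abc/d$, and divided by $s_0q^m$ it becomes $dq^{-m}/a$. *)
Lemma gauss_den_tau_sigma_tau (m : nat) :
  gauss_den q (tau_sigma_tau q al) (spec q (inv_tau q al) m) = pinf (b * c * q ^ m) * pinf (d / a / q ^ m).
Proof.
  destruct abcd_neq_0 as (Ha & Hb & Hc & Hd). pose proof q_neq_0 as Hq. pose proof s0_neq_0 as Hs.
  pose proof (qpow_neq_0 m) as Hm.
  assert (Ed : pd (tau_sigma_tau q al) = s0 * d / a).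
  { unfold tau_sigma_tau. change (pd (inv_tau q (inv_sigma q (inv_tau q al)))) with (q / (a * (q / d) / s0)).
    field. auto. }
  unfold gauss_den, qpochs_inf. rewrite Ed. unfold spec. fold s0. simpl fold_right. rewrite Cmult_1_r.
  f_equal; f_equal.
  - replace (s0 * d / a * (s0 * q ^ m)) with (s0 * s0 * d / a * q ^ m) by (unfold Cdiv; ring).
    rewrite s0_sqr. unfold A. field. auto.
  - field. auto.
Qed.

(** Relative to its value at $s_0$ the Gaussian is $(bc;q)_m/(dq^{-m}/a;q)_m$. Reversing the
    denominator cancels $(qa/d;q)_m$ and $a^{-2m}$ of the weight and leaves
    $(-1/(ad))^mq^{m(m+1)/2}$: the Gaussian supplies the quadratic exponent that the weight alone
    lacks. *)
Lemma summand_eq (g x : C) (m : nat) :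
  weight_sigma q (inv_tau q al) (spec q (inv_tau q al) m)
  * gauss q (tau_sigma_tau q al) (spec q (inv_tau q al) m)
  * AWpoly q (sigma_tau q al) (spec q (inv_tau q al) m) g
  * AWpoly q (inv_tau q al) (spec q (inv_tau q al) m) x
  = gauss q (tau_sigma_tau q al) (spec q (inv_tau q al) 0) * bilin_term g x m.
Proof.
  destruct abcd_neq_0 as (Ha & Hb & Hc & Hd). pose proof q_neq_0 as Hq.
  destruct generic_qnv as (G1 & G2 & G3 & G4 & G5 & G6 & G7 & G8 & G9).
  pose proof (qpow_neq_0 m) as Hm.
  rewrite AWpoly_tau, AWpoly_sigma_tau. unfold gauss. rewrite !gauss_den_tau_sigma_tau.
  unfold bilin_term, vwp. rewrite wA_eq, r_mult_p1, r_mult_p2.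
  assert (W : weight_sigma q (inv_tau q al) (spec q (inv_tau q al) m)
     = ((1 - q ^ (2 * m) * A) * (qp A m * (qp p1 m * (qp p2 m * qp (q * a / d) m))))
       / ((1 - A) * (qp q m * (qp (b * c) m * (qp (q * b / d) m * qp (q * c / d) m)))) * / a ^ (2 * m)).
  { unfold weight_sigma. pose proof (spec_index_tau m) as E.
    set (s := spec q (inv_tau q al) m) in *. clearbody s.
    unfold al, inv_tau in E |- *. cbn [pa pb pc pd] in E |- *. cbv zeta. rewrite E.
    unfold qpochs. simpl fold_right. rewrite !Cmult_1_r.
    replace (/ q * (a * b * c * (q / d))) with A by (unfold A; field; auto).
    replace (a * (q / d)) with (q * a / d) by (field; auto).
    replace (b * (q / d)) with (q * b / d) by (field; auto).
    replace (c * (q / d)) with (q * c / d) by (field; auto). reflexivity. }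
  rewrite W.
  assert (Hda : d / a <> 0).
  { intros N. apply Hd. replace d with (d / a * a) by (field; auto). rewrite N. ring. }
  pose proof (qp_rev (d / a) m Hda) as Rv.
  replace (q / (d / a)) with (q * a / d) in Rv by (field; auto).
  assert (Sd : pinf (d / a / q ^ m) = qp (d / a / q ^ m) m * pinf (d / a)).
  { rewrite (pinf_split (d / a / q ^ m) m). do 2 f_equal. field. auto. }
  assert (Sb : pinf (b * c) = qp (b * c) m * pinf (b * c * q ^ m)) by apply pinf_split.
  simpl (q ^ 0). replace (d / a / 1) with (d / a) by (field; auto). rewrite (Cmult_1_r (b * c)), Sd, Sb.
  assert (Qa : qnv (q * a / d)) by (replace (q * a / d) with (a / d * q) by (field; auto); now apply qnv_q).
  assert (N1 : qp (q * a / d) m <> 0) by now apply qp_neq_0.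
  assert (N2 : qp (b * c) m <> 0) by now apply qp_neq_0.
  assert (N3 : pinf (b * c * q ^ m) <> 0) by now apply pinf_neq_0, qnv_qpow.
  assert (N4 : pinf (d / a) <> 0) by now apply pinf_neq_0.
  assert (N5 : qp (q * b / d) m <> 0) by now apply qp_neq_0.
  assert (N6 : qp (q * c / d) m <> 0) by now apply qp_neq_0.
  pose proof (qpq_neq_0 m) as N7. pose proof one_minus_A as N8.
  assert (N9 : (- (d / a)) ^ m <> 0).
  { apply Cpow_nz. intros N. apply Hda. replace (d / a) with (- - (d / a)) by ring. rewrite N. ring. }
  assert (N10 : qp (d / a / q ^ m) m <> 0).
  { intros N. rewrite N, Cmult_0_l in Rv. symmetry in Rv. revert Rv. now apply Cmult_neq_0. }
  (* Written through $(d/a)\,a^2=ad$, so that the power of $-d/a$ produced by the reversal can be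
     matched. *)
  assert (Y : (- r) ^ m * q ^ tri m = q ^ (tri m + m) / ((- (d / a)) ^ m * a ^ (2 * m))).
  { replace ((- (d / a)) ^ m * a ^ (2 * m)) with ((- (a * d)) ^ m).
    2:{ rewrite Cpow_mult_r, <- Cpow_mult_l. f_equal. simpl. field. auto. }
    replace (- r) with (q * / (- (a * d))).
    2:{ unfold r. field. auto. }
    assert (Nad : - (a * d) <> 0).
    { intros N. apply (Cmult_neq_0 a d Ha Hd). replace (a * d) with (- - (a * d)) by ring. rewrite N. ring. }
    rewrite Cpow_mult_l, Cpow_inv, Cpow_add_r by auto. field. now apply Cpow_nz. }
  rewrite Y.
  replace (q ^ (tri m + m)) with ((- (d / a)) ^ m * qp (q * a / d) m / qp (d / a / q ^ m) m).
  2:{ rewrite <- Rv. field. auto. }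
  assert (N11 : a ^ (2 * m) <> 0) by now apply Cpow_nz.
  generalize dependent (a ^ (2 * m)). generalize dependent ((- (d / a)) ^ m).
  generalize dependent (qp (d / a / q ^ m) m). generalize dependent (qp (q * a / d) m).
  generalize dependent (qp (q * b / d) m). generalize dependent (qp (q * c / d) m).
  generalize dependent (qp (b * c) m). generalize dependent (pinf (b * c * q ^ m)).
  generalize dependent (pinf (d / a)). generalize dependent (qp q m).
  generalize (EE p1 p2 r a x m), (EE p1 p2 r ta g m), (qp A m), (qp p1 m), (qp p2 m), (RtoC q ^ (2 * m)).
  clearbody A. intros. field. repeat split; auto.
Qed.

Lemma gauss_s0_neq_0 : gauss q (tau_sigma_tau q al) (spec q (inv_tau q al) 0) <> 0.
Proof.
  destruct abcd_neq_0 as (Ha & _). destruct generic_qnv as (_ & _ & G3 & _ & _ & _ & _ & _ & G9).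
  unfold gauss. rewrite gauss_den_tau_sigma_tau. simpl (q ^ 0).
  replace (d / a / 1) with (d / a) by (field; auto). rewrite Cmult_1_r.
  assert (N : pinf (b * c) * pinf (d / a) <> 0) by (apply Cmult_neq_0; now apply pinf_neq_0).
  intros E. apply C1_nz. rewrite <- (Cinv_r _ N), E. ring.
Qed.

Lemma expansion (g x : C) : g <> 0 -> x <> 0 ->
  ser (bilin_term g x) (AWfun_an q al g x).
Proof. intros Hg Hx. rewrite AWfun_an_eq by auto. now apply bilin_ser. Qed.

End Application.
End Poch.

Theorem theorem4p2 (q : R) (hq : (0 < q < 1)%R) (a b c d : C)
    (hgen : generic q (Params a b c d)) (ha : (0 < Re a)%R)
    (g x : C) (hg : g <> 0) (hx : x <> 0) :
  let al := Params a b c d in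
  let ta := pa (inv_sigma q al) in
  let summand := fun s : C =>
    weight_sigma q (inv_tau q al) s * gauss q (tau_sigma_tau q al) s
    * AWpoly q (sigma_tau q al) s g * AWpoly q (inv_tau q al) s x in
  let term := fun m : nat =>
    phi43 q (/ q ^ m) (q ^ m * a * b * c / d) (a * x) (a / x)
      (a * b) (a * c) (q * a / d) q
    * phi43 q (/ q ^ m) (q ^ m * a * b * c / d) (ta * g) (ta / g)
      (a * b) (a * c) (b * c) q
    * (((1 - a * b * c * q ^ (2 * m) / d) * qpochs q [a * b * c / d; a * b; a * c] m)
       / ((1 - a * b * c / d) * qpochs q [RtoC q; q * b / d; q * c / d] m))
    * (- (1) / (a * d)) ^ m * q ^ (Nat.div (m * (m + 1)) 2) in
  (spec_summable q (inv_tau q al) summand /\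
   AWfun_an q al g x
   = / gauss q (tau_sigma_tau q al) (spec q (inv_tau q al) 0)
     * spec_sum q (inv_tau q al) summand) /\
  (ex_series term /\ AWfun_an q al g x = CSeries term).
Proof.
  intros al ta summand term.
  pose proof (expansion q hq a b c d hgen g x hg hx) as E. fold al in E.
  set (F := AWfun_an q al g x) in *.
  set (c0 := gauss q (tau_sigma_tau q al) (spec q (inv_tau q al) 0)).
  assert (S1 : ser (fun m => summand (spec q (inv_tau q al) m)) (c0 * F)).
  { apply ser_ext with (fun m => c0 * bilin_term q a b c d g x m).
    - intros m. symmetry. unfold summand, c0, al. exact (summand_eq q hq a b c d hgen g x m).
    - now apply ser_scal. }
  assert (S2 : ser term F).
  { apply ser_ext with (bilin_term q a b c d g x); auto.
    intros m. symmetry. unfold term, ta, al. exact (term_eq q hq a b c d hgen g x m). }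
  split; split.
  - exists (c0 * F). now apply ser_is_series.
  - unfold spec_sum. rewrite (CSeries_ser _ _ S1). field.
    now apply (gauss_s0_neq_0 q hq a b c d hgen).
  - exists F. now apply ser_is_series.
  - now rewrite (CSeries_ser _ _ S2).
Qed.
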